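(* Let $\Omega$ be a nonempty open set in $\mathbb{R}^n$ that has the interior Lipschitz property. Suppose that $s_1,s_2\in\mathbb{R}$ and $1<p_1,p_2<\infty$ are such that $W^{s_1,p_1}(U)\hookrightarrow W^{s_2,p_2}(U)$ for all bounded open sets $U\subseteq\mathbb{R}^n$ with Lipschitz continuous boundary. If $s_1<0$, further assume that $(-s_1,p_1',\Omega)$ is a smooth multiplication triple. If $s_2<0$, further assume that $(-s_2,p_2',\Omega)$ is a smooth multiplication triple. Then $W^{s_1,p_1}_{loc}(\Omega)\hookrightarrow W^{s_2,p_2}_{loc}(\Omega)$.
   Context: All functions are real-valued. For $1<p<\infty$, $p'$ denotes the conjugate exponent, $\frac1p+\frac1{p'}=1$. $C_c^\infty(\Omega)$ is the set of smooth functions with compact support in $\Omega$; $D'(\Omega)$ is the space of distributions on $\Omega$. A nonempty open set $\Omega\subseteq\mathbb{R}^n$ has the interior Lipschitz property if for each compact $K\subseteq\Omega$ there is a bounded open set $\Omega'\subseteq\Omega$ with Lipschitz continuous boundary such that $K\subseteq\Omega'$. Sobolev-Slobodeckij spaces: for $k\in\mathbb{N}_0$, $W^{k,p}(\Omega)=\{u\in L^p(\Omega):\|u\|_{W^{k,p}(\Omega)}:=\sum_{|\nu|\le k}\|\partial^\nu u\|_{L^p(\Omega)}<\infty\}$; for $0<\theta<1$, $|u|_{W^{\theta,p}(\Omega)}:=\big(\iint_{\Omega\times\Omega}\frac{|u(x)-u(y)|^p}{|x-y|^{n+\theta p}}dx\,dy\big)^{1/p}$; for $s=k+\theta$ with $k\in\mathbb{N}_0$,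 $0<\theta<1$, $W^{s,p}(\Omega)=\{u\in W^{k,p}(\Omega):\|u\|_{W^{s,p}(\Omega)}:=\|u\|_{W^{k,p}(\Omega)}+\sum_{|\nu|=k}|\partial^\nu u|_{W^{\theta,p}(\Omega)}<\infty\}$. $W^{s,p}_0(\Omega)$ is the closure of $C_c^\infty(\Omega)$ in $W^{s,p}(\Omega)$. For $s<0$, $W^{s,p}(\Omega)=(W^{-s,p'}_0(\Omega))^*$ with the dual norm, viewed as a subspace of $D'(\Omega)$ by restricting functionals to $C_c^\infty(\Omega)$. For $s\in\mathbb{R}$, $W^{s,p}_{loc}(\Omega)=\{u\in D'(\Omega):\varphi u\in W^{s,p}(\Omega)\ \forall\varphi\in C_c^\infty(\Omega)\}$, equipped with the topology induced by the family of seminorms $u\mapsto\|\varphi u\|_{W^{s,p}(\Omega)}$, $\varphi\in C_c^\infty(\Omega)$. The triple $(s,p,\Omega)$ is a smooth multiplication triple if for every $\varphi\in C_c^\infty(\Omega)$ the map $u\mapsto\varphi u$ is well-defined and bounded from $W^{s,p}(\Omega)$ to $W^{s,p}(\Omega)$. $X\hookrightarrow Y$ means $X\subseteq Y$ and the inclusion map is continuous. *)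

(* Defs.v *)
From HB Require Import structures.
From mathcomp Require Import all_boot all_order all_algebra.
From mathcomp Require Import all_classical all_reals all_analysis.

Set Implicit Arguments.
Unset Strict Implicit.
Unset Printing Implicit Defensive.

Import Order.TTheory GRing.Theory Num.Theory.
Import numFieldNormedType.Exports.

Local Open Scope classical_set_scope.
Local Open Scope ring_scope.

Definition rV_display : measure_display. Proof. exact: default_measure_display. Qed.

(* The sigma-algebra generated by the coordinates, i.e. the Borel sets. *)
Section rV_measurable.
Context (R : realType) (n : nat).

Definition rV_coord (i : 'I_n) (x : 'rV[R]_n) : measurableTypeR R := x ord0 i.

Let rV_set0 : g_sigma_preimage rV_coord set0.
Proof. exact: sigma_algebra0. Qed.

Let rV_setC A : g_sigma_preimage rV_coord A -> g_sigma_preimage rV_coord (~` A).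
Proof. exact: sigma_algebraC. Qed.

Let rV_bigcup (F : _^nat) : (forall i, g_sigma_preimage rV_coord (F i)) ->
  g_sigma_preimage rV_coord (\bigcup_i (F i)).
Proof. exact: sigma_algebra_bigcup. Qed.

HB.instance Definition _ := @isMeasurable.Build rV_display
  'rV[R]_n (g_sigma_preimage rV_coord) rV_set0 rV_setC rV_bigcup.

Lemma measurable_rV_coord (i : 'I_n) : measurable_fun [set: 'rV[R]_n] (rV_coord i).
Proof.
move=> _ Y mY; rewrite setTI; apply: sub_sigma_algebra => /=.
rewrite -bigcup_seq/=; exists i => /=; first by rewrite mem_index_enum.
by exists Y => //; rewrite setTI.
Qed.

Lemma measurable_fun_rVP d (T : measurableType d) (f : T -> 'rV[R]_n) :
  (forall i, measurable_fun [set: T] (rV_coord i \o f)) ->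
  measurable_fun [set: T] f.
Proof.
move=> mf.
suff prefS : g_sigma_preimage (fun i => rV_coord i \o f) `<=` measurable.
  rewrite g_sigma_preimage_comp in prefS.
  by move=> _ A mA; apply: prefS; exists A.
apply: smallest_sub; first exact: sigma_algebra_measurable.
rewrite -bigcup_seq/=; apply: bigcup_sub => i _.
by move=> A [B mB <-]; exact: mf.
Qed.

End rV_measurable.

Section rV_cons.
Context (R : realType) (n : nat).

Definition rV_cons (z : measurableTypeR R * 'rV[R]_n) : 'rV[R]_n.+1 :=
  \row_i (if unlift ord0 i is Some j then z.2 ord0 j else z.1).

Definition rV_uncons (x : 'rV[R]_n.+1) : measurableTypeR R * 'rV[R]_n :=
  (x ord0 ord0, \row_j x ord0 (lift ord0 j)).

Lemma rV_consK : cancel rV_cons rV_uncons.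
Proof.
move=> [a v]; rewrite /rV_uncons /rV_cons mxE unlift_none; congr pair.
by apply/rowP => j; rewrite !mxE liftK.
Qed.

Lemma rV_unconsK : cancel rV_uncons rV_cons.
Proof.
move=> x; apply/rowP => i; rewrite mxE /=.
by case: unliftP => [j|] -> //; rewrite mxE.
Qed.

Lemma measurable_rV_cons : measurable_fun setT rV_cons.
Proof.
apply: measurable_fun_rVP => i; case: (unliftP ord0 i) => [j|] ->.
  rewrite (_ : _ \o _ = @rV_coord R n j \o snd).
    by apply: measurableT_comp; [exact: measurable_rV_coord|exact: measurable_snd].
  by apply/funext => z; rewrite /= /rV_coord mxE liftK.
rewrite (_ : _ \o _ = fst); first exact: measurable_fst.
by apply/funext => z; rewrite /= /rV_coord mxE unlift_none.
Qed.

Lemma measurable_rV_uncons : measurable_fun setT rV_uncons.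
Proof.
apply/measurable_fun_pairP; split; first exact: (@measurable_rV_coord R n.+1).
apply: measurable_fun_rVP => i.
rewrite (_ : _ \o _ = rV_coord (lift ord0 i)); first exact: measurable_rV_coord.
by apply/funext => x; rewrite /= /rV_coord mxE.
Qed.

Variable mu : {sigma_finite_measure set 'rV[R]_n -> \bar R}.

Definition cons_measure : set 'rV[R]_n.+1 -> \bar R :=
  pushforward (lebesgue_measure \x mu)%E rV_cons.

Let cons_measure0 : cons_measure set0 = 0%E.
Proof. by rewrite /cons_measure /pushforward preimage_set0 measure0. Qed.

Let measurable_preimage_cons (A : set 'rV[R]_n.+1) :
  measurable A -> measurable (rV_cons @^-1` A).
Proof. by move=> mA; rewrite -[X in measurable X]setTI; exact: measurable_rV_cons. Qed.

Let cons_measure_ge0 A : (0 <= cons_measure A)%E.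
Proof. by rewrite /cons_measure /pushforward; apply: measure_ge0. Qed.

Let cons_measure_sigma_additive : semi_sigma_additive cons_measure.
Proof.
move=> F mF tF mUF; rewrite /cons_measure /pushforward preimage_bigcup.
apply: measure_semi_sigma_additive.
- by move=> k; exact: measurable_preimage_cons.
- apply/trivIsetP => /= i j _ _ ij; rewrite -preimage_setI.
  by move/trivIsetP : tF => /(_ _ _ _ _ ij) ->//; rewrite preimage_set0.
- by rewrite -preimage_bigcup; exact: measurable_preimage_cons.
Qed.

HB.instance Definition _ := isMeasure.Build _ _ _
  cons_measure cons_measure0 cons_measure_ge0 cons_measure_sigma_additive.

Let cons_measure_sigma_finite : sigma_finite setT cons_measure.
Proof.
have /sigma_finiteP[F [TF ndF Foo]] := sigma_finiteT
  [the {sigma_finite_measure set _ -> \bar R} of @lebesgue_measure R].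
have /sigma_finiteP[G [TG ndG Goo]] := sigma_finiteT mu.
exists (fun k => rV_uncons @^-1` (F k `*` G k)).
  rewrite -preimage_bigcup [X in _ @^-1` X](_ : _ = setT) ?preimage_setT//.
  apply/seteqP; split => // -[x y] _.
  have [k _ Fk] : (\bigcup_k F k) x by rewrite -TF.
  have [l _ Gl] : (\bigcup_k G k) y by rewrite -TG.
  exists (maxn k l) => //; split => /=.
    by move: x Fk; exact/subsetPset/ndF/leq_maxl.
  by move: y Gl; exact/subsetPset/ndG/leq_maxr.
move=> k; have [mF Fk] := Foo k; have [mG Gk] := Goo k.
have mFG := measurableX mF mG; split.
  by rewrite -[X in measurable X]setTI; exact: measurable_rV_uncons.
rewrite /cons_measure /pushforward (_ : _ @^-1` _ = F k `*` G k); last first.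
  rewrite -comp_preimage (_ : rV_uncons \o rV_cons = id)//.
  by apply/funext => z; exact: rV_consK.
by rewrite product_measure1E// lte_mul_pinfty// ge0_fin_numE.
Qed.

HB.instance Definition _ := Measure_isSigmaFinite.Build _ _ _ cons_measure
  cons_measure_sigma_finite.

End rV_cons.

Section lebesgue_rV.
Context (R : realType).

(* R^0 is a point of mass 1, and R^(n+1) = R x R^n carries the product measure. *)
Fixpoint lebesgue_rV (n : nat) : {sigma_finite_measure set 'rV[R]_n -> \bar R} :=
  match n with
  | 0 => dirac (0 : 'rV[R]_0)
  | m.+1 => cons_measure (lebesgue_rV m)
  end.

Lemma measurable_rV_box n (A : 'I_n -> set (measurableTypeR R)) :
  (forall i, measurable (A i)) ->
  measurable [set x : 'rV[R]_n | forall i, A i (x ord0 i)].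
Proof.
move=> mA; rewrite (_ : mkset _ =
    \big[setI/setT]_(i < n) (@rV_coord R n i @^-1` A i)); last first.
  rewrite -bigcap_seq; apply/seteqP; split=> x /= h i.
    by move=> _; exact: h.
  by apply: (h i); exact: mem_index_enum.
apply: bigsetI_measurable => i _.
by rewrite -[X in measurable X]setTI; exact: measurable_rV_coord.
Qed.

Lemma lebesgue_rV_box n (A : 'I_n -> set (measurableTypeR R)) :
  (forall i, measurable (A i)) ->
  lebesgue_rV n [set x | forall i, A i (x ord0 i)] =
  (\prod_(i < n) lebesgue_measure (A i))%E.
Proof.
elim: n A => [|n IH] A mA; first by rewrite big_ord0 /= diracE mem_set// => -[].
rewrite big_ord_recl /= /cons_measure /pushforward.
rewrite (_ : _ @^-1` _ = A ord0 `*`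
    [set x : 'rV[R]_n | forall i, A (lift ord0 i) (x ord0 i)]).
  rewrite product_measure1E //.
    by congr (_ * _)%E; apply: IH => i; exact: mA.
  by apply: (@measurable_rV_box n (fun i => A (lift ord0 i))) => i; exact: mA.
apply/seteqP; split => [[a v] /= h|[a v] [/= Aa Av] i].
  split; first by have := h ord0; rewrite mxE unlift_none.
  by move=> i; have := h (lift ord0 i); rewrite mxE liftK.
by rewrite mxE; case: unliftP => [j|] ->.
Qed.

End lebesgue_rV.

Section smooth.
Context (R : realType) (n : nat).
Implicit Types (f g : 'rV[R]_n -> R) (A K Omega : set 'rV[R]_n).

Definition basis_vec (i : 'I_n) : 'rV[R]_n := delta_mx ord0 i.

Fixpoint Ck (k : nat) f : Prop :=
  continuous f /\
  match k with
  | 0 => True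
  | k'.+1 => forall i : 'I_n,
      (forall x, derivable f x (basis_vec i)) /\ Ck k' ('D_(basis_vec i) f)
  end.

Definition smooth f := forall k, Ck k f.

Definition supp f : set 'rV[R]_n := closure [set x | f x != 0].

Definition test_function Omega f :=
  [/\ smooth f, compact (supp f) & supp f `<=` Omega].

Lemma CkW k f : Ck k.+1 f -> Ck k f.
Proof.
elim: k f => [|k IH] f [cf df]; split=> // i; have [dfi Cfi] := df i.
by split=> //; exact: IH.
Qed.

Lemma Ck_cst0 k : Ck k (cst 0 : 'rV[R]_n -> R).
Proof.
elim: k => [|k IH]; split=> //; try exact: cst_continuous.
move=> i; split; first by move=> x; exact: derivable_cst.
by rewrite (_ : 'D__ _ = cst 0)//; apply/funext => x; rewrite derive_cst.
Qed.

Lemma CkD k f g : Ck k f -> Ck k g -> Ck k (f + g).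
Proof.
elim: k f g => [|k IH] f g [cf df] [cg dg]; split=> //;
  try by move=> x; apply: continuousD; [exact: cf|exact: cg].
move=> i; have [dfi Cfi] := df i; have [dgi Cgi] := dg i.
split; first by move=> x; exact: derivableD.
rewrite (_ : 'D__ _ = 'D_(basis_vec i) f + 'D_(basis_vec i) g); first exact: IH.
by apply/funext => x; rewrite deriveD.
Qed.

Lemma CkM k f g : Ck k f -> Ck k g -> Ck k (f * g).
Proof.
elim: k f g => [|k IH] f g Cf Cg; have [cf df] := Cf; have [cg dg] := Cg;
  split=> //; try by move=> x; apply: continuousM; [exact: cf|exact: cg].
move=> i; have [dfi Cfi] := df i; have [dgi Cgi] := dg i.
split; first by move=> x; exact: derivableM.
rewrite (_ : 'D__ _ = f * 'D_(basis_vec i) g + g * 'D_(basis_vec i) f).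
  by apply: CkD; apply: IH => //; exact: CkW.
by apply/funext => x; rewrite deriveM.
Qed.

Lemma Ck_cst k (c : R) : Ck k (cst c : 'rV[R]_n -> R).
Proof.
case: k => [|k]; split=> //; try exact: cst_continuous.
move=> i; split; first by move=> x; exact: derivable_cst.
rewrite (_ : 'D__ _ = cst 0); first exact: Ck_cst0.
by apply/funext => x; rewrite derive_cst.
Qed.

Lemma supp_sub f K : compact K -> (forall x, ~ K x -> f x = 0) ->
  compact (supp f) /\ supp f `<=` K.
Proof.
move=> cK fK.
have sK : supp f `<=` K.
  have /closure_id -> : closed K.
    by apply: compact_closed => //; exact: norm_hausdorff.
  apply: closure_subset => x /= /eqP fx.
  by apply: contrapT => /fK.
by split=> //; apply: subclosed_compact sK => //; exact: closed_closure.
Qed.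

Lemma supp_out f x : ~ supp f x -> f x = 0.
Proof.
move=> nfx; apply: contrapT => /eqP fx; apply: nfx.
exact: subset_closure.
Qed.

Lemma test_function_sub Omega f K : smooth f -> compact K -> K `<=` Omega ->
  (forall x, ~ K x -> f x = 0) -> test_function Omega f.
Proof.
move=> sf cK KO fK; have [csf sfK] := supp_sub cK fK.
by split=> // x /sfK /KO.
Qed.

Lemma test_functionMl Omega f g : smooth f -> test_function Omega g ->
  test_function Omega (f * g).
Proof.
move=> sf [sg cg gO]; apply: (@test_function_sub _ _ (supp g)) => //.
  by move=> k; exact: CkM.
by move=> x /supp_out gx; rewrite (_ : (f * g) x = f x * g x)// gx mulr0.
Qed.

Lemma test_function_partial Omega f i : test_function Omega f ->
  test_function Omega ('D_(basis_vec i) f).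
Proof.
move=> [sf cf fO]; apply: (@test_function_sub _ _ (supp f)) => //.
  by move=> k; have [_ /(_ i) []] := sf k.+1.
move=> x nfx.
have : open (~` supp f) by apply: closed_openC; exact: closed_closure.
rewrite openE => /(_ x nfx) /= f0.
rewrite (@near_eq_derive _ _ _ f (cst 0)) ?derive_cst//.
by apply: filterS f0 => y; exact: supp_out.
Qed.

End smooth.

Section testfun.
Context (R : realType) (n : nat) (Omega : set 'rV[R]_n).

Definition test_pred : {pred 'rV[R]_n -> R^o} :=
  mem [set f | test_function Omega f].

Lemma test_pred_submod_closed : submod_closed test_pred.
Proof.
split.
  rewrite inE; apply: (@test_function_sub _ _ _ _ set0) => //.
  - by move=> k; exact: Ck_cst0.
  - exact: compact0.
move=> a f g; rewrite !inE => tf [sg cg gO].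
have [saf caf afO] : test_function Omega (cst a * f).
  by apply: test_functionMl => // k; exact: Ck_cst.
apply: (@test_function_sub _ _ _ _ (supp (cst a * f) `|` supp g)).
- by move=> k; apply: (@CkD _ _ k (cst a * f) g); [exact: saf|exact: sg].
- exact: compactU.
- by rewrite subUset.
- move=> x /not_orP[/supp_out afx /supp_out gx].
  by rewrite (_ : (a *: f + g) x = (cst a * f) x + g x)// afx gx addr0.
Qed.

HB.instance Definition _ :=
  GRing.isSubmodClosed.Build R _ test_pred test_pred_submod_closed.

Record testfun := TestFun {
  testfun_val :> 'rV[R]_n -> R^o;
  testfun_valP : testfun_val \in test_pred
}.

HB.instance Definition _ := [isSub for testfun_val].
HB.instance Definition _ := [Choice of testfun by <:].
HB.instance Definition _ := [SubChoice_isSubLmodule of testfun by <:].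

Lemma testfunP (phi : testfun) : test_function Omega phi.
Proof. by have := testfun_valP phi; rewrite inE. Qed.

Lemma testfun_mul_subproof (phi psi : testfun) :
  ((phi : 'rV[R]_n -> R) * (psi : 'rV[R]_n -> R)) \in test_pred.
Proof.
by rewrite inE; apply: test_functionMl; [case: (testfunP phi)|exact: testfunP].
Qed.

Definition testfun_mul (phi psi : testfun) : testfun :=
  TestFun (testfun_mul_subproof phi psi).

Lemma testfun_partial_subproof (i : 'I_n) (phi : testfun) :
  'D_(basis_vec R i) phi \in test_pred.
Proof. by rewrite inE; apply: test_function_partial; exact: testfunP. Qed.

Definition testfun_partial (i : 'I_n) (phi : testfun) : testfun :=
  TestFun (testfun_partial_subproof i phi).

End testfun.

(* The multi-indices all of whose entries are at most k. *)
Definition mindex (n k : nat) := {ffun 'I_n -> 'I_k.+1}.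

Definition mdeg n k (nu : mindex n k) : nat := (\sum_(i < n) nu i)%N.

Section distributions.
Context (R : realType) (n : nat) (Omega : set 'rV[R]_n).
Local Notation D := (testfun Omega).

Definition testfun_deriv k (nu : mindex n k) (phi : D) : D :=
  foldr (fun i => iter (nu i) (testfun_partial i)) phi (enum 'I_n).

Definition Cnorm (N : nat) (phi : D) : R :=
  \sum_(nu : mindex n N | (mdeg nu <= N)%N)
    sup [set `|testfun_deriv nu phi x| | x in setT].

Definition distributions : set (D -> R^o) :=
  [set u | linear u /\
    forall K, compact K -> K `<=` Omega ->
    exists (C : R) (N : nat), forall phi : D,
      supp phi `<=` K -> `|u phi| <= C * Cnorm N phi].

Definition dist_mul (phi : D) (u : D -> R^o) : D -> R^o :=
  fun psi => u (testfun_mul phi psi).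

Definition dist_deriv k (nu : mindex n k) (u : D -> R^o) : D -> R^o :=
  fun phi => (-1) ^+ mdeg nu * u (testfun_deriv nu phi).

Definition regular_dist (f : 'rV[R]_n -> R) : D -> R^o :=
  fun phi => \int[lebesgue_rV R n]_(x in Omega) (f x * phi x).

End distributions.

Section sobolev.
Context (R : realType) (n : nat) (Omega : set 'rV[R]_n).
Local Notation D := (testfun Omega).
Local Notation mu := (lebesgue_rV R n).
Local Open Scope ereal_scope.

Definition eucl_norm (x : 'rV[R]_n) : R := Num.sqrt (\sum_(i < n) x ord0 i ^+ 2).

Definition Lp_fun (p : R) : set ('rV[R]_n -> R) :=
  [set f | f \_ Omega \in Lfun mu p%:E].

Definition Lp_norm (p : R) (f : 'rV[R]_n -> R) : \bar R :=
  'N[mu]_p%:E [EFin \o (f \_ Omega)].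

Definition slobodeckij (theta p : R) (f : 'rV[R]_n -> R) : \bar R :=
  (\int[mu \x mu]_(z in Omega `*` Omega)
     (`|f z.1 - f z.2| `^ p / eucl_norm (z.1 - z.2) `^ (n%:R + theta * p))%:E)
  `^ p^-1.

Definition Lp_reps (p : R) (u : D -> R^o) : set ('rV[R]_n -> R) :=
  [set f | Lp_fun p f /\ u = regular_dist f].

(* Representatives of u in L^p(Omega) agree almost everywhere, so each of the
   two infima below ranges over at most one value; it is +oo if there is no
   representative. *)
Definition dist_Lp_norm (p : R) (u : D -> R^o) : \bar R :=
  ereal_inf [set Lp_norm p f | f in Lp_reps p u].

Definition dist_slobodeckij (theta p : R) (u : D -> R^o) : \bar R :=
  ereal_inf [set slobodeckij theta p f | f in Lp_reps p u].

(* The norm of W^{s,p}(Omega) for s >= 0, with value +oo off the space. *)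
Definition sobolev_norm_nneg (s p : R) (u : D -> R^o) : \bar R :=
  let k := Num.truncn s in
  let theta := (s - k%:R)%R in
  \sum_(nu : mindex n k | (mdeg nu <= k)%N) dist_Lp_norm p (dist_deriv nu u) +
  (if theta == 0%R then 0 else
   \sum_(nu : mindex n k | mdeg nu == k)
     dist_slobodeckij theta p (dist_deriv nu u)).

Definition sobolev_nneg (s p : R) : set (D -> R^o) :=
  [set u | distributions u /\ sobolev_norm_nneg s p u < +oo].

Definition sobolev0 (s p : R) : set (D -> R^o) :=
  [set u | sobolev_nneg s p u /\
    forall e : R, (0 < e)%R ->
    exists phi : D, sobolev_norm_nneg s p (u - regular_dist phi)%R < e%:E].

Definition dual_norm (s p : R) (F : (D -> R^o) -> R) : \bar R :=
  ereal_sup [set `|F v|%:E |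
    v in [set v | sobolev0 s p v /\ sobolev_norm_nneg s p v <= 1]].

Definition sobolev0_dual (s p : R) : set ((D -> R^o) -> R) :=
  [set F |
    (forall (a : R) v w, sobolev0 s p v -> sobolev0 s p w ->
       F (a *: v + w) = a * F v + F w)%R /\
    dual_norm s p F < +oo].

Definition conj_exp (p : R) : R := (1 - p^-1)^-1%R.

(* The norm of W^{s,p}(Omega) for s < 0. By density of the test functions in
   sobolev0, there is at most one F that restricts to u, up to its values off
   sobolev0; the infimum is +oo if there is none. *)
Definition sobolev_norm_neg (s p : R) (u : D -> R^o) : \bar R :=
  ereal_inf [set dual_norm (- s) (conj_exp p) F |
    F in [set F | sobolev0_dual (- s) (conj_exp p) F /\
                  forall phi : D, F (regular_dist phi) = u phi]].

Definition sobolev_norm (s p : R) (u : D -> R^o) : \bar R :=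
  if (0 <= s)%R then sobolev_norm_nneg s p u else sobolev_norm_neg s p u.

Definition sobolev (s p : R) : set (D -> R^o) :=
  [set u | distributions u /\ sobolev_norm s p u < +oo].

Definition sobolev_loc (s p : R) : set (D -> R^o) :=
  [set u | distributions u /\ forall phi : D, sobolev s p (dist_mul phi u)].

Definition smooth_mult_triple (s p : R) : Prop :=
  forall phi : D,
    (forall u, sobolev s p u -> sobolev s p (dist_mul phi u)) /\
    exists C : R, forall u, sobolev s p u ->
      sobolev_norm s p (dist_mul phi u) <= C%:E * sobolev_norm s p u.

End sobolev.

Section embedding.
Context (R : realType) (E : zmodType).

(* The neighbourhoods of u in the topology induced on X by the seminorms q i. *)
Definition seminorm_nbhs I (X : set E) (q : I -> E -> \bar R) (u : E)
    (V : set E) : Prop :=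
  exists F : set I, finite_set F /\
  exists e : R, 0 < e /\
    forall v, X v -> (forall i, F i -> (q i (v - u)%R < e%:E)%E) -> V v.

Definition cont_embedding I J (X : set E) (q : I -> E -> \bar R)
    (Y : set E) (r : J -> E -> \bar R) : Prop :=
  X `<=` Y /\
  forall u V, X u -> seminorm_nbhs Y r u V -> seminorm_nbhs X q u V.

End embedding.

Section sobolev_embedding.
Context (R : realType) (n : nat) (Omega : set 'rV[R]_n).

Definition sobolev_embedding (s1 p1 s2 p2 : R) : Prop :=
  cont_embedding
    (@sobolev R n Omega s1 p1) (fun _ : unit => sobolev_norm s1 p1)
    (@sobolev R n Omega s2 p2) (fun _ : unit => sobolev_norm s2 p2).

Definition sobolev_loc_embedding (s1 p1 s2 p2 : R) : Prop :=
  cont_embedding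
    (@sobolev_loc R n Omega s1 p1)
    (fun (phi : testfun Omega) u => sobolev_norm s1 p1 (dist_mul phi u))
    (@sobolev_loc R n Omega s2 p2)
    (fun (phi : testfun Omega) u => sobolev_norm s2 p2 (dist_mul phi u)).

End sobolev_embedding.

Section lipschitz_domains.
Context (R : realType) (n : nat).
Implicit Types (U Omega K : set 'rV[R]_n).

(* Near each boundary point, and in suitable orthonormal coordinates
   y = x *m Q, the set U is the region above the graph of a Lipschitz function
   of the n - 1 coordinates other than y_i. *)
Definition lipschitz_boundary U : Prop :=
  forall x0, (closure U `\` U°) x0 ->
  exists (Q : 'M[R]_n) (i : 'I_n) (gamma : 'rV[R]_n.-1 -> R),
    [/\ Q *m Q^T = 1%:M, lipschitz gamma &
      \forall x \near x0,
        U x <-> gamma (col' i (x *m Q)) < (x *m Q) ord0 i].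

Definition bounded_lipschitz U : Prop :=
  [/\ open U, bounded_set U & lipschitz_boundary U].

Definition interior_lipschitz Omega : Prop :=
  forall K, compact K -> K `<=` Omega ->
  exists U, [/\ bounded_lipschitz U, U `<=` Omega & K `<=` U].

End lipschitz_domains.

(* Main.v *)
Require Import Defs.
From mathcomp Require Import all_boot all_order all_algebra finmap.
From mathcomp Require Import all_classical all_reals all_analysis.
From mathcomp Require Import measurable_realfun.
From mathcomp Require Import ring lra.

Set Implicit Arguments.
Unset Strict Implicit.
Unset Printing Implicit Defensive.

Import Order.TTheory GRing.Theory Num.Theory.
Import numFieldNormedType.Exports.

Local Open Scope classical_set_scope.
Local Open Scope ring_scope.

                         

(** Fix a test function [phi] on [Omega]. Its support is compact, hence contained in a bounded
    Lipschitz open set [U] inside [Omega], and some test function [chi] on [U] equals 1 near that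
    support. The product [phi w] with a distribution [w] lives near the support of [phi], so its
    norm on [Omega] should be comparable with the norm on [U] of its restriction. This gives a
    chain: the (s2,p2)-norm of [phi w] on [Omega] is bounded by that of the restriction to [U]; the
    assumed embedding on [U] passes from (s2,p2) to (s1,p1); and the (s1,p1)-norm of the restriction
    is bounded by that of [phi w] on [Omega]. The constants do not depend on [w], so the chain
    yields the inclusion of the local spaces and, one seminorm at a time, the continuity of the
    inclusion.

    The two comparisons are [sobolev_norm_dist_restrict] and [sobolev_norm_dist_extend]. For
    nonnegative order, restricting only shrinks the domains of integration. In the other direction,
    [phi w] and its derivatives act on [psi] as those of the restriction act on [chi psi]; it
    remains to bound multiplication of a representative by [chi], followed by extension by zero, in
    L^p and in the Slobodeckij seminorm ([slob_int_cutoff], [sobolev_norm_cut]). For negative order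
    both comparisons are transposes of maps between test functions ([sobolev_norm_neg_comp]).
    Restriction is dual to [psi |-> chi psi] from [U] to [Omega], which Leibniz's rule bounds in the
    norm of positive order ([sobolev_norm_cutoff]). Extension is dual to [psi |-> chi psi] from
    [Omega] to [U], which the smooth multiplication property bounds.

    The analysis underneath rests on the integrability of the truncated Slobodeckij kernel
    ([trunc_kernel_lty]) and on the agreement almost everywhere, after a cut-off, of two
    representatives of one distribution ([representatives_ae_eq]). Since only boundedness matters,
    the norms are treated as quasi-norms whose triangle inequality has constant 2, and functionals
    are extended from test functions to their closure by an explicit infimum ([dual_extension]). *)

(** * Borel sets and measurable operations on row vectors *)

Section rV_borel.
Context {R : realType} {n : nat}.
Local Notation X := 'rV[R]_n.

Lemma rV_normltP (x : X) (e : R) : 0 < e -> `|x| < e <-> forall i, `|x ord0 i| < e.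
Proof.
move=> e0; rewrite {1}/Num.norm /= mx_normrE; split.
  by move=> /bigmax_ltP[_ h] i; exact: (h (ord0, i)).
move=> h; apply/bigmax_ltP; split=> // -[i j] _ /=.
by rewrite (ord1 i).
Qed.

Lemma rV_coord_le_norm (x : X) i : `|x ord0 i| <= `|x|.
Proof.
rewrite [leRHS]/Num.norm /= mx_normrE.
exact: (le_bigmax _ (fun ij : 'I_1 * 'I_n => `|x ij.1 ij.2|) (ord0, i)).
Qed.

Lemma measurable_rV_ball (x : X) (e : R) : 0 < e -> measurable (ball x e).
Proof.
move=> e0; rewrite (_ : ball x e = [set y : X | forall i, (ball (x ord0 i) e : set (measurableTypeR R)) (y ord0 i)]).
  by apply: (@measurable_rV_box R n (fun i => ball (x ord0 i) e)) => i; exact: open_measurable (ball_open _ _).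
rewrite -ball_normE; apply/seteqP; split => y /=.
  by move=> /rV_normltP-/(_ e0) h i; have := h i; rewrite !mxE -ball_normE.
by move=> h; apply/rV_normltP => // i; have := h i; rewrite !mxE -ball_normE.
Qed.

(** The sigma-algebra is generated by the coordinates, so the topology enters through a countable
    base: [U] is the union of the balls of rational centre and radius inside it. The norm is the sup
    norm, so these balls are boxes. *)
Lemma open_measurable_rV (U : set X) : open U -> measurable U.
Proof.
move=> oU.
pose F (q : 'rV[rat]_n * rat) : set X :=
  [set y | ball (map_mx ratr q.1 : X) (ratr q.2) `<=` U /\
    (0 < (ratr q.2 : R)) /\ ball (map_mx ratr q.1 : X) (ratr q.2) y].
rewrite (_ : U = \bigcup_q F q); last first.
  apply/seteqP; split=> [x Ux|x [q _ [qU [_ qx]]]]; last exact: qU.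
  have /nbhs_ballP[e /= e0 eU] : nbhs x U by exact: open_nbhs_nbhs.
  have e20 : 0 < e / 2 by rewrite divr_gt0.
  have [r] := @rat_in_itvoo R 0 (e / 2) e20; rewrite in_itv/= => /andP[r0 re].
  have /fin_all_exists[q qP] : forall i, exists q : rat, `|x ord0 i - ratr q| < ratr r.
    move=> i; have [q] := @rat_in_itvoo R (x ord0 i - ratr r) (x ord0 i + ratr r)
      (ltac:(lra)); rewrite in_itv/= => /andP[q1 q2]; exists q.
    by rewrite distrC ltr_distl q1.
  have xq : ball (map_mx ratr (\row_i q i) : X) (ratr r : R) x.
    rewrite -ball_normE /=; apply/rV_normltP => // i.
    by rewrite !mxE distrC.
  exists (\row_i q i, r) => //=; split; last by [].
  move=> y; rewrite -ball_normE /= => yq; apply: eU.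
  move: xq; rewrite -ball_normE /= => xq.
  rewrite (splitr e).
  rewrite -[x](subrK (map_mx ratr (\row_i q i))) -addrA (le_lt_trans (ler_normD _ _))//.
  by rewrite ltrD// ?(lt_trans _ re)// distrC.
apply: countable_bigcupT_measurable; first exact: countableP.
move=> q; rewrite /F.
have [h1|h1] := pselect (ball (map_mx ratr q.1 : X) (ratr q.2) `<=` U); last first.
  by rewrite (_ : mkset _ = set0)//; apply/seteqP; split => y // -[].
have [h2|h2] := pselect (0 < (ratr q.2 : R)); last first.
  by rewrite (_ : mkset _ = set0)//; apply/seteqP; split => y // -[_ []].
rewrite (_ : mkset _ = ball (map_mx ratr q.1 : X) (ratr q.2)).
  exact: measurable_rV_ball.
by apply/seteqP; split => y /=; [move=> [_ []]|].
Qed.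

Lemma continuous_measurable_rV (f : X -> R) : continuous f -> measurable_fun setT f.
Proof.
move=> /continuousP cf; apply: (measurability _ (RGenOpens.measurableE R)).
move=> _ [_ [a [b ->] <-]]; rewrite setTI; apply: open_measurable_rV.
exact/cf/interval_open.
Qed.

Lemma measurable_fun_rVD d (T : measurableType d) (f g : T -> X) :
  measurable_fun setT f -> measurable_fun setT g ->
  measurable_fun setT (fun z => f z + g z).
Proof.
move=> mf mg; apply: measurable_fun_rVP => i.
rewrite (_ : _ \o _ = (@rV_coord R n i \o f) \+ (@rV_coord R n i \o g)).
  by apply: measurable_funD; apply: measurableT_comp => //; exact: measurable_rV_coord.
by apply/funext => z; rewrite /= /rV_coord mxE.
Qed.

Lemma measurable_fun_rVZ d (T : measurableType d) (f : T -> R) (v : X) :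
  measurable_fun setT f -> measurable_fun setT (fun z => f z *: v).
Proof.
move=> mf; apply: measurable_fun_rVP => i.
rewrite (_ : _ \o _ = (fun z => f z * v ord0 i)).
  exact: measurable_funM.
by apply/funext => z; rewrite /= /rV_coord mxE.
Qed.

Lemma measurable_fun_rVB d (T : measurableType d) (f g : T -> X) :
  measurable_fun setT f -> measurable_fun setT g ->
  measurable_fun setT (fun z => f z - g z).
Proof.
move=> mf mg; apply: measurable_fun_rVP => i.
rewrite (_ : _ \o _ = (@rV_coord R n i \o f) \- (@rV_coord R n i \o g)).
  by apply: measurable_funB; apply: measurableT_comp => //; exact: measurable_rV_coord.
by apply/funext => z; rewrite /= /rV_coord !mxE.
Qed.

End rV_borel.

(** * Translation invariance of Lebesgue measure *)

Section translation.
Local Open Scope ereal_scope.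
Context {R : realType}.

(** The pushforward of Lebesgue measure along a translation gives half-open intervals their length,
    so it is Lebesgue measure by uniqueness. *)
Lemma ge0_integral_translate1 (h : R) (f : R -> \bar R) :
  measurable_fun setT f -> (forall x, 0 <= f x) ->
  \int[lebesgue_measure]_x f (x + h)%R = \int[lebesgue_measure]_x f x.
Proof.
move=> mf f0; have ms : measurable_fun setT (fun x : measurableTypeR R => (x + h)%R : measurableTypeR R).
  by apply: measurable_funD => //.
rewrite -(@ge0_integral_pushforward _ _ _ _ R _ ms lebesgue_measure setT f)//.
apply: eq_measure_integral => A mA _; apply/esym/lebesgue_measure_unique => //.
move=> _ [[a b]] _ <-.
change (lebesgue_measure `]a, b]%classic =
  lebesgue_measure ((fun x => x + h)%R @^-1` `]a, b]%classic)).
rewrite (_ : _ @^-1` _ = `](a - h)%R, (b - h)%R]%classic); last first.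
  by apply/seteqP; split=> x /=; rewrite !in_itv/= ltrBlDr lerBrDr.
rewrite /= !lebesgue_measure_itv/= !lte_fin ltrD2r.
by case: ifP => // _; rewrite -!EFinB; congr EFin; lra.
Qed.

(** Induction on the dimension, following the recursive product that defines [lebesgue_rV]: Tonelli
    splits off the first coordinate. *)
Lemma ge0_integral_rV_translate n (h : 'rV[R]_n) (f : 'rV[R]_n -> \bar R) :
  measurable_fun setT f -> (forall x, 0 <= f x) ->
  \int[lebesgue_rV R n]_x f (x + h)%R = \int[lebesgue_rV R n]_x f x.
Proof.
elim: n h f => [|n IH] h f mf f0.
  by apply: eq_integral => x _; congr f; apply/rowP => -[].
have mS (k : 'rV[R]_n.+1) : measurable_fun setT (fun x : 'rV[R]_n.+1 => f (x + k)%R).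
  by apply: (measurableT_comp mf); apply: measurable_fun_rVD => //; exact: measurable_id.
rewrite /= /cons_measure.
have mc : measurable_fun setT (@rV_cons R n) by exact: measurable_rV_cons.
rewrite !(@ge0_integral_pushforward _ _ _ _ R _ mc (lebesgue_measure \x lebesgue_rV R n)%E setT)//.
rewrite !preimage_setT !fubini_tonelli1; last 4 first.
- exact: measurableT_comp.
- by move=> z; exact: f0.
- by apply: measurableT_comp => //; exact: mS.
- by move=> z; exact: f0.
rewrite /fubini_F /=.
pose h' : 'rV[R]_n := (rV_uncons h).2.
transitivity (\int[lebesgue_measure]_a \int[lebesgue_rV R n]_v
    (fun v => f (rV_cons ((a + h ord0 ord0)%R, v))) (v + h')%R).
  apply: eq_integral => a _; apply: eq_integral => v _; congr f.
  apply/rowP => i; rewrite !mxE; case: unliftP => [j|] -> //=.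
  by rewrite /h' /rV_uncons /= !mxE.
have mfc a : measurable_fun setT (fun v => f (rV_cons (a, v))).
  by apply: (measurableT_comp mf); apply: (measurableT_comp mc).
under eq_integral => a _.
  rewrite (IH h' (fun v => f (rV_cons ((a + h ord0 ord0)%R, v))))//.
  over.
apply: (@ge0_integral_translate1 (h ord0 ord0) (fun a => \int[lebesgue_rV R n]_v f (rV_cons (a, v)))).
  apply: (measurable_fun_fubini_tonelli_F (fun z => f (rV_cons z))) => //.
  exact: measurableT_comp.
by move=> a; apply: integral_ge0 => v _.
Qed.

End translation.

                       

(** * Smooth cut-off functions *)

Section flat.
Context {R : realType}.
Implicit Types (q : {poly R}) (x y : R).

                                                                                        
(** [flat 1] is the classical smooth function that vanishes exactly for x <= 0. The polynomial in
    1/x makes the family closed under differentiation. *)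
Definition flat q x : R := if 0 < x then q.[x^-1] * expR (- x^-1) else 0.

Lemma flat_le0 q x : x <= 0 -> flat q x = 0.
Proof. by rewrite /flat ltNge => ->. Qed.

Lemma flat1_gt0 x : 0 < x -> 0 < flat 1 x.
Proof. by rewrite /flat => ->; rewrite hornerC mul1r expR_gt0. Qed.

Lemma flat1_ge0 x : 0 <= flat 1 x.
Proof. by have [/flat1_gt0/ltW|/(flat_le0 1)->] := ltP 0 x. Qed.

Lemma flat1_nd x y : x <= y -> flat 1 x <= flat 1 y.
Proof.
have [x0 xy|/(flat_le0 1)-> _] := ltP 0 x; last exact: flat1_ge0.
have y0 := lt_le_trans x0 xy.
by rewrite /flat x0 y0 !hornerC !mul1r ler_expR lerN2 lef_pV2.
Qed.

(** Put y = 1/x >= 1 and m = [size q]. Then |q(y)| is at most a constant times y^m, while exp(-y) <=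
    (m+1)! / y^(m+1); one factor 1/y = x is left over. *)
Lemma flat_bound q : exists C, forall x, 0 < x -> x < 1 -> `|flat q x| <= C * x.
Proof.
pose m := size q; exists ((\sum_(i < size q) `|q`_i|) * m.+1`!%:R) => x x0 x1.
rewrite /flat x0 normrM (ger0_norm (expR_ge0 _)); set y := x^-1.
have y0 : 0 < y by rewrite invr_gt0.
have y1 : 1 <= y by rewrite /y invf_ge1// ltW.
have qy : `|q.[y]| <= (\sum_(i < size q) `|q`_i|) * y ^+ m.
  rewrite horner_coef (le_trans (ler_norm_sum _ _ _))// mulr_suml ler_sum// => i _.
  rewrite normrM ler_wpM2l// ger0_norm; last by rewrite exprn_ge0// ltW.
  by rewrite ler_weXn2l// ltnW.
have ey : expR (- y) <= m.+1`!%:R / y ^+ m.+1.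
  have c0 : 0 < m.+1`!%:R / y ^+ m.+1 by rewrite divr_gt0// ?exprn_gt0// ltr0n fact_gt0.
  rewrite expRN -[leRHS]invrK lef_pV2 ?posrE ?expR_gt0 ?invr_gt0//.
  rewrite invf_div; apply: le_trans (expR_ge1Dxn m (ltW y0)).
  by rewrite lerDr.
apply: (le_trans (ler_pM _ (expR_ge0 _) qy ey)) => //.
rewrite -!mulrA ler_wpM2l ?sumr_ge0// mulrCA ler_wpM2l//.
rewrite exprS invfM mulrA mulrAC divff ?gt_eqF ?exprn_gt0// mul1r.
by rewrite /y invrK.
Qed.

(** For x > 0 this is the chain rule in 1/x. At 0 the difference quotient from the right is
    [flat ('X * q)], which tends to 0 by [flat_bound]. *)
Lemma is_derive_flat q x : is_derive x 1 (flat q) (flat ('X^2 * (q - q^`())) x).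
Proof.
have [x0|x0|->] := ltgtP x 0.
- rewrite flat_le0 ?ltW//.
  apply: (@near_eq_is_derive _ _ _ (cst 0)).
  near=> y; rewrite flat_le0// ltW//; near: y; exact: lt_nbhsl.
- apply: (@near_eq_is_derive _ _ _ (fun y => q.[y^-1] * expR (- y^-1))).
    near=> y; rewrite /flat ifT//; near: y; exact: lt_nbhsr.
  have xn0 : x != 0 by rewrite gt_eqF.
  have di : is_derive x 1 (fun y : R => y^-1) (- x ^- 2).
    have := @is_deriveV R id x 1 1 xn0 (is_derive_id _ _).
    by rewrite /= [_ *: 1]mulr1.
  have dh : is_derive (x^-1) 1 (horner q) q^`().[x^-1].
    rewrite -[X in is_derive _ _ _ X]/(horner q^`() x^-1) derivE derive1E.
    by apply: derivableP; exact: derivable_horner.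
  have dq : is_derive x 1 (horner q \o (fun y : R => y^-1)) (q^`().[x^-1] * - x ^- 2).
    exact: is_derive1_comp.
  have de : is_derive x 1 (expR \o (fun y : R => - y^-1)) (expR (- x^-1) * - (- x ^- 2)).
    exact: is_derive1_comp.
  apply: (is_derive_eq (is_deriveM dq de)).
  rewrite /flat x0 /= !hornerE /= -!exprVn /GRing.scale /=; ring.
- rewrite flat_le0//.
  suff h0 : h^-1 *: (flat q (h *: 1 + 0) - flat q 0) @[h --> 0^'] --> 0.
    by apply: DeriveDef; [apply/cvg_ex; exists 0|apply/cvg_lim].
  have [C Cx] := flat_bound ('X * q).
  have {}Cx h : h != 0 -> `|h| < 1 -> `|h^-1 *: (flat q (h *: 1 + 0) - flat q 0)| <= `|C| * `|h|.
    move=> hn0 h1; rewrite addr0 (flat_le0 _ (lexx 0)) subr0 [h *: 1]mulr1.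
    have [hp|hp] := ltP 0 h; last by rewrite flat_le0// scaler0 normr0 mulr_ge0.
    have -> : h^-1 *: flat q h = flat ('X * q) h.
      by rewrite /flat hp hornerM hornerX -mulrA.
    move: h1; rewrite gtr0_norm// => h1.
    by rewrite (le_trans (Cx _ hp h1))// ler_pM2r// ler_norm.
  apply/cvgr0Pnorm_lt => e e0; near=> h.
  have hn0 : h != 0 by near: h; exact: nbhs_dnbhs_neq.
  apply: (le_lt_trans (Cx _ hn0 _)).
    by near: h; exact: dnbhs0_lt.
  rewrite (@le_lt_trans _ _ ((`|C| + 1) * `|h|))//.
    by rewrite ler_wpM2r// lerDl.
  rewrite mulrC -ltr_pdivlMr ?ltr_wpDl//.
  near: h; apply: dnbhs0_lt; rewrite divr_gt0// ltr_wpDl//.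
Unshelve. all: by end_near. Qed.

Lemma continuous_flat q : continuous (flat q).
Proof.
move=> x; apply: differentiable_continuous; apply/derivable1_diffP.
by have [] := is_derive_flat q x.
Qed.

End flat.

Section Ck_comp.
Context {R : realType} {n : nat}.
Local Notation X := 'rV[R]_n.

Lemma is_derive_comp_dir (f : X -> R) (b : R -> R) (x v : X) (db : R) :
  derivable f x v -> is_derive (f x) 1 b db ->
  is_derive x v (b \o f) (db * 'D_v f x).
Proof.
move=> df dbx.
pose g (h : R) := f (h *: v + x).
have g0 : g 0 = f x by rewrite /g scale0r add0r.
have D (F : X -> R) : 'D_v F x = 'D_1 (fun h : R => F (h *: v + x)) 0.
  rewrite /derive; set g1 := fun h => h^-1 *: _; set g2 := fun h => h^-1 *: _.
  suff -> : g1 = g2 by [].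
  by apply/funext => h; rewrite /g1 /g2 /= addr0 scale0r add0r [h *: 1]mulr1.
have dg : is_derive (0 : R) (1 : R) g ('D_v f x).
  by rewrite [X in is_derive _ _ _ X]D; apply: derivableP; exact: (derivable1P f x v).1 df.
have dbg : is_derive (g 0) 1 b db by rewrite g0.
have [d1 d2] := @is_derive1_comp _ b g 0 _ _ dbg dg.
apply: DeriveDef; first exact: (derivable1P (b \o f) x v).2 d1.
by rewrite [LHS]D.
Qed.

(** The induction on [k] runs over all [q] at once, because each derivative changes the
    polynomial. *)
Lemma Ck_flat k (q : {poly R}) (f : X -> R) : Ck k f -> Ck k (flat q \o f).
Proof.
elim: k q f => [|k IH] q f Cf.
  have [cf _] := Cf; split=> // x; apply: continuous_comp; [exact: cf|exact: continuous_flat].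
have [cf df] := Cf; split.
  by move=> x; apply: continuous_comp; [exact: cf|exact: continuous_flat].
move=> i; have [dfi Cfi] := df i; have h x := is_derive_comp_dir (dfi x) (is_derive_flat q (f x)).
split; first by move=> x; have [] := h x.
rewrite (_ : 'D__ _ = (flat ('X^2 * (q - q^`())) \o f) * 'D_(basis_vec R i) f).
  by apply: CkM => //; apply: IH; exact: CkW.
by apply/funext => x; have [_ ->] := h x.
Qed.

Lemma Ck_coord k i : Ck k (fun x : X => x ord0 i).
Proof.
case: k => [|k]; split=> //; try exact: coord_continuous.
move=> j; have h (x : X) : is_derive x (basis_vec R j) (fun x : X => x ord0 i : R) (i == j)%:R.
  apply: DeriveDef; first by apply: diff_derivable; exact: differentiable_coord.
  apply/cvg_lim => //; apply: cvg_near_cst; near=> h.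
  rewrite /= !mxE addrK eqxx /= /GRing.scale/= mulrA mulVf ?mul1r//.
  by near: h; exact: nbhs_dnbhs_neq.
split; first by move=> x; have [] := h x.
rewrite (_ : 'D__ _ = cst ((i == j)%:R : R)); first exact: Ck_cst.
by apply/funext => x; have [_ ->] := h x.
Unshelve. all: by end_near. Qed.

Lemma CkN k (f : X -> R) : Ck k f -> Ck k (- f).
Proof.
move=> Cf; rewrite (_ : - f = cst (-1) * f); first by apply: CkM => //; exact: Ck_cst.
by apply/funext => x; rewrite [RHS]mulN1r.
Qed.

Lemma Ck_prod k I (r : seq I) (F : I -> X -> R) : (forall i, Ck k (F i)) ->
  Ck k (\prod_(i <- r) F i).
Proof.
move=> CF; elim/big_ind : _ => //; first exact: Ck_cst.
by move=> f g; exact: CkM.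
Qed.

Lemma Ck_sum k I (r : seq I) (F : I -> X -> R) : (forall i, Ck k (F i)) ->
  Ck k (\sum_(i <- r) F i).
Proof.
move=> CF; elim/big_ind : _ => //; first exact: Ck_cst0.
by move=> f g; exact: CkD.
Qed.

End Ck_comp.

Section cutoff.
Context {R : realType} {n : nat}.
Local Notation X := 'rV[R]_n.
Implicit Types (a b x : X) (U K : set X).

Definition box_bump a b : X -> R :=
  \prod_(i < n) ((fun x => flat 1 (x ord0 i - a ord0 i)) *
                 (fun x => flat 1 (b ord0 i - x ord0 i))).

Lemma box_bumpE a b x : box_bump a b x =
  \prod_(i < n) (flat 1 (x ord0 i - a ord0 i) * flat 1 (b ord0 i - x ord0 i)).
Proof.
rewrite /box_bump; elim/big_ind2 : _ => //.
by move=> f r g s fx gx; rewrite -fx -gx.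
Qed.

Lemma smooth_box_bump a b : smooth (box_bump a b).
Proof.
move=> k; apply: Ck_prod => i; apply: CkM.
  apply: (@Ck_flat _ _ k 1 ((fun x : X => x ord0 i) + cst (- a ord0 i))).
  by apply: CkD; [exact: Ck_coord|exact: Ck_cst].
apply: (@Ck_flat _ _ k 1 (cst (b ord0 i) + - (fun x : X => x ord0 i))).
by apply: CkD; [exact: Ck_cst|apply: CkN; exact: Ck_coord].
Qed.

Lemma box_bump_ge0 a b x : 0 <= box_bump a b x.
Proof. by rewrite box_bumpE prodr_ge0// => i _; rewrite mulr_ge0// flat1_ge0. Qed.

Lemma box_bump_gt0 a b x : (forall i, a ord0 i < x ord0 i < b ord0 i) -> 0 < box_bump a b x.
Proof.
move=> h; rewrite box_bumpE prodr_gt0// => i _; have /andP[h1 h2] := h i.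
by rewrite mulr_gt0// flat1_gt0// subr_gt0.
Qed.

Lemma box_bump_out a b x : ~ (forall i, a ord0 i < x ord0 i < b ord0 i) -> box_bump a b x = 0.
Proof.
move=> /existsNP[i /negP]; rewrite negb_and -!leNgt => h.
apply/eqP; rewrite box_bumpE prodf_seq_eq0; apply/hasP; exists i; first exact: mem_index_enum.
rewrite /= mulf_eq0; apply/orP; case/orP: h => h; [left|right].
  by rewrite flat_le0// subr_le0.
by rewrite flat_le0// subr_le0.
Qed.

Lemma compact_box a b : compact [set x : X | forall i, a ord0 i <= x ord0 i <= b ord0 i].
Proof.
have := @rV_compact R n (fun i => `[a ord0 i, b ord0 i]%classic) (fun i => @segment_compact _ _ _).
congr compact; apply/seteqP; split => x /= h i; by have := h i; rewrite in_itv.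
Qed.

(** A smooth truncation of [S] for c > 0: it is 0 where S = 0 and 1 where S >= c. *)
Definition plateau (c : R) (S : X -> R) : X -> R :=
  cst 1 + - (cst (flat 1 c)^-1 * (flat 1 \o (cst c + - S))).

Lemma plateauE c S x : plateau c S x = 1 - (flat 1 c)^-1 * flat 1 (c - S x).
Proof. by []. Qed.

Lemma smooth_plateau c S : smooth S -> smooth (plateau c S).
Proof.
move=> sS k; apply: CkD; first exact: Ck_cst.
apply: CkN; apply: CkM; first exact: Ck_cst.
by apply: Ck_flat; apply: CkD; [exact: Ck_cst|apply: CkN].
Qed.

Lemma plateau_eq1 c S x : c <= S x -> plateau c S x = 1.
Proof. by move=> cS; rewrite plateauE (@flat_le0 _ _ (c - S x)) ?subr_le0// mulr0 subr0. Qed.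

Lemma plateau_eq0 c S x : 0 < c -> S x = 0 -> plateau c S x = 0.
Proof.
by move=> c0 Sx; rewrite plateauE Sx subr0 mulVf ?subrr// gt_eqF// flat1_gt0.
Qed.

Lemma plateau_itv c S x : 0 < c -> 0 <= S x -> 0 <= plateau c S x <= 1.
Proof.
move=> c0 Sx; rewrite plateauE; apply/andP; split.
  rewrite subr_ge0 mulrC ler_pdivrMr ?flat1_gt0// mul1r flat1_nd//.
  by rewrite lerBlDr lerDl.
by rewrite lerBlDr lerDl mulr_ge0 ?invr_ge0 ?flat1_ge0.
Qed.

(** Finitely many balls whose closed boxes lie in [U] cover [K]. The sum [S] of their bumps is
    positive on [K], hence exceeds some c > 0 there, and [plateau c S] is the cut-off. Its support
    lies in the finite union [L] of closed boxes. *)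
Lemma exists_cutoff U K : open U -> compact K -> K `<=` U ->
  exists chi : X -> R, [/\ test_function U chi, (forall x, 0 <= chi x <= 1) &
    forall x, K x -> \forall y \near x, chi y = 1].
Proof.
move=> oU cK KU.
pose e (r : R) : X := const_mx r.
pose B x r : set X := [set y | forall i, (x - e r) ord0 i <= y ord0 i <= (x + e r) ord0 i].
have rP x : U x -> exists2 r : R, 0 < r & B x r `<=` U.
  move=> Ux; have /nbhs_ballP[r /= r0 rU] : nbhs x U by exact: open_nbhs_nbhs.
  exists (r / 2); first by rewrite divr_gt0.
  move=> y Bxy; apply: rU; rewrite -ball_normE /= rV_normltP// => i.
  have := Bxy i; rewrite !mxE distrC ltr_distl => /andP[h1 h2].
  by apply/andP; split; lra.
have [r rP'] : exists r : X -> R, forall x, K x -> 0 < r x /\ B x (r x) `<=` U.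
  suff /choice[r rr] : forall x, exists r, K x -> 0 < r /\ B x r `<=` U by exists r.
  move=> x; have [Kx|nKx] := pselect (K x); last by exists 0.
  by have [r r0 rU] := rP x (KU _ Kx); exists r.
have cov : K `<=` cover K (fun x => ball x (r x)).
  by move=> x Kx; exists x => //; apply: ballxx; have [] := rP' x Kx.
move: (cK); rewrite compact_cover => /(_ _ K (fun x => ball x (r x)) _ cov)[].
  by move=> x _; exact: ball_open.
move=> D DK KD.
pose S : X -> R := \sum_(x <- D : seq X) box_bump (x - e (r x)) (x + e (r x)).
have SE y : S y = \sum_(x <- D : seq X) box_bump (x - e (r x)) (x + e (r x)) y.
  rewrite /S; elim/big_ind2 : _ => //.
  by move=> f s g t fx gx; rewrite -fx -gx.
have sS : smooth S by move=> k; apply: Ck_sum => x; exact: smooth_box_bump.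
have S0 y : 0 <= S y by rewrite SE sumr_ge0// => x _; exact: box_bump_ge0.
have boxP x y : K x -> ball x (r x) y <-> (forall i, (x - e (r x)) ord0 i < y ord0 i < (x + e (r x)) ord0 i).
  move=> Kx; rewrite -ball_normE /= rV_normltP; last by have [] := rP' x Kx.
  split=> h i; have := h i; rewrite !mxE distrC ltr_distl//.
have Sgt0 y : K y -> 0 < S y.
  move=> /KD[x /= Dx xy]; rewrite SE.
  have Kx : K x by apply/set_mem/DK.
  rewrite (big_rem x)//= ltr_pwDl//; first by apply: box_bump_gt0; apply/boxP.
  by apply: sumr_ge0 => z _; exact: box_bump_ge0.
pose L := \bigcup_(x in [set` D]) B x (r x).
have cL : compact L.
  rewrite /L bigcup_fset; elim/big_ind : _ => //.
  - exact: compact0.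
  - exact: compactU.
  - by move=> x _; exact: compact_box.
have LU : L `<=` U.
  move=> y [x /= Dx]; have Kx : K x by apply/set_mem/DK.
  by have [_] := rP' x Kx; exact.
have SL y : ~ L y -> S y = 0.
  move=> nLy; rewrite SE big_seq big1// => x Dx.
  have Kx : K x by apply/set_mem/DK.
  apply: box_bump_out => xy; apply: nLy; exists x => // i.
  by have /andP[h1 h2] := xy i; rewrite !ltW.
have [c c0 cS] : exists2 c : R, 0 < c & forall x, K x -> c < S x.
  have [->|K0] := eqVneq K set0; first by exists 1.
  have /set0P K0' := K0.
  have [|z zK Sz] := @EVT_min_rV R n S K K0' cK.
    by apply: continuous_subspaceT; have [] := sS 0%N.
  (* Half the minimum, so that c < S holds strictly on [K] and therefore near each of its points. *)
  exists (S z / 2); first by rewrite divr_gt0// Sgt0//; exact: set_mem.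
  move=> x Kx; apply: (@lt_le_trans _ _ (S z)); last by apply: Sz; rewrite inE.
  have : 0 < S z by apply: Sgt0; rewrite inE in zK.
  by move=> Sz0; lra.
exists (plateau c S); split.
- apply: (@test_function_sub _ _ _ _ L) => //; first exact: smooth_plateau.
  by move=> x nLx; rewrite plateau_eq0// SL.
- by move=> x; exact: plateau_itv.
- move=> x Kx; have cS0 : {for x, continuous S} by have [cS0 _] := sS 0%N; exact: cS0.
  have : nbhs x (S @^-1` [set y | c < y]) by apply: (cS0 [set y | c < y]); exact: lt_nbhsr (cS x Kx).
  by apply: filterS => y cSy; rewrite plateau_eq1// ltW.
Qed.

End cutoff.

                                                    

(** * Directional derivatives and symmetry of second derivatives *)

Section directional.
Context {R : realType} {n : nat}.
Local Notation X := 'rV[R]_n.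
Implicit Types (f : X -> R) (x v : X).

Lemma is_derive_line f x v (s : R) : derivable f (s *: v + x) v ->
  is_derive s 1 (fun s : R => f (s *: v + x)) ('D_v f (s *: v + x)).
Proof.
have E : (fun h : R => h^-1 *: (((fun s : R => f (s *: v + x)) \o shift s) (h *: (1 : R)) - f (s *: v + x))) =
   (fun h : R => h^-1 *: ((f \o shift (s *: v + x)) (h *: v) - f (s *: v + x))).
  by apply/funext => h; rewrite /= [h *: 1]mulr1 scalerDl addrA.
by move=> df; apply: DeriveDef; rewrite /derivable /derive E.
Qed.

Lemma continuous_line f x v : continuous f -> continuous (fun s : R => f (s *: v + x)).
Proof.
move=> cf s; apply: (@continuous_comp _ _ _ (fun s : R => s *: v + x)); last exact: cf.
by apply: continuousD; [exact: scalel_continuous|exact: cst_continuous].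
Qed.

Lemma continuous_eps f x (e : R) : continuous f -> 0 < e ->
  exists2 r : R, 0 < r & forall y, `|y - x| < r -> `|f x - f y| < e.
Proof.
move=> cf e0.
have /nbhs_ballP[r /= r0 rf] : nbhs x (f @^-1` ball (f x) e) by apply: cf; exact: nbhsx_ballx.
exists r => // y yx; have : ball x r y by rewrite -ball_normE /= distrC.
by move=> /rf; rewrite /= -ball_normE.
Qed.

Lemma line_MVT f v x (h : R) : 0 < h -> continuous f -> (forall y, derivable f y v) ->
  exists2 t : R, 0 < t & t < h /\ f (h *: v + x) - f x = 'D_v f (t *: v + x) * h.
Proof.
move=> h0 cf df.
have [t] : exists2 t, t \in `]0, h[ & (fun s : R => f (s *: v + x)) h - (fun s : R => f (s *: v + x)) 0 =
    'D_v f (t *: v + x) * (h - 0).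
  apply: (@MVT _ (fun s : R => f (s *: v + x)) (fun t => 'D_v f (t *: v + x))) => //.
  - by move=> t _; exact: is_derive_line.
  - by apply: continuous_subspaceT; exact: continuous_line.
by rewrite in_itv/= scale0r add0r subr0 => /andP[t0 th] pt; exists t.
Qed.

Lemma eq_of_close (a b : R) :
  (forall e : R, 0 < e -> exists c : R, `|a - c| < e /\ `|b - c| < e) -> a = b.
Proof.
move=> h; apply/eqP; rewrite -subr_eq0 -normr_eq0; apply/eqP/le_anti.
rewrite normr_ge0 andbT; apply/ler_addgt0Pr => e e0; rewrite add0r.
have [c [ac bc]] := h (e / 2) ltac:(by rewrite divr_gt0).
have -> : a - b = (a - c) - (b - c) by ring.
by rewrite (le_trans (ler_normB _ _))// (splitr e) lerD// ltW.
Qed.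

Lemma subr_swap (a b c d : R) : a - b - (c - d) = a - c - (b - d).
Proof. ring. Qed.

(** The mean value theorem is used twice: along e_i for the difference of [f] between two parallel
    segments, then along e_j for the partial derivative that results. *)
Lemma mixed_difference f i j x (h : R) : 0 < h -> smooth f ->
  exists y, `|y - x| <= 2 * h /\
    f (h *: basis_vec R j + (h *: basis_vec R i + x)) - f (h *: basis_vec R i + x)
    - (f (h *: basis_vec R j + x) - f x) =
    h * h * 'D_(basis_vec R j) ('D_(basis_vec R i) f) y.
Proof.
move=> h0 sf; set ei := basis_vec R i; set ej := basis_vec R j.
have [_ /(_ i) [dfi Cfi]] := sf 2%N; have [cf _] := sf 0%N.
have [cfi /(_ j) [dfij _]] := Cfi.
pose p (s : R) := f (s *: ei + (h *: ej + x)) - f (s *: ei + x).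
have [s] : exists2 s, s \in `]0, h[ & p h - p 0 =
    ('D_ei f (s *: ei + (h *: ej + x)) - 'D_ei f (s *: ei + x)) * (h - 0).
  apply: MVT => //.
  - move=> s _; apply: (@is_deriveB _ _ _ (fun s : R => f (s *: ei + (h *: ej + x))) (fun s : R => f (s *: ei + x))); exact: is_derive_line.
  - apply: continuous_subspaceT => s; apply: continuousB; exact: continuous_line.
rewrite in_itv/= => /andP[s0 sh] ps.
have [t t0 [th pt]] := line_MVT (s *: ei + x) h0 cfi dfij.
exists (t *: ej + (s *: ei + x)); split.
  rewrite addrA addrK; apply: (le_trans (ler_normD _ _)).
  have nb (k : 'I_n) : `|basis_vec R k| <= 1 :> R.
    rewrite [leLHS]/Num.norm/= mx_normrE; apply/bigmax_leP; split=> // -[a b] _ /=.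
    by rewrite /basis_vec mxE; case: andP => _; rewrite ?normr1 ?normr0.
  rewrite !normrZ (gtr0_norm t0) (gtr0_norm s0).
  have h1 := ler_wpM2l (ltW t0) (nb j); have h2 := ler_wpM2l (ltW s0) (nb i).
  by rewrite !mulr1 in h1 h2; rewrite (le_trans (lerD h1 h2))//; lra.
move: ps; rewrite /p !scale0r !add0r subr0 => ps.
rewrite [in LHS]addrCA.
transitivity (f (h *: ei + (h *: ej + x)) - f (h *: ei + x) - (f (h *: ej + x) - f x)) => //.
by rewrite ps (addrCA (s *: ei)) pt mulrC mulrA mulrAC.
Qed.

Lemma eq_of_near_eq (A B : X -> R) x : continuous A -> continuous B ->
  (forall h : R, 0 < h -> exists y z, [/\ `|y - x| <= 2 * h, `|z - x| <= 2 * h & A y = B z]) ->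
  A x = B x.
Proof.
move=> cA cB AB; apply: eq_of_close => e e0.
have [r r0 rA] := continuous_eps x cA e0; have [r' r'0 rB] := continuous_eps x cB e0.
pose h := Num.min r r' / 3.
have m0 : 0 < Num.min r r' by rewrite lt_min r0.
have h0 : 0 < h by rewrite divr_gt0.
have hr y : `|y - x| <= 2 * h -> `|y - x| < r /\ `|y - x| < r'.
  move=> yx; have : `|y - x| < Num.min r r' by rewrite (le_lt_trans yx)// /h; lra.
  by rewrite lt_min => /andP.
have [y [z [/hr[/rA yA _] /hr[_ /rB zB] Ayz]]] := AB h h0.
by exists (A y); split=> //; rewrite Ayz.
Qed.

(** Schwarz's theorem. The second difference is symmetric in [i] and [j], so the two mixed
    derivatives take a common value at points within 2h of [x]; continuity lets h tend to 0. *)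
Lemma derive_swap f i j : smooth f ->
  'D_(basis_vec R j) ('D_(basis_vec R i) f) = 'D_(basis_vec R i) ('D_(basis_vec R j) f).
Proof.
move=> sf; apply/funext => x; apply: (@eq_of_near_eq ('D_(basis_vec R j) ('D_(basis_vec R i) f)) ('D_(basis_vec R i) ('D_(basis_vec R j) f)) x).
- by have [_ /(_ i) [_ [_ /(_ j) [_ [cA _]]]]] := sf 2%N.
- by have [_ /(_ j) [_ [_ /(_ i) [_ [cB _]]]]] := sf 2%N.
move=> h h0.
have [y [yx Ey]] := mixed_difference i j x h0 sf.
have [z [zx Ez]] := mixed_difference j i x h0 sf.
exists y, z; split; [exact: yx|exact: zx|].
apply: (mulfI (mulf_neq0 (lt0r_neq0 h0) (lt0r_neq0 h0))).
have E : h *: basis_vec R i + (h *: basis_vec R j + x) = h *: basis_vec R j + (h *: basis_vec R i + x).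
  exact: addrCA.
by rewrite -Ey -Ez E; exact: subr_swap.
Qed.

End directional.

(** * Integrals of test functions, their increments and their partial derivatives *)

Section test_integrals.
Context {R : realType} {n : nat}.
Local Notation X := 'rV[R]_n.
Local Notation mu := (lebesgue_rV R n).
Implicit Types (f g : X -> R) (x v : X).

Lemma test_function_out (U : set X) f x : test_function U f -> ~ U x -> f x = 0.
Proof. by move=> [_ _ fU] nUx; apply: supp_out => /fU. Qed.

Lemma test_function_continuous (U : set X) f : test_function U f -> continuous f.
Proof. by case=> sf _ _; case: (sf 0%N). Qed.

Lemma test_function_measurable (U : set X) f : test_function U f -> measurable_fun setT f.
Proof. by move=> /test_function_continuous; exact: continuous_measurable_rV. Qed.

Lemma test_function_bounded (U : set X) f : test_function U f ->
  exists2 M : R, 0 < M & forall x, `|f x| <= M.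
Proof.
move=> tf; have [_ cK _] := tf.
have : compact (f @` supp f).
  apply: continuous_compact => //; apply: continuous_subspaceT.
  exact: test_function_continuous tf.
move=> /compact_bounded[M [_ fM]]; exists (`|M| + 1); first by rewrite ltr_wpDl.
move=> x; have [xK|/supp_out ->] := pselect (supp f x); last by rewrite normr0 addr_ge0.
by apply: fM; [rewrite (le_lt_trans (ler_norm M))// ltrDl|exists x].
Qed.

Lemma compact_finite_measure (K : set X) : compact K -> (mu K < +oo)%E.
Proof.
move=> /[dup] cK /compact_bounded[M [_ KM]].
pose A (i : 'I_n) : set (measurableTypeR R) := `[- (`|M| + 1), `|M| + 1]%classic.
have mA i : measurable (A i) by exact: measurable_itv.
apply: (@le_lt_trans _ _ (mu [set x | forall i, A i (x ord0 i)])).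
  apply: le_measure; rewrite ?inE.
  - rewrite -[K]setCK; apply: measurableC; apply: open_measurable_rV; apply: closed_openC.
    by apply: compact_closed => //; exact: norm_hausdorff.
  - exact: measurable_rV_box.
  - move=> x Kx i; rewrite /A /= in_itv/= -ler_norml (le_trans (rV_coord_le_norm x i))//.
    by apply: KM => //; rewrite (le_lt_trans (ler_norm M))// ltrDl.
rewrite lebesgue_rV_box// ltey_eq; apply/orP; left; elim/big_ind : _ => //.
- by move=> a b; exact: fin_numM.
- by move=> i _; rewrite /A lebesgue_measure_itv/=; case: ifP => _; rewrite -?EFinB.
Qed.

Local Open Scope ereal_scope.

Lemma integral_rV_translate (h : X) (F : X -> \bar R) : measurable_fun setT F ->
  \int[mu]_x F (x + h)%R = \int[mu]_x F x.
Proof.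
move=> mF; rewrite integralE [RHS]integralE; congr (_ - _).
  rewrite -(@ge0_integral_rV_translate R n h F^\+ (measurable_funepos mF) (fun x => funepos_ge0 F x)).
  by apply: eq_integral => x _; rewrite !funeposE.
rewrite -(@ge0_integral_rV_translate R n h F^\- (measurable_funeneg mF) (fun x => funeneg_ge0 F x)).
by apply: eq_integral => x _; rewrite !funenegE.
Qed.

Lemma test_function_integrable (U : set X) f : test_function U f ->
  mu.-integrable setT (EFin \o f).
Proof.
move=> tf; have [M M0 fM] := test_function_bounded tf; have [_ cK _] := tf.
have mK : measurable (supp f).
  by rewrite -[supp f]setCK; apply: measurableC; apply: open_measurable_rV;
     apply: closed_openC; exact: closed_closure.
rewrite (_ : EFin \o f = (EFin \o f) \_ (supp f)).
  apply/integrable_restrict => //; rewrite setTI.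
  apply: measurable_bounded_integrable => //.
  - exact: compact_finite_measure.
  - by apply: measurable_funTS; exact: test_function_measurable tf.
  - exists M; split; first by rewrite realE ltW.
    by move=> y My x _ /=; rewrite (le_trans (fM x))// ltW.
apply/funext => x; rewrite patchE; case: ifPn => // /negP; rewrite inE => /supp_out.
by rewrite /= => ->.
Qed.

Lemma test_function_powR_lty (U : set X) f (p : R) : (0 < p)%R -> test_function U f ->
  \int[mu]_x (`|f x| `^ p)%:E < +oo.
Proof.
move=> p0 tf; have [M M0 fM] := test_function_bounded tf; have [_ cK _] := tf.
have mK : measurable (supp f).
  by rewrite -[supp f]setCK; apply: measurableC; apply: open_measurable_rV;
     apply: closed_openC; exact: closed_closure.
have mf := test_function_measurable tf.
apply: (@le_lt_trans _ _ (\int[mu]_x ((M `^ p) * \1_(supp f) x)%:E)); last first.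
  under eq_integral do rewrite EFinM.
  rewrite ge0_integralZl//=; last 2 first.
    by apply/measurable_EFinP; exact: measurable_indic.
    by rewrite lee_fin powR_ge0.
  rewrite integral_indic// setIT lte_mul_pinfty// ?lee_fin ?powR_ge0//.
  exact: compact_finite_measure.
apply: ge0_le_integral => //.
- apply/measurable_EFinP; apply: (measurableT_comp (measurable_powR _)).
  exact: measurableT_comp.
- apply/measurable_EFinP; apply: measurable_funM => //; exact: measurable_indic.
- move=> x _; rewrite lee_fin indicE.
  have [/mem_set->|nKx] := pselect (supp f x).
    by rewrite mulr1 ge0_ler_powR ?nnegrE// ltW.
  by rewrite (supp_out nKx) normr0 powR0 ?gt_eqF// mulr_ge0// powR_ge0.
Qed.

Lemma line_FTC f v x : continuous f -> (forall y, derivable f y v) -> continuous ('D_v f) ->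
  \int[lebesgue_measure]_(r in `[0%R, 1%R]) ('D_v f (r *: v + x))%:E = (f (v + x) - f x)%:E.
Proof.
move=> cf df cdf.
have cl := @continuous_line _ _ f x v cf.
rewrite (@continuous_FTC2 _ (fun r : R => 'D_v f (r *: v + x)%R) (fun r : R => f (r *: v + x)%R))//.
- by rewrite scale1r scale0r add0r EFinB.
- by apply: continuous_subspaceT; exact: (@continuous_line _ _ ('D_v f) x v cdf).
- split.
  + by move=> r _; have [] := is_derive_line (df (r *: v + x)%R).
  + by apply: cvg_at_right_filter; exact: cl.
  + by apply: cvg_at_left_filter; exact: cl.
- by move=> r _; rewrite derive1E; have [_ ->] := is_derive_line (df (r *: v + x)%R).
Qed.

End test_integrals.

Section directional_scaling.
Context {R : realType} {n : nat}.
Local Notation X := 'rV[R]_n.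
Implicit Types (f : X -> R) (x v : X).

Lemma is_derive_scale_dir f x v (t : R) : derivable f x v ->
  is_derive x (t *: v) f ('D_v f x * t).
Proof.
move=> df; pose g (s : R) := f (s *: v + x).
have E (F : X -> R) w : 'D_w F x = 'D_1 (fun h : R => F (h *: w + x)) 0.
  rewrite /derive; set g1 := fun h => h^-1 *: _; set g2 := fun h => h^-1 *: _.
  suff -> : g1 = g2 by [].
  by apply/funext => h; rewrite /g1 /g2 /= addr0 scale0r add0r [h *: 1]mulr1.
have dg : is_derive ((0 : R) * t) (1 : R) g ('D_v f x).
  rewrite mul0r [X in is_derive _ _ _ X]E; apply: derivableP.
  exact: (derivable1P f x v).1 df.
have dm : is_derive (0 : R) (1 : R) (fun s : R => s * t) t.
  by have := @is_deriveM _ _ id (cst t) 0 1 1 0 (is_derive_id _ _) (is_derive_cst _ _ _);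
    rewrite /= scaler0 add0r [_ *: _]mulr1.
have [d1 d2] := @is_derive1_comp _ g (fun s : R => s * t) 0 _ _ dg dm.
have gE : g \o (fun s : R => s * t) = (fun h : R => f (h *: (t *: v) + x)).
  by apply/funext => h; rewrite /g /= scalerA.
rewrite gE in d1 d2; apply: DeriveDef; first exact: (derivable1P f x (t *: v)).2 d1.
by rewrite [LHS]E.
Qed.

End directional_scaling.

Section partial_integrals.
Context {R : realType} {n : nat}.
Local Notation X := 'rV[R]_n.
Local Notation mu := (lebesgue_rV R n).
Local Notation lam := (@lebesgue_measure R).
Implicit Types (f g : X -> R) (x v : X).
Local Open Scope ereal_scope.

Lemma ge0_integral_unit_segment (a : R -> \bar R) : measurable_fun setT a -> (forall r, 0 <= a r) ->
  \int[lam]_(r in `[0%R, 1%R]) a r = \int[lam]_r ((\1_(`[0%R, 1%R]%classic) r)%:E * a r).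
Proof.
move=> ma a0; rewrite integral_mkcond; apply: eq_integral => r _.
by rewrite patchE indicE; case: ifPn => _; rewrite ?mul1e ?mul0e.
Qed.

Lemma lebesgue_measure_unit_segment : lam `[0%R, 1%R]%classic = 1.
Proof. by rewrite lebesgue_measure_itv/= lte_fin ltr01 oppr0 adde0. Qed.

Lemma integral_indic_unit_segment : \int[lam]_r (\1_(`[0%R, 1%R]%classic) r)%:E = 1.
Proof.
rewrite integral_indic//= setIT; exact: lebesgue_measure_unit_segment.
Qed.

(** Jensen's inequality for t^p on a segment of length 1, obtained from Hoelder's inequality against
    the indicator of the segment, whose norm is 1. *)
Lemma unit_segment_hoelder (a : R -> R) (p : R) : (1 < p)%R -> measurable_fun setT a ->
  (\int[lam]_(r in `[0%R, 1%R]) (`|a r|)%:E) `^ p <= \int[lam]_(r in `[0%R, 1%R]) (`|a r| `^ p)%:E.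
Proof.
move=> p1 ma; have p0 : (0 < p)%R by apply: lt_trans p1.
pose q := ((1 - p^-1)^-1)%R.
have q0 : (0 < q)%R by rewrite invr_gt0 subr_gt0 invf_lt1.
have pq : (p^-1 + q^-1 = 1)%R by rewrite /q invrK addrC subrK.
pose I : R -> R := \1_(`[0%R, 1%R]%classic).
have mI : measurable_fun setT I by apply: measurable_indic.
have I01 r : (I r = 0 \/ I r = 1)%R.
  by rewrite /I indicE; case: (_ \in _); [right|left].
have := @hoelder _ _ _ lam (fun r => a r * I r)%R I p q (measurable_funM ma mI) mI p0 q0 pq.
have -> : 'N[lam]_q%:E[EFin \o I] = 1.
  rewrite unlock /Lnorm (_ : \int[_]_x _ = \int[lam]_x (I x)%:E).
    by rewrite integral_indic_unit_segment poweR1r.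
  apply: eq_integral => r _ /=; case: (I01 r) => ->.
    by rewrite normr0 powR0// gt_eqF.
  by rewrite normr1 powR1.
rewrite mule1 Lnorm1 unlock /Lnorm.
have -> : \int[lam]_x `|(EFin \o ((fun r => a r * I r) \* I)%R) x| = \int[lam]_(r in `[0%R, 1%R]) (`|a r|)%:E.
  rewrite [RHS]integral_mkcond; apply: eq_integral => r _ /=.
  rewrite patchE /I indicE; case: ifPn => _; first by rewrite !mulr1.
  by rewrite !mulr0 normr0.
have -> : \int[lam]_x (`|(EFin \o (fun r => a r * I r)%R) x| `^ p) = \int[lam]_(r in `[0%R, 1%R]) (`|a r| `^ p)%:E.
  rewrite [RHS]integral_mkcond; apply: eq_integral => r _ /=.
  rewrite patchE /I indicE; case: ifPn => _; first by rewrite !mulr1.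
  by rewrite !mulr0 normr0 powR0// gt_eqF.
set A := (X in X <= _); set B := (X in _ <= X `^ _ -> _) => AB.
have A0 : 0 <= A by apply: integral_ge0 => r _; rewrite lee_fin.
have B0 : 0 <= B by apply: integral_ge0 => r _; rewrite lee_fin powR_ge0.
rewrite -/A -/B; have -> : B = (B `^ p^-1) `^ p by rewrite -poweRrM mulVf ?poweRe1// gt_eqF.
by apply: gt0_ler_poweR; rewrite ?in_itv/= ?leey ?andbT ?poweR_ge0// ltW.
Qed.

Lemma measurable_segment_comp g v : continuous g ->
  measurable_fun setT (fun z : X * measurableTypeR R => g (z.2 *: v + z.1)%R).
Proof.
move=> cg; apply: (measurableT_comp (continuous_measurable_rV cg)).
by apply: measurable_fun_rVD => //; apply: measurable_fun_rVZ.
Qed.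

(** After Tonelli, each inner integral over [x] is a translate of the integral of [F], and [r]
    ranges over a set of measure 1. *)
Lemma ge0_integral_segment (F : X -> R) v : measurable_fun setT F -> (forall x, 0 <= F x)%R ->
  measurable_fun setT (fun z : X * measurableTypeR R => F (z.2 *: v + z.1)%R) ->
  \int[mu]_x \int[lam]_(r in `[0%R, 1%R]) (F (r *: v + x)%R)%:E = \int[mu]_x (F x)%:E.
Proof.
move=> mF F0 mFv; pose G (z : X * measurableTypeR R) : \bar R :=
  (\1_(`[0%R, 1%R]%classic) z.2)%:E * (F (z.2 *: v + z.1)%R)%:E.
have mG : measurable_fun setT G.
  apply: emeasurable_funM; apply/measurable_EFinP => //.
  apply: (@measurableT_comp _ _ _ _ _ _ (\1_(`[0%R, 1%R]%classic) : measurableTypeR R -> R)) => //.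
have G0 z : 0 <= G z by rewrite mule_ge0// lee_fin// indicE.
transitivity (\int[mu]_x \int[lam]_r G (x, r)).
  apply: eq_integral => x _; rewrite ge0_integral_unit_segment// => [|r]; last by rewrite lee_fin.
  apply/measurable_EFinP; apply: (@measurableT_comp _ _ _ _ _ _ (fun z : X * measurableTypeR R => F (z.2 *: v + z.1)%R) _ (fun r => (x, r))) => //; exact: pair1_measurable.
rewrite fubini_tonelli//.
transitivity (\int[lam]_r ((\1_(`[0%R, 1%R]%classic) r)%:E * \int[mu]_x (F x)%:E)).
  apply: eq_integral => r _; rewrite /G /= ge0_integralZl//=; last 2 first.
  - apply/measurable_EFinP; apply: (@measurableT_comp _ _ _ _ _ _ (fun z : X * measurableTypeR R => F (z.2 *: v + z.1)%R) _ (fun x => (x, r))) => //; exact: pair2_measurable.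
  - by move=> x _; rewrite lee_fin.
  congr (_ * _); under eq_integral do rewrite addrC.
  by rewrite (@ge0_integral_rV_translate _ _ (r *: v) (EFin \o F))//; exact/measurable_EFinP.
rewrite ge0_integralZr//=; last 2 first.
- by apply/measurable_EFinP; exact: measurable_indic.
- by apply: integral_ge0 => x _; rewrite lee_fin.
by rewrite integral_indic_unit_segment mul1e.
Qed.

(** The increment is the integral of the derivative along the segment from x to x + t e_i. Hoelder
    on the segment brings the power p inside, and integration over [x] removes the translation by
    [ge0_integral_segment]. *)
Lemma integral_increment_powR (U : set X) f i (t p : R) : (1 < p)%R -> test_function U f ->
  \int[mu]_x (`|f (t *: basis_vec R i + x) - f x| `^ p)%:E <=
  (`|t| `^ p)%:E * \int[mu]_x (`|'D_(basis_vec R i) f x| `^ p)%:E.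
Proof.
move=> p1 tf; set e := basis_vec R i; pose v := (t *: e)%R.
have p0 : (0 < p)%R by apply: lt_trans p1.
have [sf _ _] := tf; have [cf /(_ i)[df [cdf _]]] := sf 1%N.
have dv x := is_derive_scale_dir t (df x).
have Dv : 'D_v f = (fun x => 'D_e f x * t)%R by apply/funext => x; have [_ ->] := dv x.
have dfv x : derivable f x v by have [] := dv x.
have cdv : continuous ('D_v f).
  by rewrite Dv => x; apply: (@continuousM _ _ ('D_e f) (cst t) x); [exact: cdf|exact: cst_continuous].
have mdv : measurable_fun setT ('D_v f) by exact: continuous_measurable_rV.
have mde : measurable_fun setT ('D_e f) by exact: (continuous_measurable_rV cdf).
have mp (F : X -> R) : measurable_fun setT F -> measurable_fun setT (fun x => `|F x| `^ p)%R.
  by move=> mF; apply: (measurableT_comp (measurable_powR _)); exact: measurableT_comp.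
have mf : measurable_fun setT f by exact: test_function_measurable tf.
have mz : measurable_fun setT (fun z : X * measurableTypeR R => `|'D_v f (z.2 *: v + z.1)%R| `^ p)%R.
  apply: (measurableT_comp (measurable_powR _)); apply: measurableT_comp => //.
  exact: (@measurable_segment_comp ('D_v f) v cdv).
apply: (@le_trans _ _ (\int[mu]_x \int[lam]_(r in `[0%R, 1%R]) (`|'D_v f (r *: v + x)%R| `^ p)%:E)).
  apply: ge0_le_integral => //.
  - apply/measurable_EFinP; apply: (mp (fun x => f (v + x) - f x)%R).
    apply: (@measurable_funB _ _ _ setT (fun x => f (v + x)%R) f) => //.
    by apply: (measurableT_comp mf); apply: measurable_fun_rVD => //; exact: measurable_cst.
  - have -> : (fun x => \int[lam]_(r in `[0%R, 1%R]) (`|'D_v f (r *: v + x)%R| `^ p)%:E) =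
        fubini_F lam (fun z : X * measurableTypeR R => (\1_(`[0%R, 1%R]%classic) z.2)%:E * (`|'D_v f (z.2 *: v + z.1)%R| `^ p)%:E).
      apply/funext => x; rewrite ge0_integral_unit_segment//.
      apply/measurable_EFinP; apply: (@measurableT_comp _ _ _ _ _ _ (fun z : X * measurableTypeR R => `|'D_v f (z.2 *: v + z.1)%R| `^ p)%R _ (fun r => (x, r))) => //; exact: pair1_measurable.
    apply: measurable_fun_fubini_tonelli_F.
      apply: emeasurable_funM; apply/measurable_EFinP; last exact: mz.
      by apply: (@measurableT_comp _ _ _ _ _ _ (\1_(`[0%R, 1%R]%classic) : measurableTypeR R -> R)).
    by move=> z; rewrite mule_ge0// lee_fin ?powR_ge0// indicE.
  - move=> x _.
    have cline := @continuous_line _ _ ('D_v f) x v cdv.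
    have mline : measurable_fun setT (fun r : measurableTypeR R => 'D_v f (r *: v + x)%R).
      exact: continuous_measurable_fun.
    apply: le_trans (unit_segment_hoelder p1 mline).
    rewrite -poweR_EFin; apply: (gt0_ler_poweR (ltW p0)); rewrite ?in_itv/= ?leey ?andbT ?lee_fin ?integral_ge0//.
    rewrite -[(`|_|)%:E]/(`|(f (v + x) - f x)%R%:E|) -(line_FTC x _ dfv cdv)//.
    by apply: (le_trans (le_abse_integral _ _ _)) => //; apply: measurable_funTS; exact/measurable_EFinP.
rewrite (@ge0_integral_segment (fun x => `|'D_v f x| `^ p)%R v)//.
- rewrite -ge0_integralZl//=.
  + apply: ge0_le_integral => //.
    * by apply/measurable_EFinP; exact: (mp ('D_v f) mdv).
    * apply: emeasurable_funM => //; apply/measurable_EFinP; exact: (mp ('D_e f) mde).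
    * move=> x _; have [_ Dvx] := dv x; rewrite Dvx -EFinM lee_fin normrM mulrC powRM//.
  + by apply/measurable_EFinP; exact: (mp ('D_e f) mde).
- exact: (mp ('D_v f) mdv).
Qed.

(** The integral of f(x + e_i) - f(x) is computed in two ways: it is 0 by translation invariance,
    and by the fundamental theorem of calculus and Fubini it is the integral of the partial
    derivative. *)
Lemma integral_partial (U : set X) f i : test_function U f ->
  \int[mu]_x ('D_(basis_vec R i) f x)%:E = 0.
Proof.
move=> tf; set e := basis_vec R i; set g := 'D_e f.
have tg : test_function U g by exact: test_function_partial.
have [sf _ _] := tf; have [cf /(_ i)[df [cdf _]]] := sf 1%N.
have if_ := test_function_integrable tf; have ig := test_function_integrable tg.
have mf := test_function_measurable tf; have mg := test_function_measurable tg.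
have ms : measurable_fun setT (fun x : X => f (x + e)%R).
  by apply: (measurableT_comp mf); apply: measurable_fun_rVD => //; exact: measurable_cst.
have is_ : mu.-integrable setT (EFin \o (fun x : X => f (x + e)%R)).
  apply/integrableP; split; first exact/measurable_EFinP.
  rewrite (@ge0_integral_rV_translate _ _ e (fun x => `|(f x)%:E|))//; first by have /integrableP[] := if_.
  by apply: measurableT_comp => //; exact/measurable_EFinP.
have I0 : \int[mu]_x (f (e + x) - f x)%:E = 0.
  transitivity (\int[mu]_x ((f (x + e)%R)%:E - (f x)%:E)).
    by apply: eq_integral => x _; rewrite (addrC e) EFinB.
  rewrite integralB_EFin// (@integral_rV_translate _ _ e (EFin \o f)); last exact/measurable_EFinP.
  by rewrite subee// integrable_fin_num.
pose F (z : X * measurableTypeR R) : \bar R :=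
  (\1_(`[0%R, 1%R]%classic) z.2)%:E * (g (z.2 *: e + z.1)%R)%:E.
have mgz := measurable_segment_comp e cdf.
have m1 : measurable_fun setT (fun z : X * measurableTypeR R => (\1_(`[0%R, 1%R]%classic) z.2)%:E : \bar R).
  by apply/measurable_EFinP; apply: (@measurableT_comp _ _ _ _ _ _ (\1_(`[0%R, 1%R]%classic) : measurableTypeR R -> R)).
have mF : measurable_fun setT F by apply: emeasurable_funM => //; exact/measurable_EFinP.
have absF x r : `|F (x, r)| = (\1_(`[0%R, 1%R]%classic) r)%:E * (`|g (r *: e + x)%R|)%:E.
  by rewrite /F abseM; congr (_ * _); rewrite gee0_abs// lee_fin indicE.
have iF : (mu \x lam).-integrable setT F.
  apply/integrable12ltyP => //.
  rewrite (_ : \int[mu]_x _ = \int[mu]_x \int[lam]_(r in `[0%R, 1%R]) ((fun x => `|g x|%R) (r *: e + x)%R)%:E).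
    rewrite (@ge0_integral_segment (fun x => `|g x|%R) e)//; [|exact: measurableT_comp|exact: measurableT_comp].
    by have /integrableP[] := ig.
  apply: eq_integral => x _; rewrite ge0_integral_unit_segment//; first by apply: eq_integral.
  apply/measurable_EFinP; apply: measurableT_comp => //; apply: continuous_measurable_fun.
  exact: (@continuous_line _ _ ('D_e f) x e cdf).
have := Fubini iF.
have -> : \int[mu]_x \int[lam]_y F (x, y) = 0.
  rewrite -I0; apply: eq_integral => x _; rewrite -(line_FTC x cf df cdf).
  rewrite [RHS]integral_mkcond; apply: eq_integral => r _; rewrite /F patchE indicE /=.
  by case: ifPn => _; rewrite ?mul1e ?mul0e.
have -> : \int[lam]_y \int[mu]_x F (x, y) = \int[lam]_r ((\1_(`[0%R, 1%R]%classic) r)%:E * \int[mu]_x (g x)%:E).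
  apply: eq_integral => r _; rewrite /F /=.
  have h : \int[mu]_x (g (r *: e + x)%R)%:E = \int[mu]_x (g x)%:E.
    under eq_integral do rewrite addrC.
    by rewrite (@integral_rV_translate _ _ (r *: e) (EFin \o g))//; exact/measurable_EFinP.
  rewrite indicE; case: (_ \in _); last by under eq_integral do rewrite mul0e; rewrite integral0 mul0e.
  by rewrite mul1e -h; apply: eq_integral => x _; rewrite mul1e.
have -> : \int[mu]_x (g x)%:E = (fine (\int[mu]_x (g x)%:E))%:E by rewrite fineK// integrable_fin_num.
rewrite integralZr//; last first.
  apply/integrableP; split; first by apply/measurable_EFinP; exact: measurable_indic.
  rewrite (_ : \int[lam]_x _ = 1) ?ltry// -integral_indic_unit_segment.
  by apply: eq_integral => r _; rewrite /= ger0_norm// indicE.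
by rewrite integral_indic_unit_segment mul1e.
Qed.

End partial_integrals.

                                      

(** * Almost everywhere uniqueness of representatives *)

Section orthants.
Context {R : realType} {n : nat}.
Local Notation X := 'rV[R]_n.
Local Notation mu := (lebesgue_rV R n).

                                                                      
(** Infinite bounds are allowed so that the half-spaces x_i < r are included; these sets form a
    pi-system generating the Borel sets. *)
Definition orthant (b : 'I_n -> \bar R) : set X :=
  [set x | forall i, ((x ord0 i)%:E < b i)%E].

Definition orthant_bump (b : 'I_n -> \bar R) : X -> R :=
  \prod_(i < n) (if b i is r%:E then fun x : X => flat 1 (r - x ord0 i)
                 else if b i is +oo%E then cst 1 else cst 0).

Lemma orthant_bumpE b x : orthant_bump b x =
  \prod_(i < n) (if b i is r%:E then flat 1 (r - x ord0 i)
                 else if b i is +oo%E then 1 else 0).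
Proof.
transitivity (\prod_(i < n) ((if b i is r%:E then fun x : X => flat 1 (r - x ord0 i)
                 else if b i is +oo%E then cst 1 else cst 0) : X -> R) x).
  rewrite /orthant_bump; elim/big_ind2 : _ => //.
  by move=> f r g s fx gx; rewrite -fx -gx.
by apply: eq_bigr => i _; case: (b i).
Qed.

Lemma smooth_orthant_bump b : smooth (orthant_bump b).
Proof.
move=> k; apply: Ck_prod => i; case: (b i) => [r||]; [|exact: Ck_cst|exact: Ck_cst].
apply: (@Ck_flat _ _ k 1 (cst r + - (fun x : X => x ord0 i))).
by apply: CkD; [exact: Ck_cst|apply: CkN; exact: Ck_coord].
Qed.

Lemma orthant_bump_gt0 b x : orthant b x -> 0 < orthant_bump b x.
Proof.
move=> bx; rewrite orthant_bumpE prodr_gt0// => i _; have := bx i.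
case: (b i) => [r||] //=; rewrite lte_fin => xr.
by rewrite flat1_gt0// subr_gt0.
Qed.

Lemma orthant_bump_ge0 b x : 0 <= orthant_bump b x.
Proof.
rewrite orthant_bumpE prodr_ge0// => i _; case: (b i) => [r||] //=.
exact: flat1_ge0.
Qed.

Lemma orthant_bump_out b x : ~ orthant b x -> orthant_bump b x = 0.
Proof.
move=> /existsNP[i bx]; apply/eqP; rewrite orthant_bumpE prodf_seq_eq0.
apply/hasP; exists i; first exact: mem_index_enum.
move: bx; case: (b i) => [r||] //=; last by rewrite ltry.
by move/negP; rewrite lte_fin -leNgt => h; rewrite flat_le0// subr_le0.
Qed.

Lemma measurable_orthant b : measurable (orthant b).
Proof.
rewrite (_ : orthant b = [set x | 0 < orthant_bump b x]).
  apply: open_measurable_rV; rewrite (_ : mkset _ = orthant_bump b @^-1` `]0, +oo[%classic).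
    apply: open_comp; last exact: interval_open.
    by move=> x _; have [cb _] := smooth_orthant_bump b 0%N; exact: cb.
  by apply/seteqP; split => x /=; rewrite in_itv/= andbT.
apply/seteqP; split => x; first exact: orthant_bump_gt0.
by move=> /= h; apply: contrapT => /orthant_bump_out bx; rewrite bx ltxx in h.
Qed.

Lemma orthant_setI : setI_closed (range orthant).
Proof.
move=> _ _ [b _ <-] [c _ <-]; exists (fun i => mine (b i) (c i)) => //.
apply/seteqP; split=> x /=.
  by move=> h; split=> i; have := h i; rewrite lt_min => /andP[].
by move=> [hb hc] i; rewrite lt_min hb hc.
Qed.

Lemma measurable_rV_orthants : (measurable : set (set X)) = <<s range orthant >>.
Proof.
apply/seteqP; split; last first.
  apply: smallest_sub; first exact: sigma_algebra_measurable.
  by move=> _ [b _ <-]; exact: measurable_orthant.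
apply: smallest_sub; first exact: smallest_sigma_algebra.
rewrite -bigcup_seq; apply: bigcup_sub => i _ _ [B mB <-].
suff : measurable_fun setT ((fun x => x ord0 i) : g_sigma_algebraType (range orthant) -> measurableTypeR R).
  by move=> /(_ measurableT B mB).
apply: (measurability _ (RGenInftyO.measurableE R)).
move=> _ [_ [r ->] <-]; rewrite setTI; apply: sub_sigma_algebra.
exists (fun j => if j == i then r%:E else +oo%E) => //.
apply/seteqP; split=> x /=.
  by move=> /(_ i); rewrite eqxx lte_fin in_itv.
rewrite in_itv/= => xr j; case: eqP => [->|_]; first by rewrite lte_fin.
by rewrite ltry.
Qed.

(** The plateaus of the orthant bump at heights 1/(k+1) are smooth, bounded by 1, and converge
    pointwise to the indicator of the orthant; dominated convergence concludes. *)
Lemma integral_orthant_eq0 (g : X -> R) b : mu.-integrable setT (EFin \o g) ->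
  (forall psi : X -> R, smooth psi -> (\int[mu]_x (g x * psi x)%:E = 0)%E) ->
  (\int[mu]_(x in orthant b) (g x)%:E = 0)%E.
Proof.
move=> ig g0.
have mg : measurable_fun setT g by apply/measurable_EFinP; exact: measurable_int ig.
pose F (k : nat) (x : X) : \bar R := (g x * plateau k.+1%:R^-1 (orthant_bump b) x)%:E.
have mF k : measurable_fun setT (F k).
  apply/measurable_EFinP; apply: measurable_funM => //.
  apply: continuous_measurable_rV.
  by have [] := smooth_plateau k.+1%:R^-1 (smooth_orthant_bump b) 0%N.
have mO := measurable_orthant b.
have mgO : measurable_fun setT ((EFin \o g) \_ (orthant b)).
  by apply/(measurable_restrictT _ mO); apply: measurable_funTS; exact/measurable_EFinP.
have Fcvg x : F k x @[k --> \oo] --> ((EFin \o g) \_ (orthant b)) x.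
  rewrite patchE; case: ifPn => xb; apply: cvg_near_cst.
    have bx := orthant_bump_gt0 (set_mem xb).
    near=> k; rewrite /F plateau_eq1 ?mulr1//.
    by apply: ltW; near: k; exact: (near_infty_natSinv_lt (PosNum bx)).
  near=> k; rewrite /F plateau_eq0 ?mulr0// ?invr_gt0 ?ltr0n//.
  by apply: orthant_bump_out => xb'; move/negP: xb; apply; exact: mem_set.
have Fg x k : (`|F k x| <= (abse \o (EFin \o g)) x)%E.
  rewrite /F /= lee_fin normrM ler_piMr//.
  have kp : 0 < k.+1%:R^-1 :> R by rewrite invr_gt0 ltr0n.
  have /andP[h1 h2] := plateau_itv kp (orthant_bump_ge0 b x).
  by rewrite ger0_norm.
have [_ _ cvgF] := @dominated_convergence _ _ _ mu setT measurableT F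
  ((EFin \o g) \_ (orthant b)) (abse \o (EFin \o g)) mF mgO
  (aeW _ (fun x _ => Fcvg x)) (integrable_abse ig) (aeW _ (fun x k _ => Fg x k)).
rewrite integral_mkcond -(cvg_lim _ cvgF)//.
apply: lim_near_cst => //; near=> k; rewrite /F; apply: g0.
exact/smooth_plateau/smooth_orthant_bump.
Unshelve. all: by end_near. Qed.

(** The measurable sets over which [g] has integral 0 form a Dynkin system containing the orthants,
    hence contain every measurable set. *)
Lemma ae_eq0_smooth (g : X -> R) : mu.-integrable setT (EFin \o g) ->
  (forall psi : X -> R, smooth psi -> (\int[mu]_x (g x * psi x)%:E = 0)%E) ->
  {ae mu, forall x, g x = 0}.
Proof.
move=> ig g0.
have gT : (\int[mu]_x (g x)%:E = 0)%E.
  have := g0 (cst 1) (fun k => Ck_cst _ k 1); under eq_integral do rewrite mulr1.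
  by [].
have H A : measurable A -> (\int[mu]_(x in A) (g x)%:E = 0)%E.
  rewrite [X in X A -> _]measurable_rV_orthants.
  apply: (@dynkin_induction _ _ (range orthant) (fun A => \int[mu]_(x in A) (g x)%:E = 0)%E measurable_rV_orthants orthant_setI) => //.
  - by move=> _ [b _ <-]; exact: integral_orthant_eq0.
  - move=> S mS S0.
    have := @integral_setU _ _ _ mu S (~` S) (EFin \o g) mS (measurableC mS).
    rewrite setUv => /(_ _ _)/=; rewrite gT S0 add0e => <- //.
    + exact: measurable_int ig.
    + by apply/disj_setPS => x [].
  - move=> F mF tF F0; rewrite (@integral_bigcup _ _ _ mu F (EFin \o g))//.
      by rewrite eseries0.
    by apply: integrableS ig => //; exact: bigcup_measurable.
have := @integral_ae_eq _ _ _ mu setT measurableT (cst 0%E) (EFin \o g) ig.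
move=> /(_ _ _)[]//.
  by move=> E _ mE; rewrite /= H// integral0.
by move=> N [mN N0 gN]; exists N; split=> // x /= gx; apply: gN => /= h; apply: gx; exact: EFin_inj (h I).
Qed.

End orthants.

Section representatives.
Context {R : realType} {n : nat}.
Local Notation X := 'rV[R]_n.
Local Notation mu := (lebesgue_rV R n).
Implicit Types (U : set X) (f g : X -> R).

Lemma Lp_funP U (p : R) f : 1 <= p ->
  Lp_fun U p f <-> measurable_fun setT (f \_ U) /\ (\int[mu]_x (`|(f \_ U) x| `^ p)%:E < +oo)%E.
Proof.
move=> p1; have p0 : 0 < p by apply: lt_le_trans p1.
rewrite /Lp_fun /= inE; split.
  move=> /andP[/[!inE]/= mf]; rewrite /finite_norm unlock /Lnorm => h; split=> //.
  have := poweR_lty p h; rewrite -poweRrM mulVf ?gt_eqF// poweRe1//.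
  by apply: integral_ge0 => x _; rewrite poweR_ge0.
move=> [mf ff]; apply/andP; split; rewrite inE//=.
by rewrite /finite_norm unlock /Lnorm poweR_lty.
Qed.

Lemma ler_Dpowr (a p : R) : 1 <= p -> 0 <= a -> a <= 1 + a `^ p.
Proof.
move=> p1 a0; have [a1|/ltW a1] := leP a 1; first by rewrite (le_trans a1)// lerDl powR_ge0.
by rewrite (le_trans (le1r_powR a1 p1))// lerDr.
Qed.

(** From a <= 1 + a^p, the product is dominated by |eta| + M |f|^p, where M bounds |eta|. *)
Lemma Lp_fun_mul_integrable U (p : R) f eta : 1 <= p -> open U -> Lp_fun U p f ->
  test_function U eta -> mu.-integrable setT (fun x => (eta x * (f \_ U) x)%:E).
Proof.
move=> p1 oU /(Lp_funP _ _ p1)[mf ff] te.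
have [M M0 eM] := test_function_bounded te.
have me := test_function_measurable te; have ie := integrable_abse (test_function_integrable te).
have mfp : measurable_fun setT (fun x => (`|(f \_ U) x| `^ p)%:E).
  apply/measurable_EFinP; apply: (measurableT_comp (measurable_powR _)).
  exact: measurableT_comp.
have ifp : mu.-integrable setT (fun x => (`|(f \_ U) x| `^ p)%:E).
  apply/integrableP; split=> //; under eq_integral do rewrite gee0_abs ?lee_fin ?powR_ge0//.
  exact: ff.
apply: (le_integrable measurableT _ _ (integrableD measurableT ie (integrableZl measurableT M ifp))).
  by apply/measurable_EFinP; apply: measurable_funM.
move=> x _ /=; rewrite !lee_fin [leRHS]ger0_norm; last first.
  by rewrite addr_ge0// mulr_ge0 ?powR_ge0// ltW.
rewrite normrM (le_trans (ler_wpM2l _ (ler_Dpowr p1 _)))// mulrDr mulr1 lerD2l.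
by rewrite ler_wpM2r// powR_ge0.
Qed.

Lemma regular_distE U f (phi : testfun U) :
  regular_dist f phi = \int[mu]_x (phi x * (f \_ U) x).
Proof.
rewrite /regular_dist Rintegral_mkcond; congr fine; apply: eq_integral => x _.
rewrite !patchE; case: ifPn => _; first by rewrite mulrC.
by rewrite mulr0.
Qed.

Lemma regular_dist_EFin U (p : R) f (phi : testfun U) : 1 <= p -> open U -> Lp_fun U p f ->
  (regular_dist f phi)%:E = (\int[mu]_x (phi x * (f \_ U) x)%:E)%E.
Proof.
move=> p1 oU fp; rewrite regular_distE /Rintegral fineK// integrable_fin_num//.
exact: (Lp_fun_mul_integrable p1 oU fp (testfunP phi)).
Qed.

(** The function eta (f - g) is integrable on the whole space, and its integral against a smooth psi
    is the difference of the two pairings with the test function psi eta. This allows the L^p norm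
    and the Slobodeckij seminorm, which are separate infima, to be estimated through different
    representatives. *)
Lemma representatives_ae_eq U (p : R) f g (eta : testfun U) : 1 <= p -> open U ->
  Lp_fun U p f -> Lp_fun U p g -> regular_dist f = regular_dist g :> (testfun U -> R^o) ->
  {ae mu, forall x, eta x * (f \_ U) x = eta x * (g \_ U) x}.
Proof.
move=> p1 oU fp gp fg.
have i1 := Lp_fun_mul_integrable p1 oU fp; have i2 := Lp_fun_mul_integrable p1 oU gp.
have ie := integrableB measurableT (i1 _ (testfunP eta)) (i2 _ (testfunP eta)).
have h := @ae_eq0_smooth _ _ (fun x => eta x * (f \_ U) x - eta x * (g \_ U) x) ie.
apply: filterS (h _) => [x /eqP|psi spsi]; first by rewrite subr_eq0 => /eqP.
have tp : test_function U (psi * (eta : X -> R)) by exact: test_functionMl (testfunP eta).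
have tP : psi * (eta : X -> R) \in test_pred U by rewrite inE.
have := regular_dist_EFin (TestFun tP) p1 oU fp.
rewrite fg (regular_dist_EFin (TestFun tP) p1 oU gp) /= => E.
transitivity (\int[mu]_x (((psi x * eta x) * (f \_ U) x)%:E - ((psi x * eta x) * (g \_ U) x)%:E))%E.
  by apply: eq_integral => x _; rewrite -EFinB -mulrBr -mulrBr mulrC mulrA.
rewrite integralB//; [|exact: i1|exact: i2].
rewrite -[X in (X - _)%E]E subee// integrable_fin_num//; exact: i2.
Qed.

End representatives.

                             

(** * Power inequalities and integrability of the truncated kernel *)

Section powR_sums.
Context {R : realType}.
Implicit Types a b c p : R.

Lemma ler_powRD p a b : 0 <= p -> 0 <= a -> 0 <= b ->
  (a + b) `^ p <= 2 `^ p * (a `^ p + b `^ p).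
Proof.
move=> p0; wlog ab : a b / a <= b => [H a0 b0|a0 b0].
  have [ab|/ltW ba] := leP a b; first exact: H.
  by rewrite addrC [a `^ p + _]addrC; exact: H.
apply: (@le_trans _ _ (2 `^ p * b `^ p)).
  by rewrite -powRM// ge0_ler_powR ?nnegrE ?addr_ge0 ?mulr_ge0//; lra.
by rewrite ler_wpM2l ?powR_ge0// lerDr powR_ge0.
Qed.

Lemma ler_powRD3 p a b c : 0 <= p -> 0 <= a -> 0 <= b -> 0 <= c ->
  (a + b + c) `^ p <= 4 `^ p * (a `^ p + b `^ p + c `^ p).
Proof.
move=> p0 a0 b0 c0; apply: (le_trans (ler_powRD p0 (addr_ge0 a0 b0) c0)).
have -> : 4 `^ p = 2 `^ p * 2 `^ p :> R by rewrite -powRM//; congr (_ `^ _); lra.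
rewrite -mulrA ler_wpM2l ?powR_ge0// mulrDr lerD ?ler_powRD//.
rewrite ler_peMl ?powR_ge0//.
have p2 : 1 <= 2 :> R by rewrite ler1n.
by have := ler_powR p2 p0; rewrite powRr0.
Qed.

Lemma powR_expn (x s : R) (j : nat) : 0 <= x -> (x ^+ j) `^ s = (x `^ s) ^+ j.
Proof. by move=> x0; rewrite -powR_mulrn// powRAC powR_mulrn// powR_ge0. Qed.

Lemma powRV (x a : R) : 0 <= x -> x^-1 `^ a = (x `^ a)^-1.
Proof. by move=> x0; rewrite -powR_inv1// -powRrM mulN1r powRN. Qed.

Lemma ler_powRV (a x y : R) : 0 <= a -> 0 < y -> y <= x -> (x `^ a)^-1 <= (y `^ a)^-1.
Proof.
move=> a0 y0 yx; have x0 := lt_le_trans y0 yx.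
by rewrite lef_pV2 ?posrE ?powR_gt0// ge0_ler_powR ?nnegrE ?(ltW x0) ?(ltW y0).
Qed.

Lemma geometric_nneseries_lty (C q : R) : 0 <= C -> 0 <= q -> q < 1 ->
  (\sum_(0 <= j <oo) (C * q ^+ j)%:E < +oo)%E.
Proof.
move=> C0 q0 q1; apply: (@le_lt_trans _ _ (C / (1 - q))%:E); last by rewrite ltry.
apply: lime_le; first by apply: is_cvg_nneseries => j _ _; rewrite lee_fin mulr_ge0// exprn_ge0.
apply: nearW => m; rewrite sumEFin lee_fin.
have := @geometric_seriesE _ C q ltac:(by rewrite lt_eqF).
move=> /(congr1 (@^~ m)); rewrite /series /= => ->.
rewrite ler_wpM2r ?invr_ge0 ?subr_ge0 ?(ltW q1)//.
by rewrite ler_piMr// lerBlDr lerDl exprn_ge0.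
Qed.

End powR_sums.

Section kernel.
Context {R : realType} {n : nat}.
Local Notation X := 'rV[R]_n.
Local Notation mu := (lebesgue_rV R n).
Implicit Types (x y h : X).

(** Volumes are computed for sup-norm balls while the kernel is Euclidean. The kernel decreases in
    the Euclidean norm, so a lower bound for that norm is what estimates from above require. *)
Lemma norm_le_eucl h : `|h| <= eucl_norm h.
Proof.
rewrite [leLHS]/Num.norm/= mx_normrE; apply/bigmax_leP; split=> [|[a i] _ /=].
  exact: sqrtr_ge0.
rewrite (ord1 a) -sqrtr_sqr ler_sqrt ?sumr_ge0// => [|j _]; last exact: sqr_ge0.
by rewrite (bigD1 i)//= lerDl sumr_ge0// => j _; exact: sqr_ge0.
Qed.

Lemma eucl_normN h : eucl_norm (- h) = eucl_norm h.
Proof. by congr Num.sqrt; apply: eq_bigr => i _; rewrite mxE sqrrN. Qed.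

Lemma measurable_eucl_norm : measurable_fun setT (@eucl_norm R n).
Proof.
apply: continuous_measurable_rV => x.
apply: (@continuous_comp _ _ _ (fun x : X => \sum_(i < n) x ord0 i ^+ 2)); last exact: sqrt_continuous.
have := @Ck_sum R n 0 _ (index_enum 'I_n) (fun i => (fun x : X => x ord0 i) * (fun x : X => x ord0 i))
  (fun i => CkM (Ck_coord 0 i) (Ck_coord 0 i)).
move=> [/(_ x) + _]; congr (continuous_at _ _); apply/funext => y.
transitivity (\sum_(i < n) ((fun x : X => x ord0 i) * (fun x : X => x ord0 i)) y).
  by elim/big_ind2 : _ => // f r g s fx gx; rewrite -fx -gx.
by apply: eq_bigr => i _; rewrite expr2.
Qed.

Definition slob_kernel (a : R) h : R := (eucl_norm h `^ a)^-1.

Lemma slob_kernel_ge0 a h : 0 <= slob_kernel a h.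
Proof. by rewrite invr_ge0 powR_ge0. Qed.

Lemma slob_kernelN a h : slob_kernel a (- h) = slob_kernel a h.
Proof. by rewrite /slob_kernel eucl_normN. Qed.

Lemma measurable_slob_kernel a : measurable_fun setT (slob_kernel a).
Proof.
rewrite (_ : slob_kernel a = (fun x : R => x `^ (- a)) \o @eucl_norm R n).
  by apply: (measurableT_comp (measurable_powR _)); exact: measurable_eucl_norm.
by apply/funext => h; rewrite /slob_kernel /= powRN.
Qed.

(** Up to a constant, a majorant for the Slobodeckij integrand of a bounded Lipschitz function at
    points that differ by [h]. *)
Definition trunc_kernel (p a : R) h : R := Num.min 1 `|h| `^ p * slob_kernel a h.

Lemma trunc_kernel_ge0 p a h : 0 <= trunc_kernel p a h.
Proof. by rewrite mulr_ge0 ?powR_ge0// slob_kernel_ge0. Qed.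

Lemma measurable_trunc_kernel p a : measurable_fun setT (trunc_kernel p a).
Proof.
apply: measurable_funM; last exact: measurable_slob_kernel.
apply: (measurableT_comp (measurable_powR _)).
apply: measurable_minr => //; apply: continuous_measurable_rV; exact: norm_continuous.
Qed.

Lemma lebesgue_rV_ball (r : R) : 0 < r -> mu (ball (0 : X) r) = ((2 * r) ^+ n)%:E.
Proof.
move=> r0; rewrite (_ : ball (0 : X) r = [set y : X | forall i, (ball (0 : R) r : set (measurableTypeR R)) (y ord0 i)]).
  rewrite (@lebesgue_rV_box R n (fun=> ball (0 : R) r)); last by move=> i; exact: open_measurable (ball_open _ _).
  under eq_bigr do rewrite lebesgue_measure_ball ?ltW//.
  by rewrite prodEFin prodr_const card_ord -[r *+ 2]mulr_natl.
rewrite -ball_normE; apply/seteqP; split => y /=.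
  by move=> /rV_normltP-/(_ r0) h i; have := h i; rewrite !mxE -ball_normE.
by move=> h; apply/rV_normltP => // i; have := h i; rewrite !mxE -ball_normE.
Qed.

Lemma dyadic_small (r : R) : 0 < r -> r < 1 -> exists j, 2^-1 ^+ j.+1 <= r < 2^-1 ^+ j.
Proof.
move=> r0 r1.
have [m rm] : exists m, 2^-1 ^+ m.+1 <= r.
  exists (Num.truncn r^-1); rewrite exprVn -[leRHS]invrK lef_pV2 ?posrE ?invr_gt0 ?exprn_gt0//.
  have := truncnS_gt r^-1; move=> /ltW h; apply: (le_trans h).
  by rewrite -natrX ler_nat ltnW// ltn_expl.
have exP : exists m, (fun m => 2^-1 ^+ m.+1 <= r) m by exists m.
exists (ex_minn exP); case: ex_minnP => j -> minj /=.
case: j minj => [|j] minj; first by rewrite expr0.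
by rewrite ltNge; apply/negP => /minj; rewrite ltnn.
Qed.

Lemma dyadic_large (r : R) : 1 <= r -> exists j, 2 ^+ j <= r < 2 ^+ j.+1.
Proof.
move=> r1; have r0 : 0 < r by apply: lt_le_trans r1.
have [m rm] : exists m, r < 2 ^+ m.+1.
  exists (Num.truncn r); apply: (lt_le_trans (truncnS_gt r)).
  by rewrite -natrX ler_nat ltnW// ltn_expl.
have exP : exists m, (fun m => r < 2 ^+ m.+1) m by exists m.
exists (ex_minn exP); case: ex_minnP => j -> minj /=; rewrite andbT.
case: j minj => [|j] minj; first by rewrite expr0.
by rewrite leNgt; apply/negP => /minj; rewrite ltnn.
Qed.

End kernel.

Section kernel_integrable.
Context {R : realType} {n : nat}.
Local Notation X := 'rV[R]_n.
Local Notation mu := (lebesgue_rV R n).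
Implicit Types (x y h : X).

Lemma trunc_kernel_small (p a : R) h j : 0 <= p -> 0 <= a -> 2^-1 ^+ j.+1 <= `|h| < 2^-1 ^+ j ->
  trunc_kernel p a h <= (2^-1 `^ p) ^+ j * (2 `^ a) ^+ j.+1.
Proof.
move=> p0 a0 /andP[h1 h2]; have w0 k : 0 < 2^-1 ^+ k :> R by rewrite exprn_gt0.
have m0 : 0 <= Num.min 1 `|h| by rewrite le_min ler01 normr_ge0.
rewrite -!powR_expn ?invr_ge0//; apply: ler_pM; rewrite ?powR_ge0 ?slob_kernel_ge0//.
  apply: ge0_ler_powR; rewrite ?nnegrE ?m0 ?(ltW (w0 j))//.
  by rewrite ge_min (ltW h2) orbT.
have -> : 2 ^+ j.+1 = (2^-1 ^+ j.+1)^-1 :> R by rewrite exprVn invrK.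
rewrite powRV; last exact: ltW (w0 _).
by apply: ler_powRV => //; apply: (le_trans h1); exact: norm_le_eucl.
Qed.

Lemma trunc_kernel_large (p a : R) h j : 0 <= p -> 0 <= a -> 2 ^+ j <= `|h| ->
  trunc_kernel p a h <= (2^-1 `^ a) ^+ j.
Proof.
move=> p0 a0 h1; have w0 k : 0 < 2 ^+ k :> R by rewrite exprn_gt0.
have hj : 1 <= `|h| by apply: le_trans h1; rewrite exprn_ege1// ler1n.
rewrite /trunc_kernel min_l// powR1 mul1r -powR_expn ?invr_ge0//.
rewrite /slob_kernel exprVn powRV; last exact: ltW (w0 _).
by apply: ler_powRV => //; apply: (le_trans h1); exact: norm_le_eucl.
Qed.

                                                                                                       
(** Dyadic shells. Where |h| is about 2^-j the kernel is at most [c j], and where |h| is about 2^j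
    it is at most [d j]. Multiplied by the volumes of the enclosing balls [B j] and [E j], these
    bounds become geometric, with ratios 2^(-p(1-theta)) and 2^(-theta p); theta < 1 makes the first
    series converge and theta > 0 the second. *)
Lemma trunc_kernel_lty (p theta : R) : 1 < p -> 0 < theta -> theta < 1 ->
  (\int[mu]_h (trunc_kernel p (n%:R + theta * p) h)%:E < +oo)%E.
Proof.
move=> p1 t0 t1; have p0 : 0 < p by apply: lt_trans p1.
set a := n%:R + theta * p.
have a0 : 0 < a by rewrite ltr_wpDl// mulr_gt0.
pose c j : R := (2^-1 `^ p) ^+ j * (2 `^ a) ^+ j.+1.
pose d j : R := (2^-1 `^ a) ^+ j.
pose B j : set X := ball (0 : X) (2^-1 ^+ j).
pose E j : set X := ball (0 : X) (2 ^+ j.+1).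
have c0 j : 0 <= c j by rewrite mulr_ge0// exprn_ge0// powR_ge0.
have d0 j : 0 <= d j by rewrite exprn_ge0// powR_ge0.
have w0 k : 0 < 2^-1 ^+ k :> R by rewrite exprn_gt0.
have e0 k : 0 < 2 ^+ k :> R by rewrite exprn_gt0.
have mB j : measurable (B j) by exact: measurable_rV_ball.
have mE j : measurable (E j) by exact: measurable_rV_ball.
have muB j : mu (B j) = ((2 * 2^-1 ^+ j) ^+ n)%:E by exact: lebesgue_rV_ball.
have muE j : mu (E j) = ((2 * 2 ^+ j.+1) ^+ n)%:E by exact: lebesgue_rV_ball.
have iB j : (\int[mu]_h (\1_(B j) h)%:E)%E = ((2 * 2^-1 ^+ j) ^+ n)%:E.
  by rewrite -muB integral_indic// setIT.
have iE j : (\int[mu]_h (\1_(E j) h)%:E)%E = ((2 * 2 ^+ j.+1) ^+ n)%:E.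
  by rewrite -muE integral_indic// setIT.
pose F (j : nat) (h : X) : \bar R := ((c j)%:E * (\1_(B j) h)%:E + (d j)%:E * (\1_(E j) h)%:E)%E.
have F0 j h : (0 <= F j h)%E.
  by rewrite adde_ge0// mule_ge0// lee_fin// indicE.
have mF j : measurable_fun setT (F j).
  by apply: emeasurable_funD; apply: emeasurable_funM => //; apply/measurable_EFinP; exact: measurable_indic.
have KF h : ((trunc_kernel p a h)%:E <= \sum_(j <oo) F j h)%E.
  have big j : (F j h <= \sum_(j <oo) F j h)%E.
    apply: le_trans (@nneseries_lim_ge _ (F ^~ h) xpredT 0%N j.+1 _) => //.
    by rewrite big_nat_recr//= leeDr// sume_ge0.
  have [h0|hn0] := eqVneq h 0.
    rewrite h0 /trunc_kernel normr0 min_r// powR0 ?gt_eqF// mul0r.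
    by apply: nneseries_ge0 => j _ _; exact: F0.
  have r0 : 0 < `|h| by rewrite normr_gt0.
  have [r1|r1] := ltP `|h| 1.
    have [j jP] := dyadic_small r0 r1; apply: le_trans (big j).
    have /andP[_ j2] := jP.
    have hB : h \in B j by rewrite inE /B -ball_normE /= sub0r normrN.
    rewrite /F indicE hB mule1 (le_trans _ (leeDl _ _))//; last by rewrite mule_ge0// lee_fin// indicE.
    by rewrite lee_fin trunc_kernel_small// ltW.
  have [j /andP[j1 j2]] := dyadic_large r1; apply: le_trans (big j).
  have hE : h \in E j by rewrite inE /E -ball_normE /= sub0r normrN.
  rewrite /F !indicE hE mule1 (le_trans _ (leeDr _ _))//; last by rewrite mule_ge0// lee_fin// indicE.
  by rewrite lee_fin trunc_kernel_large// ltW.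
pose q1 : R := 2^-1 `^ (p * (1 - theta)); pose q2 : R := 2^-1 `^ (theta * p).
have half_lt1 s : 0 < s -> 2^-1 `^ s < 1 :> R.
  move=> s0; have := @gt0_ltr_powR R s s0 2^-1 1; rewrite powR1; apply; rewrite ?nnegrE//.
  by rewrite invf_lt1// ltr1n.
have IF j : (\int[mu]_h F j h = (2 `^ a * 2 ^+ n * q1 ^+ j)%:E + (4 ^+ n * q2 ^+ j)%:E)%E.
  rewrite ge0_integralD//; last 4 first.
  - by move=> h _; rewrite mule_ge0// lee_fin// indicE.
  - by apply: emeasurable_funM => //; apply/measurable_EFinP; exact: measurable_indic.
  - by move=> h _; rewrite mule_ge0// lee_fin// indicE.
  - by apply: emeasurable_funM => //; apply/measurable_EFinP; exact: measurable_indic.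
  rewrite !ge0_integralZl_EFin//; try by [move=> h _; rewrite lee_fin indicE | apply/measurable_EFinP; exact: measurable_indic].
  rewrite iB iE -!EFinM; congr (_ + _)%E; congr EFin.
    have -> : q1 = 2^-1 `^ p * 2 `^ a * 2^-1 ^+ n.
      rewrite -powR_mulrn ?invr_ge0// (_ : 2 `^ a = 2^-1 `^ (- a)); last first.
        by rewrite powRN powRV// invrK.
      rewrite -!powRD ?invr_eq0 ?pnatr_eq0 ?implybT//; congr (_ `^ _).
      by rewrite /a; ring.
    rewrite /c !exprMn exprS -(exprM 2^-1 n) mulnC exprM; ring.
  have -> : q2 = 2^-1 `^ a * 2 ^+ n.
    have -> : 2 ^+ n = 2^-1 `^ (- n%:R) :> R by rewrite powRN powRV// powR_mulrn// invrK.
    rewrite -powRD ?invr_eq0 ?pnatr_eq0 ?implybT//; congr (_ `^ _).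
    by rewrite /a; ring.
  rewrite /d (_ : 2 * 2 ^+ j.+1 = 4 * 2 ^+ j) ?exprS; last by ring.
  by rewrite !exprMn -exprM mulnC exprM; ring.
apply: (@le_lt_trans _ _ (\int[mu]_h \sum_(j <oo) F j h)%E).
  apply: ge0_le_integral => //.
  - by move=> h _; rewrite lee_fin trunc_kernel_ge0.
  - by apply/measurable_EFinP; exact: measurable_trunc_kernel.
  - by apply: ge0_emeasurable_sum => // j h _ _; exact: F0.
rewrite integral_nneseries//.
under eq_eseriesr do rewrite IF.
rewrite nneseriesD; [|by move=> j _ _; rewrite lee_fin !mulr_ge0// ?exprn_ge0 ?powR_ge0..].
by apply: lte_add_pinfty; apply: geometric_nneseries_lty; rewrite ?mulr_ge0 ?powR_ge0 ?exprn_ge0// half_lt1// ?mulr_gt0// subr_gt0.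
Qed.

End kernel_integrable.

(** * Increments and the Slobodeckij seminorm under cut-offs *)

Section increments.
Context {R : realType} {n : nat}.
Local Notation X := 'rV[R]_n.
Local Notation mu := (lebesgue_rV R n).
Implicit Types (f g : X -> R) (x y h : X).

Lemma partial_lipschitz (U : set X) f : test_function U f -> exists2 L : R, 0 < L &
  forall i (t : R) x, `|f (t *: basis_vec R i + x) - f x| <= L * `|t|.
Proof.
move=> tf; have [sf _ _] := tf; have [cf df] := sf 1%N.
have /fin_all_exists[B BP] : forall i, exists b : R, 0 < b /\ forall x, `|'D_(basis_vec R i) f x| <= b.
  by move=> i; have [b b0 bP] := test_function_bounded (test_function_partial i tf); exists b.
pose L := 1 + \sum_i B i.
have L0 : 0 < L by rewrite ltr_pwDl// sumr_ge0// => i _; have [/ltW] := BP i.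
have BL i x : `|'D_(basis_vec R i) f x| <= L.
  have [_ /(_ x) h] := BP i; apply: (le_trans h).
  rewrite /L (bigD1 i)//= addrCA lerDl addr_ge0// sumr_ge0// => j _.
  by have [/ltW] := BP j.
have pos i (t : R) x : 0 < t -> `|f (t *: basis_vec R i + x) - f x| <= L * t.
  move=> t0; have [dfi _] := df i.
  have [s _ [_ ->]] := line_MVT x t0 cf dfi.
  by rewrite normrM (gtr0_norm t0) ler_wpM2r// ltW.
exists L => // i t x; have [t0|t0|->] := ltgtP t 0.
- rewrite (ltr0_norm t0); have nt0 : 0 < - t by rewrite oppr_gt0.
  have := pos i (- t) (t *: basis_vec R i + x) nt0.
  by rewrite scaleNr addrA addNr add0r distrC.
- by rewrite (gtr0_norm t0); exact: pos.
- by rewrite scale0r add0r subrr normr0 mulr0.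
Qed.

(** The minimum combines two bounds: a global one by twice the supremum, and a Lipschitz one
    obtained by moving one coordinate at a time. *)
Lemma test_function_lipschitz (U : set X) f : test_function U f -> exists2 L : R, 0 < L &
  forall x y, `|f x - f y| <= L * Num.min 1 `|x - y|.
Proof.
move=> tf; have [L L0 LP] := partial_lipschitz tf; have [M M0 MP] := test_function_bounded tf.
have inc (s : seq 'I_n) h x : `|f (\sum_(i <- s) h ord0 i *: basis_vec R i + x) - f x| <= (L *+ size s) * `|h|.
  elim: s x => [|i s IH] x; first by rewrite big_nil add0r subrr normr0 mulr0n mul0r.
  rewrite big_cons -addrA; set y := _ + x.
  rewrite (le_trans (ler_distD (f y) _ _))//= mulrS mulrDl lerD//.
    by rewrite (le_trans (LP _ _ _))// ler_wpM2l ?(ltW L0)// rV_coord_le_norm.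
  exact: IH.
exists (M + M + L *+ n); first by rewrite ltr_pwDl ?addr_gt0// mulrn_wge0// ltW.
move=> x y.
have h1 : `|f x - f y| <= M + M by rewrite (le_trans (ler_normB _ _))// lerD.
have h2 : `|f x - f y| <= (L *+ n) * `|x - y|.
  have := inc (enum 'I_n) (x - y) y; rewrite big_enum/= size_enum_ord.
  suff -> : \sum_i (x - y) ord0 i *: basis_vec R i = x - y by rewrite subrK.
  by rewrite [RHS]row_sum_delta.
have Ln0 : 0 <= L *+ n by rewrite mulrn_wge0// ltW.
rewrite minEle; case: ifPn => _.
  by rewrite mulr1 (le_trans h1)// lerDl.
by rewrite mulrDl (le_trans h2)// lerDr mulr_ge0// addr_ge0// ltW.
Qed.

End increments.

Section fractional_embedding.
Context {R : realType} {n : nat}.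
Local Notation X := 'rV[R]_n.
Local Notation mu := (lebesgue_rV R n).
Implicit Types (f g : X -> R) (x y h : X).
Local Open Scope ereal_scope.

(** The p-th power of the Slobodeckij seminorm; roots are taken only at the end, through
    [lee_root]. *)
Definition slob_int (U : set X) (theta p : R) f : \bar R :=
  \int[mu \x mu]_(z in U `*` U) (`|f z.1 - f z.2| `^ p * slob_kernel (n%:R + theta * p) (z.1 - z.2)%R)%:E.

Lemma measurable_powR_norm d (T : measurableType d) (F : T -> R) (p : R) :
  measurable_fun setT F -> measurable_fun setT (fun z : T => `|F z| `^ p)%R.
Proof. by move=> mF; apply: (measurableT_comp (measurable_powR _)); exact: measurableT_comp. Qed.

Lemma measurable_shift f h : measurable_fun setT f -> measurable_fun setT (fun x : X => f (h + x)%R).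
Proof. by move=> mf; apply: (measurableT_comp mf); apply: measurable_fun_rVD => //; exact: measurable_cst. Qed.

Definition increment_int (p : R) f h : \bar R := \int[mu]_x (`|f (h + x) - f x| `^ p)%:E.

(** Translation moves the base point of the [h]-increment to x + k, after which the two increments
    telescope. *)
Lemma increment_intD (p : R) f h k : (0 <= p)%R -> measurable_fun setT f ->
  increment_int p f (h + k) <= (2 `^ p)%:E * (increment_int p f h + increment_int p f k).
Proof.
move=> p0 mf.
have m1 (l : X) : measurable_fun setT (fun x : X => `|f (l + x) - f x| `^ p)%R.
  by apply: measurable_powR_norm; apply: measurable_funB => //; exact: measurable_shift.
have -> : increment_int p f h = \int[mu]_x (`|f (h + (x + k)) - f (x + k)%R| `^ p)%:E.
  rewrite (@ge0_integral_rV_translate _ _ k (fun x => (`|f (h + x) - f x| `^ p)%:E))//.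
  exact/measurable_EFinP.
have m2 : measurable_fun setT (fun x : X => `|f (h + (x + k)) - f (x + k)| `^ p)%R.
  apply: (measurableT_comp (m1 h)); apply: measurable_fun_rVD => //; exact: measurable_cst.
rewrite -ge0_integralD//; [|exact/measurable_EFinP|exact/measurable_EFinP].
rewrite -ge0_integralZl//=; last 2 first.
- by apply: emeasurable_funD; exact/measurable_EFinP.
- by move=> x _; rewrite -EFinD lee_fin addr_ge0// powR_ge0.
apply: ge0_le_integral => //.
- exact/measurable_EFinP.
- by apply: emeasurable_funM => //; apply: emeasurable_funD; exact/measurable_EFinP.
- move=> x _; rewrite -EFinD -EFinM lee_fin; apply: (le_trans _ (ler_powRD p0 _ _)) => //.
  apply: ge0_ler_powR; rewrite ?nnegrE ?addr_ge0//.
  rewrite -addrA [(k + x)%R]addrC; set a := f _; set b := f _; set c := f _.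
  by rewrite (le_trans _ (ler_normD _ _))// addrA subrK.
Qed.

(** The vector [h] is reached one coordinate at a time: [increment_intD] adds a step, and
    [integral_increment_powR] bounds it. *)
Lemma increment_int_le (U : set X) (p : R) : (1 < p)%R -> exists2 C : R, (0 <= C)%R &
  forall f h, test_function U f ->
  increment_int p f h <= (C * `|h| `^ p)%:E * \sum_i \int[mu]_x (`|'D_(basis_vec R i) f x| `^ p)%:E.
Proof.
move=> p1; have p0 : (0 <= p)%R by apply: ltW; apply: lt_trans p1.
pose A f := \sum_i \int[mu]_x (`|'D_(basis_vec R i) f x| `^ p)%:E.
have Ai f i : \int[mu]_x (`|'D_(basis_vec R i) f x| `^ p)%:E <= A f.
  rewrite /A (bigD1 i)//= leeDl// sume_ge0// => j _.
  by apply: integral_ge0 => x _; rewrite lee_fin powR_ge0.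
suff [C C0 CP] : exists2 C : R, (0 <= C)%R & forall f h, test_function U f ->
    increment_int p f (\sum_(i <- index_enum 'I_n) h ord0 i *: basis_vec R i)%R <=
    (C * `|h| `^ p)%:E * A f.
  exists C; first exact: C0.
  move=> f h tf; have := CP f h tf.
  by rewrite -[(\sum_(i <- _) _)%R]row_sum_delta.
have A0 f : 0 <= A f by apply: sume_ge0 => i _; apply: integral_ge0 => x _; rewrite lee_fin powR_ge0.
elim: (index_enum 'I_n) => [|i s [C C0 IH]].
  exists 0%R; first by [].
  move=> f h tf; rewrite big_nil mul0r mul0e /increment_int.
  rewrite integral0_eq// => x _; rewrite add0r subrr normr0 powR0//.
  by rewrite gt_eqF// (lt_trans _ p1).
exists (2 `^ p * (1 + C))%R; first by rewrite mulr_ge0 ?powR_ge0// addr_ge0.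
move=> f h tf; rewrite big_cons; have mf := test_function_measurable tf.
apply: (le_trans (increment_intD _ _ p0 mf)).
rewrite -mulrA EFinM -muleA lee_wpmul2l ?lee_fin ?powR_ge0//.
rewrite mulrDl mul1r EFinD ge0_muleDl ?lee_fin ?mulr_ge0 ?powR_ge0//.
apply: leeD; last exact: IH.
apply: (le_trans (integral_increment_powR i (h ord0 i) p1 tf)).
apply: lee_pmul; rewrite ?lee_fin ?powR_ge0//.
- by apply: integral_ge0 => x _; rewrite lee_fin powR_ge0.
- by apply: ge0_ler_powR; rewrite ?nnegrE// rV_coord_le_norm.
Qed.

Lemma increment_int_bound (U : set X) (p : R) f h : (1 < p)%R -> test_function U f ->
  increment_int p f h <= (2 `^ p * 2)%:E * \int[mu]_x (`|f x| `^ p)%:E.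
Proof.
move=> p1 tf; have p0 : (0 <= p)%R by apply: ltW; apply: lt_trans p1.
have mf := test_function_measurable tf.
have m1 : measurable_fun setT (fun x : X => `|f x| `^ p)%R by exact: measurable_powR_norm.
have m2 : measurable_fun setT (fun x : X => `|f (x + h)| `^ p)%R.
  by apply: (measurableT_comp m1); apply: measurable_fun_rVD => //; exact: measurable_cst.
rewrite EFinM -muleA; set I := \int[mu]_x _.
have -> : 2%:E * I = I + I by rewrite -[2%R]/(1 + 1)%R EFinD ge0_muleDl ?mul1e.
rewrite {1}/I -(@ge0_integral_rV_translate _ _ h (fun x => (`|f x| `^ p)%:E))//; last exact/measurable_EFinP.
rewrite -ge0_integralD//; [|exact/measurable_EFinP|exact/measurable_EFinP].
rewrite -ge0_integralZl//=; last 2 first.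
- by apply: emeasurable_funD; exact/measurable_EFinP.
- by move=> x _; rewrite -EFinD lee_fin addr_ge0// powR_ge0.
apply: ge0_le_integral => //.
- apply/measurable_EFinP; apply: measurable_powR_norm; apply: measurable_funB => //; exact: measurable_shift.
- by apply: emeasurable_funM => //; apply: emeasurable_funD; exact/measurable_EFinP.
- move=> x _; rewrite -EFinD -EFinM lee_fin [(x + h)%R]addrC; apply: (le_trans _ (ler_powRD p0 _ _)) => //.
  by apply: ge0_ler_powR; rewrite ?nnegrE ?addr_ge0// ler_normB.
Qed.

Lemma measurable_diff_kernel (k : X -> R) : measurable_fun setT k ->
  measurable_fun setT (fun z : X * X => k (z.1 - z.2)%R).
Proof. by move=> mk; apply: (measurableT_comp mk); apply: measurable_fun_rVB. Qed.

(** Substitute y = h + x and exchange the order of integration; the kernel is even. *)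
Lemma slob_int_increment (theta p : R) f : measurable_fun setT f ->
  slob_int setT theta p f =
  \int[mu]_h ((slob_kernel (n%:R + theta * p) h)%:E * increment_int p f h).
Proof.
move=> mf; set k := slob_kernel _; rewrite /slob_int setXTT.
have mk : measurable_fun setT k by exact: measurable_slob_kernel.
have mi : measurable_fun setT (fun z : X * X => `|f (z.2 + z.1) - f z.1| `^ p)%R.
  apply: measurable_powR_norm; apply: measurable_funB; last by apply: measurableT_comp.
  by apply: (measurableT_comp mf); apply: measurable_fun_rVD.
rewrite fubini_tonelli1//=; last 2 first.
- apply/measurable_EFinP; apply: measurable_funM; last exact: measurable_diff_kernel.
  by apply: measurable_powR_norm; apply: measurable_funB; apply: measurableT_comp.
- by move=> z; rewrite lee_fin mulr_ge0 ?powR_ge0// slob_kernel_ge0.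
transitivity (\int[mu]_x \int[mu]_h ((`|f (h + x) - f x| `^ p * k h)%:E)).
  apply: eq_integral => x _; rewrite /fubini_F /=.
  rewrite -(@ge0_integral_rV_translate _ _ x (fun y => (`|f x - f y| `^ p * k (x - y)%R)%:E)).
  - by apply: eq_integral => h _; rewrite opprD addrCA subrr addr0 /k slob_kernelN distrC.
  - apply/measurable_EFinP; apply: measurable_funM.
      by apply: measurable_powR_norm; apply: measurable_funB.
    by apply: (measurableT_comp mk); apply: measurable_fun_rVB => //; exact: measurable_cst.
  - by move=> y; rewrite lee_fin mulr_ge0 ?powR_ge0// slob_kernel_ge0.
rewrite (fubini_tonelli (fun z : X * X => (`|f (z.2 + z.1) - f z.1| `^ p * k z.2)%:E))//=.
- apply: eq_integral => h _; rewrite /increment_int -ge0_integralZl//=.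
  + by apply: eq_integral => x _; rewrite -EFinM mulrC.
  + apply/measurable_EFinP; apply: measurable_powR_norm; apply: measurable_funB => //; exact: measurable_shift.
  + by rewrite lee_fin slob_kernel_ge0.
- apply/measurable_EFinP; apply: measurable_funM => //; exact: measurableT_comp.
- by move=> z; rewrite lee_fin mulr_ge0 ?powR_ge0// slob_kernel_ge0.
Qed.

(** A fractional order below 1 costs at most one derivative. For |h| < 1 the increment is controlled
    by the first derivatives, with a factor |h|^p, and for |h| >= 1 by the function itself; both
    cases produce the truncated kernel. *)
Lemma slob_int_test (U : set X) (theta p : R) : (1 < p)%R -> (0 < theta)%R -> (theta < 1)%R ->
  exists2 C : R, (0 <= C)%R & forall f, test_function U f ->
  slob_int setT theta p f <= C%:E * (\int[mu]_x (`|f x| `^ p)%:E +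
     \sum_i \int[mu]_x (`|'D_(basis_vec R i) f x| `^ p)%:E).
Proof.
move=> p1 t0 t1; have [C C0 CP] := increment_int_le U p1.
have p0 : (0 <= p)%R by apply: ltW; apply: lt_trans p1.
have kfin := @trunc_kernel_lty R n p theta p1 t0 t1.
set a := (n%:R + theta * p)%R in kfin *; set K := \int[mu]_h _ in kfin.
have K0 : 0 <= K by apply: integral_ge0 => h _; rewrite lee_fin trunc_kernel_ge0.
have KE : K = (fine K)%:E by rewrite fineK// ge0_fin_numE.
exists ((C + 2 `^ p * 2) * fine K)%R.
  by rewrite mulr_ge0 ?fine_ge0// addr_ge0// mulr_ge0// powR_ge0.
move=> f tf; have mf := test_function_measurable tf.
rewrite slob_int_increment// -/a; set A := \int[mu]_x (`|f x| `^ p)%:E; set B := \sum_i _.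
have A0 : 0 <= A by apply: integral_ge0 => x _; rewrite lee_fin powR_ge0.
have B0 : 0 <= B by apply: sume_ge0 => i _; apply: integral_ge0 => x _; rewrite lee_fin powR_ge0.
have C2 : (0 <= C + 2 `^ p * 2)%R by rewrite addr_ge0// mulr_ge0// powR_ge0.
rewrite EFinM -KE muleAC /K -ge0_integralZl; last 4 first.
- exact: measurableT.
- by apply/measurable_EFinP; exact: measurable_trunc_kernel.
- by move=> h _; rewrite lee_fin trunc_kernel_ge0.
- by apply: mule_ge0; [rewrite lee_fin|exact: adde_ge0].
have mI : measurable_fun setT (increment_int p f).
  apply: (measurable_fun_fubini_tonelli_F (fun z : X * X => (`|f (z.1 + z.2) - f z.2| `^ p)%:E)).
    apply/measurable_EFinP; apply: measurable_powR_norm; apply: measurable_funB; last exact: measurableT_comp.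
    by apply: (measurableT_comp mf); apply: measurable_fun_rVD.
  by move=> z; rewrite lee_fin powR_ge0.
have I0 h : 0 <= increment_int p f h by apply: integral_ge0 => x _; rewrite lee_fin powR_ge0.
have AB0 : 0 <= A + B by exact: adde_ge0.
have p20 : (0 <= 2 `^ p * 2)%R by rewrite mulr_ge0// powR_ge0.
have QA : (2 `^ p * 2)%:E * A <= (C + 2 `^ p * 2)%:E * (A + B).
  by apply: lee_pmul => //; rewrite ?lee_fin ?lerDr ?leeDl.
have QB : C%:E * B <= (C + 2 `^ p * 2)%:E * (A + B).
  by apply: lee_pmul => //; rewrite ?lee_fin ?lerDl ?leeDr.
apply: ge0_le_integral => //.
- by move=> h _; apply: mule_ge0; rewrite ?lee_fin ?slob_kernel_ge0.
- by apply: emeasurable_funM => //; apply/measurable_EFinP; exact: measurable_slob_kernel.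
- by apply: emeasurable_funM => //; apply/measurable_EFinP; exact: measurable_trunc_kernel.
move=> h _; rewrite /trunc_kernel EFinM muleA [X in _ <= X]muleC.
rewrite lee_wpmul2l ?lee_fin ?slob_kernel_ge0//.
have [h1|h1] := leP 1%R (`|h|%R : R).
  by rewrite powR1 mule1 (le_trans (increment_int_bound h p1 tf)).
rewrite (le_trans (CP f h tf))// -/B EFinM [X in X <= _]muleAC.
by rewrite lee_wpmul2r// lee_fin powR_ge0.
Qed.

(** Integrating out the variable on which [s] does not depend leaves the total mass of the kernel.
    This and [integral_conv2] evaluate the two cross terms of a cut-off. *)
Lemma integral_conv1 (k s : X -> R) : measurable_fun setT k -> measurable_fun setT s ->
  (forall h, 0 <= k h)%R -> (forall h, 0 <= s h)%R -> (forall h, k (- h)%R = k h) ->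
  \int[mu \x mu]_z (k (z.1 - z.2)%R * s z.1)%:E = (\int[mu]_h (k h)%:E) * \int[mu]_x (s x)%:E.
Proof.
move=> mk ms k0 s0 kN; rewrite fubini_tonelli1; last 2 first.
- apply/measurable_EFinP; apply: measurable_funM; first exact: measurable_diff_kernel.
  exact: measurableT_comp.
- by move=> z; rewrite lee_fin mulr_ge0.
rewrite -ge0_integralZl//; last 3 first.
- exact/measurable_EFinP.
- by move=> x _; rewrite lee_fin.
- by apply: integral_ge0 => h _; rewrite lee_fin.
apply: eq_integral => x _; rewrite /fubini_F /=.
under eq_integral do rewrite EFinM.
rewrite ge0_integralZr//; last 3 first.
- apply/measurable_EFinP; apply: (measurableT_comp mk); apply: measurable_fun_rVB => //; exact: measurable_cst.
- by move=> y _; rewrite lee_fin.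
- by rewrite lee_fin.
congr (_ * _); rewrite -[RHS](@ge0_integral_rV_translate _ _ (- x)%R (fun h => (k h)%:E)).
- by apply: eq_integral => y _; rewrite -kN opprB.
- exact/measurable_EFinP.
- by move=> y; rewrite lee_fin.
Qed.

Lemma integral_conv2 (k s : X -> R) : measurable_fun setT k -> measurable_fun setT s ->
  (forall h, 0 <= k h)%R -> (forall h, 0 <= s h)%R ->
  \int[mu \x mu]_z (k (z.1 - z.2)%R * s z.2)%:E = (\int[mu]_h (k h)%:E) * \int[mu]_x (s x)%:E.
Proof.
move=> mk ms k0 s0; rewrite fubini_tonelli2; last 2 first.
- apply/measurable_EFinP; apply: measurable_funM; first exact: measurable_diff_kernel.
  exact: measurableT_comp.
- by move=> z; rewrite lee_fin mulr_ge0.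
rewrite -ge0_integralZl//; last 3 first.
- exact/measurable_EFinP.
- by move=> x _; rewrite lee_fin.
- by apply: integral_ge0 => h _; rewrite lee_fin.
apply: eq_integral => y _; rewrite /fubini_G /=.
under eq_integral do rewrite EFinM.
rewrite ge0_integralZr//; last 3 first.
- apply/measurable_EFinP; apply: (measurableT_comp mk); apply: measurable_fun_rVB => //; exact: measurable_cst.
- by move=> x _; rewrite lee_fin.
- by rewrite lee_fin.
congr (_ * _); rewrite -[RHS](@ge0_integral_rV_translate _ _ (- y)%R (fun h => (k h)%:E)) //.
exact/measurable_EFinP.
Qed.

Local Open Scope ring_scope.

(** When x lies in [U] and eta(y) is nonzero, write the difference as eta(x)(F(x) - F(y)) + (eta(x)
    - eta(y)) F(y). Otherwise one of eta(x), eta(y) vanishes, so the other is at most [c] in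
    absolute value and one cross term suffices. The indicators confine the difference of [F] to [U]
    and the cross terms to the set where [eta] is nonzero. *)
Lemma cutoff_difference (U : set X) (eta F : X -> R) (M c : R) x y :
  (forall x, `|eta x| <= M) -> (forall w, ~ U w -> eta w = 0) -> `|eta x - eta y| <= c ->
  `|eta x * F x - eta y * F y| <= M * (\1_(U `*` U) (x, y) * `|F x - F y|) +
     c * (\1_[set x | eta x != 0] x * `|F x|) + c * (\1_[set x | eta x != 0] y * `|F y|).
Proof.
move=> MP etaU exy; set S := [set _ | _].
have M0 : 0 <= M by apply: le_trans (MP x).
have c0 : 0 <= c by apply: le_trans exy.
pose v w : R := \1_S w * `|F w|.
have v0 w : 0 <= v w by rewrite mulr_ge0// indicE.
pose u := \1_(U `*` U) (x, y) * `|F x - F y|.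
have u0 : 0 <= u by rewrite mulr_ge0// indicE.
rewrite -/(v x) -/(v y) -/u.
have etaS w : ~ S w -> eta w = 0 by move=> /negP; rewrite negbK => /eqP.
have SU w : S w -> U w by move=> /= /eqP h; apply: contrapT => nU; apply: h; exact: etaU.
have [Mu0 cx0 cy0] : [/\ 0 <= M * u, 0 <= c * v x & 0 <= c * v y] by split; exact: mulr_ge0.
have [Sy|nSy] := pselect (S y).
  have vy : v y = `|F y| by rewrite /v indicE mem_set// mul1r.
  have [Ux|nUx] := pselect (U x).
    have uE : u = `|F x - F y| by rewrite /u indicE mem_set ?mul1r//; split=> //; exact: SU.
    have -> : eta x * F x - eta y * F y = eta x * (F x - F y) + (eta x - eta y) * F y by ring.
    rewrite (le_trans (ler_normD _ _))// !normrM uE vy.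
    have h1 : `|eta x| * `|F x - F y| <= M * `|F x - F y| by rewrite ler_wpM2r.
    have h2 : `|eta x - eta y| * `|F y| <= c * `|F y| by rewrite ler_wpM2r.
    by move: cx0; lra.
  have ex : eta x = 0 by exact: etaU.
  move: exy; rewrite ex mul0r !sub0r !normrN normrM => exy.
  have h2 : `|eta y| * `|F y| <= c * v y by rewrite vy ler_wpM2r.
  lra.
have ey := etaS _ nSy; move: exy; rewrite ey mul0r !subr0 => exy.
have [Sx|nSx] := pselect (S x); last by rewrite (etaS _ nSx) mul0r normr0 !addr_ge0.
have vx : v x = `|F x| by rewrite /v indicE mem_set// mul1r.
have h2 : `|eta x| * `|F x| <= c * v x by rewrite vx ler_wpM2r.
rewrite normrM; lra.
Qed.

Lemma cutoff_pointwise (U : set X) (eta F : X -> R) (p M L a : R) x y : 0 < p -> 0 <= L ->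
  (forall x, `|eta x| <= M) -> (forall w, ~ U w -> eta w = 0) ->
  (forall x y, `|eta x - eta y| <= L * Num.min 1 `|x - y|) ->
  `|eta x * F x - eta y * F y| `^ p * slob_kernel a (x - y) <=
  4 `^ p * (M `^ p * (\1_(U `*` U) (x, y) * (`|F x - F y| `^ p * slob_kernel a (x - y))) +
    L `^ p * (trunc_kernel p a (x - y) * (\1_[set x | eta x != 0] x * `|F x| `^ p)) +
    L `^ p * (trunc_kernel p a (x - y) * (\1_[set x | eta x != 0] y * `|F y| `^ p))).
Proof.
move=> p0 L0 MP etaU LP; rewrite /trunc_kernel; set k := slob_kernel a _; set S := [set _ | _].
have k0 : 0 <= k by exact: slob_kernel_ge0.
have M0 : 0 <= M by apply: le_trans (MP x).
have := cutoff_difference F MP etaU (LP x y).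
set m := Num.min 1 _; rewrite -/S => le1.
have m0 : 0 <= m by rewrite le_min ler01 normr_ge0.
have indp (T : Type) (A : set T) (w : T) (b : R) : 0 <= b -> (\1_A w * b) `^ p = \1_A w * b `^ p.
  by move=> b0; rewrite indicE; case: (_ \in _); rewrite ?mul1r// !mul0r powR0// gt_eqF.
have ind0 (T : Type) (A : set T) (w : T) (b : R) : 0 <= b -> 0 <= \1_A w * b.
  by move=> b0; rewrite mulr_ge0// indicE.
set A := M * _ in le1; set B := L * m * _ in le1; set C := L * m * _ in le1.
have A0 : 0 <= A by rewrite mulr_ge0// ind0.
have B0 : 0 <= B by rewrite !mulr_ge0// indicE.
have C0 : 0 <= C by rewrite !mulr_ge0// indicE.
have le2 : `|eta x * F x - eta y * F y| `^ p <= 4 `^ p * (A `^ p + B `^ p + C `^ p).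
  apply: le_trans (ler_powRD3 (ltW p0) A0 B0 C0).
  by apply: ge0_ler_powR; rewrite ?nnegrE ?(ltW p0) ?addr_ge0.
apply: (le_trans (ler_wpM2r k0 le2)).
rewrite /A /B /C (powRM _ M0) ?ind0// !(powRM _ (mulr_ge0 L0 m0)) ?ind0// !(powRM _ L0 m0) !indp//.
rewrite le_eqVlt; apply/orP; left; apply/eqP; ring.
Qed.

Local Close Scope ring_scope.

                                                                                               
                                                                                                
                                                
(** The function [f] carries the fractional seminorm and [g] the L^p norm, since the two are
    minimised separately; they agree almost everywhere where [eta] is nonzero, and the cross terms
    see only that set. The cross terms are convolutions with the truncated kernel, whose mass is
    finite. Integrating over the whole space on the left makes the bound cover the extension by
    zero. *)
Lemma slob_int_cutoff (U : set X) (theta p : R) (eta : X -> R) :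
  (1 < p)%R -> (0 < theta)%R -> (theta < 1)%R -> open U -> test_function U eta ->
  exists2 C : R, (0 <= C)%R & forall f g,
    measurable_fun setT (f \_ U) -> measurable_fun setT (g \_ U) ->
    {ae mu, forall x, (eta x * (f \_ U) x = eta x * (g \_ U) x)%R} ->
    slob_int setT theta p (fun x => eta x * f x)%R <=
    C%:E * (slob_int U theta p f + \int[mu]_x (`|(g \_ U) x| `^ p)%:E).
Proof.
move=> p1 t0 t1 oU te; have p0 : (0 < p)%R by apply: lt_trans p1.
have [M M0 MP] := test_function_bounded te; have [L L0 LP] := test_function_lipschitz te.
have me := test_function_measurable te; have mU := open_measurable_rV oU.
have kfin := @trunc_kernel_lty R n p theta p1 t0 t1.
set a := (n%:R + theta * p)%R in kfin; set kap := trunc_kernel p a in kfin.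
set K := \int[mu]_h _ in kfin.
have kap0 h : (0 <= kap h)%R by exact: trunc_kernel_ge0.
have K0 : 0 <= K by apply: integral_ge0 => h _; rewrite lee_fin.
have KE : K = (fine K)%:E by rewrite fineK// ge0_fin_numE.
have mkap : measurable_fun setT kap by exact: measurable_trunc_kernel.
have mk : measurable_fun setT (slob_kernel a : X -> R) by exact: measurable_slob_kernel.
have kapN h : kap (- h)%R = kap h by rewrite /kap /trunc_kernel normrN slob_kernelN.
(* The factor 4^p comes from the p-th power of a sum of three terms, and the factor 2 from the two
   cross terms. *)
pose C := (4 `^ p * (M `^ p + 2 * (L `^ p * fine K)))%R.
have fK0 : (0 <= fine K)%R by rewrite fine_ge0.
have C0 : (0 <= C)%R by rewrite mulr_ge0 ?powR_ge0// addr_ge0 ?powR_ge0// mulr_ge0// mulr_ge0// powR_ge0.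
exists C; first exact: C0.
move=> f g mf mg fg; set F := f \_ U.
pose S : set X := [set x | eta x != 0%R].
have mS : measurable S.
  rewrite (_ : S = setT `&` eta @^-1` (~` [set 0%R])); last first.
    by rewrite setTI; apply/seteqP; split => x /= /eqP.
  by apply: me => //; exact: measurableC.
have SU x : S x -> U x.
  by move=> /= /eqP h; apply: contrapT => nU; apply: h; exact: test_function_out te nU.
pose s x := (\1_S x * `|F x| `^ p)%R.
have s0 x : (0 <= s x)%R by rewrite mulr_ge0 ?powR_ge0// indicE.
have ms : measurable_fun setT s.
  by apply: measurable_funM; [exact: measurable_indic|exact: measurable_powR_norm].
have etaF : (fun x => eta x * f x)%R = (fun x => eta x * F x)%R.
  apply/funext => x; rewrite /F patchE; case: ifPn => // /negP xU.
  by rewrite (test_function_out te) ?mul0r// => Ux; apply: xU; rewrite inE.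
pose D (z : X * X) := (\1_(U `*` U) z * (`|F z.1 - F z.2| `^ p * slob_kernel a (z.1 - z.2)%R))%R.
have mUU : measurable (U `*` U) by exact: measurableX.
have mD : measurable_fun setT D.
  apply: measurable_funM; first exact: measurable_indic.
  apply: measurable_funM; last exact: measurable_diff_kernel.
  by apply: measurable_powR_norm; apply: measurable_funB; exact: measurableT_comp.
have D0 z : (0 <= D z)%R.
  by rewrite mulr_ge0 ?indicE// mulr_ge0 ?powR_ge0// slob_kernel_ge0.
have DE : \int[mu \x mu]_z (D z)%:E = slob_int U theta p f.
  rewrite /slob_int [RHS]integral_mkcond; apply: eq_integral => z _.
  rewrite patchE /D indicE; case: ifPn => [|_]; last by rewrite mul0r.
  by rewrite inE => -[z1 z2]; rewrite mul1r /F !patchE !mem_set.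
have cross1 := integral_conv1 mkap ms kap0 s0 kapN.
have cross2 := integral_conv2 mkap ms kap0 s0.
have sg : \int[mu]_x (s x)%:E <= \int[mu]_x (`|(g \_ U) x| `^ p)%:E.
  apply: ae_ge0_le_integral => //.
  - by move=> x _; rewrite lee_fin.
  - exact/measurable_EFinP.
  - by apply/measurable_EFinP; exact: measurable_powR_norm.
  - apply: filterS fg => x fgx _; rewrite lee_fin /s indicE.
    have [xS|_] := boolP (x \in S); last by rewrite mul0r powR_ge0.
    by rewrite mul1r; rewrite inE in xS; rewrite -(mulfI xS fgx).
have key z : (`|eta z.1 * F z.1 - eta z.2 * F z.2| `^ p * slob_kernel a (z.1 - z.2) <=
    4 `^ p * (M `^ p * D z + L `^ p * (kap (z.1 - z.2) * s z.1) + L `^ p * (kap (z.1 - z.2) * s z.2)))%R.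
  case: z => x y; exact: (@cutoff_pointwise U eta F p M L a x y p0 (ltW L0) MP (fun w (nU : ~ U w) => test_function_out te nU) LP).
rewrite etaF /slob_int setXTT -/a.
have meta : measurable_fun setT (fun x => eta x * F x)%R by exact: measurable_funM.
have mc1 : measurable_fun setT (fun z : X * X => kap (z.1 - z.2) * s z.1)%R.
  by apply: measurable_funM; [exact: measurable_diff_kernel|exact: measurableT_comp].
have mc2 : measurable_fun setT (fun z : X * X => kap (z.1 - z.2) * s z.2)%R.
  by apply: measurable_funM; [exact: measurable_diff_kernel|exact: measurableT_comp].
have mD' : measurable_fun setT (EFin \o D) by exact/measurable_EFinP.
have mc1' : measurable_fun setT (EFin \o (fun z : X * X => kap (z.1 - z.2) * s z.1)%R) by exact/measurable_EFinP.
have mc2' : measurable_fun setT (EFin \o (fun z : X * X => kap (z.1 - z.2) * s z.2)%R) by exact/measurable_EFinP.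
have c1_0 (z : X * X) : 0 <= (kap (z.1 - z.2) * s z.1)%:E by rewrite lee_fin mulr_ge0.
have c2_0 (z : X * X) : 0 <= (kap (z.1 - z.2) * s z.2)%:E by rewrite lee_fin mulr_ge0.
have D0' z : 0 <= (D z)%:E by rewrite lee_fin.
have pw0 (b : R) : 0 <= (b `^ p)%:E by rewrite lee_fin powR_ge0.
pose H (z : X * X) := ((M `^ p)%:E * (D z)%:E + (L `^ p)%:E * (kap (z.1 - z.2) * s z.1)%:E
  + (L `^ p)%:E * (kap (z.1 - z.2) * s z.2)%:E).
have mH1 : measurable_fun setT (fun z : X * X => (M `^ p)%:E * (D z)%:E) by exact: emeasurable_funM.
have mH2 : measurable_fun setT (fun z : X * X => (L `^ p)%:E * (kap (z.1 - z.2) * s z.1)%:E) by exact: emeasurable_funM.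
have mH3 : measurable_fun setT (fun z : X * X => (L `^ p)%:E * (kap (z.1 - z.2) * s z.2)%:E) by exact: emeasurable_funM.
have mH12 := emeasurable_funD mH1 mH2.
have mH : measurable_fun setT H by exact: emeasurable_funD mH12 mH3.
have H1_0 (z : X * X) : 0 <= (M `^ p)%:E * (D z)%:E by apply: mule_ge0.
have H2_0 (z : X * X) : 0 <= (L `^ p)%:E * (kap (z.1 - z.2) * s z.1)%:E by apply: mule_ge0.
have H3_0 (z : X * X) : 0 <= (L `^ p)%:E * (kap (z.1 - z.2) * s z.2)%:E by apply: mule_ge0.
have H12_0 (z : X * X) : 0 <= (M `^ p)%:E * (D z)%:E + (L `^ p)%:E * (kap (z.1 - z.2) * s z.1)%:E by apply: adde_ge0.
apply: (@le_trans _ _ (\int[mu \x mu]_z ((4 `^ p)%:E * H z))).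
  apply: ge0_le_integral => //.
  - by move=> z _; rewrite lee_fin mulr_ge0 ?powR_ge0// slob_kernel_ge0.
  - apply/measurable_EFinP; apply: measurable_funM; last exact: measurable_diff_kernel.
    by apply: measurable_powR_norm; apply: measurable_funB; [exact: (measurableT_comp meta)|exact: (measurableT_comp meta)].
  - exact: emeasurable_funM.
  - by move=> z _; have := key z; rewrite -lee_fin.
rewrite ge0_integralZl//; last by move=> z _; exact: adde_ge0.
rewrite (@ge0_integralD _ _ _ _ _ measurableT _ _ (fun z _ => H12_0 z) mH12 (fun z _ => H3_0 z) mH3).
rewrite (@ge0_integralD _ _ _ _ _ measurableT _ _ (fun z _ => H1_0 z) mH1 (fun z _ => H2_0 z) mH2).
rewrite ge0_integralZl// ge0_integralZl// ge0_integralZl// DE cross1 cross2.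
have Ig0 : 0 <= \int[mu]_x (`|(g \_ U) x| `^ p)%:E by apply: integral_ge0 => x _.
have sl0 : 0 <= slob_int U theta p f by rewrite -DE; apply: integral_ge0.
have Is0 : 0 <= \int[mu]_x (s x)%:E by apply: integral_ge0 => x _; rewrite lee_fin.
set Is := \int[mu]_x (s x)%:E in sg Is0 *; set Ig := \int[mu]_x _ in sg Ig0 *; set sl := slob_int _ _ _ _ in sl0 *.
rewrite -/K KE /C; clear - M0 L0 fK0 Ig0 sl0 Is0 sg.
move: (fine K) fK0 => k k0; move: (4 `^ p)%R (powR_ge0 4 p) => q q0.
move: (M `^ p)%R (powR_ge0 M p) (L `^ p)%R (powR_ge0 L p) => m m0 l l0.
rewrite EFinM -muleA lee_wpmul2l// EFinD ge0_muleDl ?lee_fin ?mulr_ge0//.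
rewrite -[leLHS]addeA; apply: leeD; first by rewrite lee_wpmul2l// leeDl.
rewrite (@le_trans _ _ ((l * k)%:E * Is + (l * k)%:E * Is))//; first by rewrite !muleA -!EFinM.
rewrite -ge0_muleDl ?lee_fin ?mulr_ge0// -EFinD -mulr2n -mulr_natl.
rewrite mulr1 mulr_natl; apply: lee_pmul => //; last by rewrite (le_trans sg)// leeDr.
by rewrite lee_fin mulrn_wge0// mulr_ge0.
Qed.

End fractional_embedding.

                             

(** * Iterated derivatives, integration by parts and Leibniz's rule *)

Section words.
Context {R : realType} {n : nat} {U : set 'rV[R]_n}.
Local Notation D := (testfun U).
Implicit Types (phi psi : D) (w : seq 'I_n).

                                                                                           
                                                                                 
(** Derivatives indexed by words rather than multi-indices, so that inductions can peel off one
    derivative at a time. The order of the letters is immaterial by [Dw_perm], and [mword] and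
    [mword_surj] translate between the two. *)
Definition Dw w phi : D := foldr (@testfun_partial R n U) phi w.

Lemma testfun_partialC i j phi :
  testfun_partial i (testfun_partial j phi) = testfun_partial j (testfun_partial i phi).
Proof. by apply: val_inj; apply: derive_swap; case: (testfunP phi). Qed.

Lemma Dw_cat w1 w2 phi : Dw (w1 ++ w2) phi = Dw w1 (Dw w2 phi).
Proof. by rewrite /Dw foldr_cat. Qed.

Lemma Dw_partial i w phi : Dw w (testfun_partial i phi) = testfun_partial i (Dw w phi).
Proof. by elim: w => //= j w IH; rewrite -/(Dw _ _) IH testfun_partialC. Qed.

Lemma Dw_perm w1 w2 phi : perm_eq w1 w2 -> Dw w1 phi = Dw w2 phi.
Proof.
elim: w1 w2 => [|i w1 IH] w2; first by move=> /perm_size/esym/eqP; rewrite size_eq0 => /eqP ->.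
move=> h; have : i \in w2 by rewrite -(perm_mem h) mem_head.
move: h => + /path.splitPr e; case: e => a b.
rewrite perm_sym -[i :: b]cat1s perm_catCA/= perm_cons perm_sym => /IH e.
by rewrite Dw_cat/= -/(Dw _ _) -/(Dw _ _) e Dw_cat Dw_partial.
Qed.

Definition mword k (nu : mindex n k) : seq 'I_n :=
  flatten [seq nseq (nu i) i | i <- enum 'I_n].

Lemma testfun_derivE k (nu : mindex n k) phi : testfun_deriv nu phi = Dw (mword nu) phi.
Proof.
rewrite /testfun_deriv /mword; elim: (enum 'I_n) => //= i s IH.
by rewrite Dw_cat -IH; elim: (nat_of_ord (nu i)) => //= m ->.
Qed.

Lemma size_mword k (nu : mindex n k) : size (mword nu) = mdeg nu.
Proof.
rewrite size_flatten /shape -map_comp sumnE big_map big_enum/= /mdeg.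
by apply: eq_bigr => i _; rewrite size_nseq.
Qed.

Lemma mword_surj k (w : seq 'I_n) : (size w <= k)%N ->
  exists nu : mindex n k, mdeg nu = size w /\ forall phi, testfun_deriv nu phi = Dw w phi.
Proof.
move=> wk; pose nu : mindex n k := [ffun i => inord (count_mem i w)].
have nuE i : nu i = count_mem i w :> nat.
  by rewrite ffunE inordK// ltnS (leq_trans _ wk)// count_size.
have pw : perm_eq (mword nu) w.
  apply/allP => j _ /=; apply/eqP; rewrite count_flatten -map_comp sumnE big_map big_enum/=.
  rewrite (bigD1 j)//= count_nseq/= eqxx mul1n nuE big1 ?addn0// => i ij.
  by rewrite count_nseq/= (negbTE ij).
exists nu; rewrite -size_mword (perm_size pw); split=> // phi.
by rewrite testfun_derivE (Dw_perm _ pw).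
Qed.

Lemma linear_testfun_partial i : linear (@testfun_partial R n U i).
Proof.
move=> a phi psi; apply: val_inj; apply/funext => x /=.
have dp : derivable (phi : 'rV[R]_n -> R) x (basis_vec R i).
  by have [sf _ _] := testfunP phi; have [_ /(_ i)[]] := sf 1%N.
have dq : derivable (psi : 'rV[R]_n -> R) x (basis_vec R i).
  by have [sf _ _] := testfunP psi; have [_ /(_ i)[]] := sf 1%N.
have da : derivable (a *: (phi : 'rV[R]_n -> R^o)) x (basis_vec R i) by exact: derivableZ.
transitivity ('D_(basis_vec R i) (a *: (phi : 'rV[R]_n -> R^o)) x + 'D_(basis_vec R i) psi x).
  exact: deriveD.
congr (_ + _); exact: (deriveZ a dp).
Qed.

End words.
Arguments Dw {R n U}.
Arguments mword {n k}.

Section by_parts.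
Context {R : realType} {n : nat} {U : set 'rV[R]_n}.
Local Notation D := (testfun U).
Local Notation mu := (lebesgue_rV R n).

Lemma testfun_partialM i (phi psi : D) x :
  'D_(basis_vec R i) (testfun_mul phi psi : 'rV[R]_n -> R) x =
  phi x * ('D_(basis_vec R i) psi x : R) + psi x * ('D_(basis_vec R i) phi x : R).
Proof.
have dp : derivable (phi : 'rV[R]_n -> R) x (basis_vec R i).
  by have [sf _ _] := testfunP phi; have [_ /(_ i)[]] := sf 1%N.
have dq : derivable (psi : 'rV[R]_n -> R) x (basis_vec R i).
  by have [sf _ _] := testfunP psi; have [_ /(_ i)[]] := sf 1%N.
exact: (@deriveM _ _ (phi : 'rV[R]_n -> R) (psi : 'rV[R]_n -> R) x (basis_vec R i) dp dq).
Qed.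

Lemma regular_dist_testE (phi psi : D) :
  regular_dist phi psi = \int[mu]_x (phi x * psi x).
Proof.
rewrite regular_distE; apply: eq_Rintegral => x _.
rewrite patchE; case: ifPn => [_|/negP xU]; first by rewrite mulrC.
by rewrite mulr0 (test_function_out (testfunP phi)) ?mul0r// => Ux; apply: xU; rewrite inE.
Qed.

(** Integration by parts: the partial derivative of the product [phi psi] has integral 0 by
    [integral_partial]. *)
Lemma regular_dist_partial i (phi psi : D) :
  regular_dist phi (testfun_partial i psi) = - regular_dist (testfun_partial i phi) psi.
Proof.
apply/eqP; rewrite -addr_eq0 !regular_dist_testE/=.
have i1 := test_function_integrable (testfunP (testfun_mul phi (testfun_partial i psi))).
have i2 := test_function_integrable (testfunP (testfun_mul psi (testfun_partial i phi))).
have := integral_partial i (testfunP (testfun_mul phi psi)).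
rewrite (eq_integral (fun x => (phi x * ('D_(basis_vec R i) psi x : R))%:E +
    (psi x * ('D_(basis_vec R i) phi x : R))%:E)%E); last first.
  by move=> x _; rewrite -EFinD; congr EFin; exact: testfun_partialM.
rewrite integralD//= => h; apply/eqP.
rewrite /Rintegral -fineD; [|exact: integrable_fin_num|].
  rewrite (_ : (_ + _)%E = 0%E)// -h; congr (_ + _)%E.
  by apply: eq_integral => x _; rewrite mulrC.
apply: integrable_fin_num => //; apply: eq_integrable i2 => // x _ /=.
by rewrite mulrC.
Qed.

Lemma regular_dist_Dw w (phi psi : D) :
  regular_dist phi (Dw w psi) = (-1) ^+ size w * regular_dist (Dw w phi) psi.
Proof.
elim: w phi psi => [|i w IH] phi psi; first by rewrite mul1r.
by rewrite /= -/(Dw _ _) regular_dist_partial IH Dw_partial exprS mulN1r mulNr.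
Qed.

Lemma dist_deriv_regular k (nu : mindex n k) (phi : D) :
  dist_deriv nu (regular_dist phi : D -> R^o) = regular_dist (testfun_deriv nu phi).
Proof.
apply/funext => psi; rewrite /dist_deriv !testfun_derivE regular_dist_Dw size_mword.
by rewrite mulrA -exprMn mulrN1 opprK expr1n mul1r.
Qed.

End by_parts.

Section leibniz.
Context {R : realType} {n : nat} {U : set 'rV[R]_n}.
Local Notation D := (testfun U).

(** Differential operators of order at most [m] with test functions as coefficients. Leibniz's rule
    is used only through this shape, so no binomial coefficients are tracked. *)
Inductive diff_op (m : nat) : (D -> D) -> Prop :=
| diff_op_mul (eta : D) w : (size w <= m)%N ->
    diff_op m (fun psi => testfun_mul eta (Dw w psi))
| diff_opD S T : diff_op m S -> diff_op m T -> diff_op m (fun psi => S psi + T psi).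

Lemma diff_op_partial m i T : diff_op m T -> diff_op m.+1 (fun psi => testfun_partial i (T psi)).
Proof.
elim=> {T} [eta w wm|S T _ IS _ IT].
  rewrite (_ : (fun _ => _) = (fun psi => testfun_mul eta (Dw (i :: w) psi) +
      testfun_mul (testfun_partial i eta) (Dw w psi))).
    by apply: diff_opD; apply: diff_op_mul => //; exact: leqW.
  apply/funext => psi; apply: val_inj; apply/funext => x.
  rewrite [LHS]testfun_partialM; congr (_ + _); exact: mulrC.
rewrite (_ : (fun _ => _) = (fun psi => testfun_partial i (S psi) + testfun_partial i (T psi))).
  exact: diff_opD.
by apply/funext => psi; rewrite -[S psi]scale1r linear_testfun_partial scale1r scale1r.
Qed.

Lemma diff_op_Dw_mul w (eta : D) : diff_op (size w) (fun psi => Dw w (testfun_mul eta psi)).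
Proof.
elim: w => [|i w IH] /=; first exact: (@diff_op_mul 0 eta [::]).
exact: diff_op_partial.
Qed.

End leibniz.

                                     

(** * Sobolev norms of nonnegative order as quasi-norms *)

Section ereal_power.
Context {R : realType}.
Implicit Types (p q : R).

(** With s = a + b, each c in [0, s] satisfies c/s <= (c/s)^q, that is, s^q (c/s) <= c^q. Add the
    cases c = a and c = b. *)
Lemma powR_subadd q (a b : R) : 0 < q -> q <= 1 -> 0 <= a -> 0 <= b ->
  (a + b) `^ q <= a `^ q + b `^ q.
Proof.
move=> q0 q1 a0 b0; have [ab0|] := eqVneq (a + b) 0.
  by rewrite ab0 powR0 ?gt_eqF// addr_ge0// powR_ge0.
rewrite neq_lt ltNge addr_ge0//= => s0; set s := a + b in s0 *.
have aux c : 0 <= c -> c <= s -> s `^ q * (c / s) <= c `^ q.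
  rewrite le_eqVlt => /predU1P[<-|c0] cs; first by rewrite mul0r mulr0 powR_ge0.
  rewrite -[in leRHS](divfK (lt0r_neq0 s0) c) powRM ?divr_ge0 ?(ltW c0) ?(ltW s0)// mulrC.
  rewrite ler_wpM2r ?powR_ge0// -[leLHS]powRr1 ?divr_ge0 ?(ltW c0) ?(ltW s0)//.
  by apply: ger_powR => //; rewrite divr_gt0//= ler_pdivrMr// mul1r.
apply: le_trans (lerD (aux a _ _) (aux b _ _)) => //; rewrite ?lerDl ?lerDr//.
by rewrite -mulrDr -mulrDl divff ?mulr1// gt_eqF.
Qed.

Lemma poweR_subadd q (a b : \bar R) : 0 < q -> q <= 1 -> (0 <= a -> 0 <= b ->
  (a + b) `^ q <= a `^ q + b `^ q)%E.
Proof.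
move=> q0 q1; case: a => [a||]//; case: b => [b||]// a0 b0.
- by rewrite -EFinD !poweR_EFin -EFinD lee_fin powR_subadd// -lee_fin.
- by rewrite addey// !poweRyr ?gt_eqF// ?addey// ?leey.
- by rewrite addye// !poweRyr ?gt_eqF// ?addye// ?leey.
- by rewrite addye// !poweRyr ?gt_eqF// ?addye// ?leey.
Qed.

(** Passes from p-th powers to norms; subadditivity of the power 1/p plays the part of Minkowski's
    inequality. *)
Lemma lee_root (p c : R) (x a b : \bar R) : 1 <= p -> 0 <= c ->
  (0 <= x -> 0 <= a -> 0 <= b -> x <= (c `^ p)%:E * (a + b) ->
  x `^ p^-1 <= c%:E * (a `^ p^-1 + b `^ p^-1))%E.
Proof.
move=> p1 c0 x0 a0 b0 h; have p0 : 0 < p by apply: lt_le_trans p1.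
have q0 : 0 < p^-1 by rewrite invr_gt0.
have ab0 : (0 <= a + b)%E by exact: adde_ge0.
have cp0 : (0 <= (c `^ p)%:E)%E by rewrite lee_fin powR_ge0.
apply: (@le_trans _ _ (((c `^ p)%:E * (a + b)) `^ p^-1)%E).
  by apply: (gt0_ler_poweR (ltW q0)) => //; rewrite in_itv/= ?leey ?andbT ?mule_ge0// x0.
rewrite poweRM// poweR_EFin -powRrM divff ?gt_eqF// powRr1//.
by rewrite lee_wpmul2l ?lee_fin// poweR_subadd// invf_le1.
Qed.

(** Strict positivity of [a] matters when [S] is empty: the infimum is then +oo, and the right-hand
    side has to be +oo as well. *)
Lemma le_ereal_inf_affine (S : set \bar R) (z b : \bar R) (a : R) :
  0 < a -> (0 <= b -> (forall x, S x -> 0 <= x) ->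
  (forall x, S x -> z <= a%:E * x + b) -> z <= a%:E * ereal_inf S + b)%E.
Proof.
move=> a0 b0 S0 h; have i0 : (0 <= ereal_inf S)%E by apply/ereal_infP.
case: b b0 h => [b||]// b0 h; last by rewrite addey ?leey// gt_eqF// (lt_le_trans _ (mule_ge0 _ i0))// ?lee_fin ?(ltW a0)// ltNy0.
rewrite -leeBlDr// -lee_pdivrMl//; apply/ereal_infP => x Sx.
by rewrite lee_pdivrMl// leeBlDr// h.
Qed.

Lemma le_ereal_inf2 (S T : set \bar R) (z : \bar R) (a c : R) : 0 < a -> 0 < c ->
  ((forall x, S x -> 0 <= x) -> (forall y, T y -> 0 <= y) ->
  (forall x y, S x -> T y -> z <= c%:E * (a%:E * x + y)) ->
  z <= c%:E * (a%:E * ereal_inf S + ereal_inf T))%E.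
Proof.
move=> a0 c0 S0 T0 h; have i0 : (0 <= ereal_inf S)%E by apply/ereal_infP.
have j0 : (0 <= ereal_inf T)%E by apply/ereal_infP.
have a0' : (0 <= a%:E)%E by rewrite lee_fin ltW.
have c0' : (0 <= c%:E)%E by rewrite lee_fin ltW.
rewrite ge0_muleDr ?mule_ge0// addeC; apply: le_ereal_inf_affine => //; rewrite ?mule_ge0//.
move=> y Ty; have y0 := T0 _ Ty.
rewrite addeC muleA -EFinM; apply: le_ereal_inf_affine; rewrite ?mulr_gt0 ?mule_ge0//.
move=> x Sx; have x0 := S0 _ Sx; rewrite EFinM -muleA -ge0_muleDr ?mule_ge0//.
exact: h.
Qed.

End ereal_power.

Section quasi_norm.
Context {R : realType} {n : nat} (U : set 'rV[R]_n).
Local Notation X := 'rV[R]_n.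
Local Notation D := (testfun U).
Local Notation mu := (lebesgue_rV R n).
Local Open Scope ereal_scope.
Implicit Types (f g : X -> R) (u v : D -> R^o) (p theta : R).

Definition lp_int (p : R) f : \bar R := \int[mu]_x (`|(f \_ U) x| `^ p)%:E.

Lemma lp_int_ge0 p f : 0 <= lp_int p f.
Proof. by apply: integral_ge0 => x _; rewrite lee_fin powR_ge0. Qed.

Lemma slob_int_ge0 theta p f : 0 <= slob_int U theta p f.
Proof. by apply: integral_ge0 => x _; rewrite lee_fin mulr_ge0 ?powR_ge0// slob_kernel_ge0. Qed.

Lemma Lp_normE p f : (0 < p)%R -> Lp_norm U p f = lp_int p f `^ p^-1.
Proof. by move=> p0; rewrite /Lp_norm unlock /Lnorm. Qed.

Lemma slobodeckijE theta p f : slobodeckij U theta p f = slob_int U theta p f `^ p^-1.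
Proof. by []. Qed.

                                                                                             
(** Source of the constant 2 in all the triangle inequalities below: integrating and taking the p-th
    root turns 2^p into 2. *)
Lemma ler_powR_lincomb p (a x y : R) : (1 <= p)%R ->
  (`|a * x + y| `^ p <= 2 `^ p * ((`|a| `^ p * `|x| `^ p) + `|y| `^ p))%R.
Proof.
move=> p1; have p0 : (0 <= p)%R by rewrite (le_trans _ p1).
rewrite -powRM ?normr_ge0// -normrM.
apply: le_trans (ler_powRD p0 (normr_ge0 _) (normr_ge0 _)).
by rewrite ge0_ler_powR ?nnegrE// ?addr_ge0// ler_normD.
Qed.

Lemma patch_lincomb (a : R) f g x :
  ((fun x => a * f x + g x)%R \_ U) x = (a * (f \_ U) x + (g \_ U) x)%R.
Proof. by rewrite !patchE; case: ifP => // _; rewrite mulr0 addr0. Qed.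

Lemma measurable_patch_lincomb (a : R) f g : measurable_fun setT (f \_ U) ->
  measurable_fun setT (g \_ U) -> measurable_fun setT ((fun x => a * f x + g x)%R \_ U).
Proof.
move=> mf mg; rewrite (_ : _ \_ _ = fun x => a * (f \_ U) x + (g \_ U) x)%R.
  by apply: measurable_funD => //; exact: measurable_funM.
by apply/funext => x; exact: patch_lincomb.
Qed.

Lemma lp_int_lincomb p (a : R) f g : (1 <= p)%R ->
  measurable_fun setT (f \_ U) -> measurable_fun setT (g \_ U) ->
  lp_int p (fun x => a * f x + g x)%R <=
  (2 `^ p)%:E * ((`|a| `^ p)%:E * lp_int p f + lp_int p g).
Proof.
move=> p1 mf mg; have mh := measurable_patch_lincomb a mf mg.
have m1 : measurable_fun setT (fun x => (`|(f \_ U) x| `^ p)%:E).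
  by apply/measurable_EFinP; exact: measurable_powR_norm.
have m2 : measurable_fun setT (fun x => (`|(g \_ U) x| `^ p)%:E).
  by apply/measurable_EFinP; exact: measurable_powR_norm.
have pw0 (b q : R) : 0 <= (b `^ q)%:E by rewrite lee_fin powR_ge0.
have m3 : measurable_fun setT (fun x => (`|a| `^ p)%:E * (`|(f \_ U) x| `^ p)%:E).
  exact: emeasurable_funM.
rewrite /lp_int -ge0_integralZl// -ge0_integralD//.
rewrite -ge0_integralZl//; last 2 first.
- exact: emeasurable_funD.
- by move=> x _; rewrite adde_ge0// mule_ge0.
apply: ge0_le_integral => //.
- by apply/measurable_EFinP; exact: measurable_powR_norm.
- by apply: emeasurable_funM => //; exact: emeasurable_funD.
- move=> x _; rewrite patch_lincomb.
  by have := ler_powR_lincomb a ((f \_ U) x) ((g \_ U) x) p1; rewrite -lee_fin.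
Qed.

Lemma slob_int_lincomb theta p (a : R) f g : (1 <= p)%R -> open U ->
  measurable_fun setT (f \_ U) -> measurable_fun setT (g \_ U) ->
  slob_int U theta p (fun x => a * f x + g x)%R <=
  (2 `^ p)%:E * ((`|a| `^ p)%:E * slob_int U theta p f + slob_int U theta p g).
Proof.
move=> p1 oU mf mg; have mh := measurable_patch_lincomb a mf mg.
have mU : measurable U by exact: open_measurable_rV.
have mUU : measurable (U `*` U) by exact: measurableX.
have pw0 (b q : R) : 0 <= (b `^ q)%:E by rewrite lee_fin powR_ge0.
pose k : X -> R := slob_kernel (n%:R + theta * p)%R.
have k0 h : (0 <= k h)%R by exact: slob_kernel_ge0.
pose d (h : X -> R) (z : X * X) := (`|h z.1 - h z.2| `^ p * k (z.1 - z.2))%:E.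
have md h : measurable_fun setT (h \_ U) -> measurable_fun (U `*` U) (d h).
  move=> mh'; apply: (@eq_measurable_fun _ _ _ _ _ (d (h \_ U))).
    by move=> z; rewrite inE => -[z1 z2]; rewrite /d !patchE !mem_set.
  apply: (measurable_funS measurableT) => //.
  apply/measurable_EFinP; apply: measurable_funM; last exact: (measurable_diff_kernel (measurable_slob_kernel _)).
  by apply: measurable_powR_norm; apply: measurable_funB; exact: (measurableT_comp mh').
have d0 h z : 0 <= d h z by rewrite lee_fin mulr_ge0// powR_ge0.
have m3 : measurable_fun (U `*` U) (fun z => (`|a| `^ p)%:E * d f z).
  by apply: emeasurable_funM => //; exact: md.
have mg' := md _ mg; have mf' := md _ mf.
have slE h : slob_int U theta p h = \int[mu \x mu]_(z in U `*` U) d h z by [].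
rewrite !slE -ge0_integralZl// -ge0_integralD//.
rewrite -ge0_integralZl//; last 2 first.
- exact: emeasurable_funD.
- by move=> x _; rewrite adde_ge0// mule_ge0.
apply: ge0_le_integral => //.
- exact: (md (fun x => a * f x + g x)%R).
- by apply: emeasurable_funM => //; exact: emeasurable_funD.
- move=> z _; rewrite /d.
  have := ler_powR_lincomb a (f z.1 - f z.2)%R (g z.1 - g z.2)%R p1.
  rewrite (_ : (_ * _ + _)%R = (a * f z.1 + g z.1 - (a * f z.2 + g z.2))%R); last by ring.
  move=> /(ler_wpM2r (k0 (z.1 - z.2)%R)); rewrite -lee_fin => /le_trans; apply.
  rewrite [leRHS](_ : _ = (2 `^ p * (`|a| `^ p * (`|f z.1 - f z.2| `^ p * k (z.1 - z.2)) +
    `|g z.1 - g z.2| `^ p * k (z.1 - z.2)))%:E)// lee_fin le_eqVlt; apply/orP; left.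
  by apply/eqP; ring.
by move=> x _; exact: mule_ge0.
Qed.

Lemma Lp_fun_lincomb p (a : R) f g : (1 <= p)%R -> Lp_fun U p f -> Lp_fun U p g ->
  Lp_fun U p (fun x => a * f x + g x)%R.
Proof.
move=> p1 /(Lp_funP _ _ p1)[mf ff] /(Lp_funP _ _ p1)[mg gf]; apply/(Lp_funP _ _ p1); split.
  exact: (measurable_patch_lincomb a mf mg).
apply: le_lt_trans (lp_int_lincomb a p1 mf mg) _.
apply: lte_mul_pinfty; rewrite ?lee_fin ?powR_ge0 ?fin_numE//.
apply: lte_add_pinfty; last exact: gf.
by apply: lte_mul_pinfty; [rewrite lee_fin powR_ge0|rewrite fin_numE|exact: ff].
Qed.

Lemma Lp_reps_lincomb p (a : R) f g u v : (1 <= p)%R -> open U ->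
  Lp_reps p u f -> Lp_reps p v g -> Lp_reps p (a *: u + v)%R (fun x => a * f x + g x)%R.
Proof.
move=> p1 oU [fp ->] [gp ->]; split; first exact: Lp_fun_lincomb.
apply/funext => phi; apply/EFin_inj.
have hp := Lp_fun_lincomb a p1 fp gp.
rewrite (regular_dist_EFin phi p1 oU hp).
transitivity (a%:E * (regular_dist f phi)%:E + (regular_dist g phi)%:E) => //.
rewrite (regular_dist_EFin phi p1 oU fp) (regular_dist_EFin phi p1 oU gp).
have i1 := Lp_fun_mul_integrable p1 oU fp (testfunP phi).
have i2 := Lp_fun_mul_integrable p1 oU gp (testfunP phi).
rewrite -integralZl// -integralD//; last exact: integrableZl.
by apply: eq_integral => x _; rewrite patch_lincomb -EFinM -EFinD; congr EFin; ring.
Qed.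

Lemma Lp_norm_lincomb p (a : R) f g : (1 <= p)%R ->
  Lp_fun U p f -> Lp_fun U p g ->
  Lp_norm U p (fun x => a * f x + g x)%R <= 2%:E * (`|a|%:E * Lp_norm U p f + Lp_norm U p g).
Proof.
move=> p1 /(Lp_funP _ _ p1)[mf ff] /(Lp_funP _ _ p1)[mg gf].
have p0 : (0 < p)%R by apply: lt_le_trans p1.
rewrite !Lp_normE//; have := lp_int_lincomb a p1 mf mg.
move=> /(lee_root p1 _ (lp_int_ge0 _ _) _ (lp_int_ge0 _ _)) h.
apply: le_trans (h _ _) _ => //; first by rewrite mule_ge0 ?lp_int_ge0// lee_fin powR_ge0.
rewrite poweRM ?lp_int_ge0// ?lee_fin ?powR_ge0//.
by rewrite poweR_EFin -powRrM divff ?gt_eqF// powRr1.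
Qed.

Lemma slobodeckij_lincomb theta p (a : R) f g : (1 <= p)%R -> open U ->
  Lp_fun U p f -> Lp_fun U p g ->
  slobodeckij U theta p (fun x => a * f x + g x)%R <=
  2%:E * (`|a|%:E * slobodeckij U theta p f + slobodeckij U theta p g).
Proof.
move=> p1 oU /(Lp_funP _ _ p1)[mf ff] /(Lp_funP _ _ p1)[mg gf].
have p0 : (0 < p)%R by apply: lt_le_trans p1.
rewrite !slobodeckijE//; have := slob_int_lincomb theta a p1 oU mf mg.
move=> /(lee_root p1 _ (slob_int_ge0 _ _ _) _ (slob_int_ge0 _ _ _)) h.
apply: le_trans (h _ _) _ => //; first by rewrite mule_ge0 ?slob_int_ge0// lee_fin powR_ge0.
rewrite poweRM ?slob_int_ge0// ?lee_fin ?powR_ge0//.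
by rewrite poweR_EFin -powRrM divff ?gt_eqF// powRr1.
Qed.

Lemma dist_Lp_norm_ge0 p u : (0 < p)%R -> 0 <= dist_Lp_norm p u.
Proof. by move=> p0; apply/ereal_infP => _ [f _ <-]; rewrite Lp_normE// poweR_ge0. Qed.

Lemma dist_slobodeckij_ge0 theta p u : 0 <= dist_slobodeckij theta p u.
Proof. by apply/ereal_infP => _ [f _ <-]; rewrite poweR_ge0. Qed.

Let inf_reps_lincomb (Phi : (X -> R) -> \bar R) p (a : R) u v : (1 <= p)%R -> open U ->
  (forall f, 0 <= Phi f) ->
  (forall f g, Lp_fun U p f -> Lp_fun U p g ->
    Phi (fun x => a * f x + g x)%R <= 2%:E * (`|a|%:E * Phi f + Phi g)) ->
  ereal_inf [set Phi f | f in Lp_reps p (a *: u + v)%R] <=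
  2%:E * (`|a|%:E * ereal_inf [set Phi f | f in Lp_reps p u] +
          ereal_inf [set Phi f | f in Lp_reps p v]).
Proof.
(* The case a = 0 is separate because [le_ereal_inf2] requires positive factors: the infimum for [u]
   may be +oo, and 0 times +oo is 0. *)
move=> p1 oU Phi0 h; have [->|a0] := eqVneq a 0%R.
  rewrite scale0r add0r normr0 mul0e add0e -[leLHS]mul1e lee_wpmul2r// ?lee_fin ?ler1n//.
  by apply/ereal_infP => _ [f _ <-].
apply: le_ereal_inf2 => //; [by rewrite normr_gt0|by move=> _ [f _ <-]|by move=> _ [f _ <-]|].
move=> _ _ [f uf <-] [g vg <-]; apply: le_trans (h _ _ uf.1 vg.1).
by apply: ereal_inf_lbound; exists (fun x => a * f x + g x)%R => //; exact: Lp_reps_lincomb.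
Qed.

Lemma dist_Lp_norm_lincomb p (a : R) u v : (1 <= p)%R -> open U ->
  dist_Lp_norm p (a *: u + v)%R <= 2%:E * (`|a|%:E * dist_Lp_norm p u + dist_Lp_norm p v).
Proof.
move=> p1 oU; have p0 : (0 < p)%R by apply: lt_le_trans p1.
apply: inf_reps_lincomb => // [f|f g]; first by rewrite Lp_normE// poweR_ge0.
exact: Lp_norm_lincomb.
Qed.

Lemma dist_slobodeckij_lincomb theta p (a : R) u v : (1 <= p)%R -> open U ->
  dist_slobodeckij theta p (a *: u + v)%R <=
  2%:E * (`|a|%:E * dist_slobodeckij theta p u + dist_slobodeckij theta p v).
Proof.
move=> p1 oU; apply: inf_reps_lincomb => // [f|f g]; first by rewrite slobodeckijE// poweR_ge0.
exact: slobodeckij_lincomb.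
Qed.

Lemma sobolev_norm_nneg_ge0 s p u : (0 < p)%R -> 0 <= sobolev_norm_nneg s p u.
Proof.
move=> p0; apply: adde_ge0; first by apply: sume_ge0 => nu _; exact: dist_Lp_norm_ge0.
by case: ifP => // _; apply: sume_ge0 => nu _; exact: dist_slobodeckij_ge0.
Qed.

Lemma dist_deriv_lincomb k (nu : mindex n k) (a : R) u v :
  dist_deriv nu (a *: u + v)%R = (a *: (dist_deriv nu u : D -> R^o) + dist_deriv nu v)%R.
Proof.
apply/funext => phi; rewrite /dist_deriv.
transitivity ((-1) ^+ mdeg nu * (a * u (testfun_deriv nu phi) + v (testfun_deriv nu phi)))%R => //.
by rewrite mulrDr mulrCA.
Qed.

Lemma sobolev_norm_nneg_lincomb s p (a : R) u v : (1 <= p)%R -> open U ->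
  sobolev_norm_nneg s p (a *: u + v)%R <=
  2%:E * (`|a|%:E * sobolev_norm_nneg s p u + sobolev_norm_nneg s p v).
Proof.
move=> p1 oU; have p0 : (0 < p)%R by apply: lt_le_trans p1.
have a0 : 0 <= `|a|%:E by rewrite lee_fin.
have sum_lincomb k (P : pred (mindex n k)) (dist : (D -> R^o) -> \bar R) :
    (forall w, 0 <= dist w) ->
    (forall w z, dist (a *: w + z)%R <= 2%:E * (`|a|%:E * dist w + dist z)) ->
    \sum_(nu | P nu) dist (dist_deriv nu (a *: u + v)%R) <=
    2%:E * (`|a|%:E * (\sum_(nu | P nu) dist (dist_deriv nu u)) +
            \sum_(nu | P nu) dist (dist_deriv nu v)).
  move=> d0 h; rewrite ge0_sume_distrr// -big_split/= ge0_sume_distrr.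
    by apply: lee_sum => nu _; rewrite dist_deriv_lincomb.
  by move=> i _; rewrite adde_ge0// mule_ge0.
rewrite /sobolev_norm_nneg; set k := Num.truncn s; set th := (s - k%:R)%R.
have h1 := sum_lincomb k (fun nu => mdeg nu <= k)%N (dist_Lp_norm p)
  (fun w => dist_Lp_norm_ge0 w p0) (fun w z => dist_Lp_norm_lincomb a w z p1 oU).
have h2 := sum_lincomb k (fun nu => mdeg nu == k) (dist_slobodeckij th p)
  (fun w => dist_slobodeckij_ge0 th p w) (fun w z => dist_slobodeckij_lincomb th a w z p1 oU).
have s1 (w : D -> R^o) : 0 <= \sum_(nu : mindex n k | (mdeg nu <= k)%N) dist_Lp_norm p (dist_deriv nu w).
  by apply: sume_ge0 => nu _; exact: dist_Lp_norm_ge0.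
have s2 (w : D -> R^o) : 0 <= \sum_(nu : mindex n k | mdeg nu == k) dist_slobodeckij th p (dist_deriv nu w).
  by apply: sume_ge0 => nu _; exact: dist_slobodeckij_ge0.
case: ifP => _; first by rewrite !adde0.
apply: le_trans (leeD h1 h2) _.
rewrite -ge0_muleDr ?adde_ge0 ?mule_ge0// addeACA -ge0_muleDr//.
Qed.

Lemma Lp_fun0 p : (1 <= p)%R -> Lp_fun U p (cst 0%R).
Proof.
move=> p1; apply/(Lp_funP _ _ p1); rewrite (_ : _ \_ _ = cst 0%R).
  split; first exact: measurable_cst.
  under eq_integral do rewrite normr0 powR0 ?gt_eqF ?(lt_le_trans _ p1)//.
  by rewrite integral0.
by apply/funext => x; rewrite patchE if_same.
Qed.

Lemma Lp_reps0 p : (1 <= p)%R -> Lp_reps p (0 : D -> R^o)%R (cst 0%R).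
Proof.
move=> p1; split; first exact: Lp_fun0.
apply/funext => phi; rewrite /regular_dist (_ : (fun _ => _) = cst 0%R)//; last first.
  by apply/funext => x; rewrite mul0r.
by rewrite /Rintegral integral0_eq.
Qed.

Lemma dist_Lp_norm0 p : (1 <= p)%R -> dist_Lp_norm p (0 : D -> R^o)%R = 0.
Proof.
move=> p1; have p0 : (0 < p)%R by apply: lt_le_trans p1.
apply/eqP; rewrite eq_le dist_Lp_norm_ge0// andbT; apply: ereal_inf_lbound.
exists (cst 0%R); first exact: Lp_reps0.
rewrite Lp_normE// /lp_int integral0_eq ?poweR0r ?gt_eqF ?invr_gt0// => x _.
by rewrite patchE if_same normr0 powR0 ?gt_eqF.
Qed.

Lemma dist_slobodeckij0 theta p : (1 <= p)%R -> dist_slobodeckij theta p (0 : D -> R^o)%R = 0.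
Proof.
move=> p1; have p0 : (0 < p)%R by apply: lt_le_trans p1.
apply/eqP; rewrite eq_le dist_slobodeckij_ge0// andbT; apply: ereal_inf_lbound.
exists (cst 0%R); first exact: Lp_reps0.
rewrite slobodeckijE /slob_int integral0_eq ?poweR0r ?gt_eqF ?invr_gt0// => x _.
by rewrite subrr normr0 powR0 ?gt_eqF// mul0r.
Qed.

Lemma sobolev_norm_nneg0 s p : (1 <= p)%R -> sobolev_norm_nneg s p (0 : D -> R^o)%R = 0.
Proof.
move=> p1; have d0 k (nu : mindex n k) : dist_deriv nu (0 : D -> R^o)%R = 0%R.
  by apply/funext => phi; rewrite /dist_deriv mulr0.
rewrite /sobolev_norm_nneg big1 ?add0e => [|nu _]; last by rewrite d0 dist_Lp_norm0.
by case: ifP => // _; rewrite big1// => nu _; rewrite d0 dist_slobodeckij0.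
Qed.

End quasi_norm.

                                   

(** * Test functions as elements of the Sobolev spaces *)

Section testfun_regular.
Context {R : realType} {n : nat} {U : set 'rV[R]_n}.
Local Notation X := 'rV[R]_n.
Local Notation D := (testfun U).
Local Notation mu := (lebesgue_rV R n).
Implicit Types (phi psi : D).

Lemma patch_testfun phi : (phi : X -> R) \_ U = phi.
Proof.
apply/funext => x; rewrite patchE; case: ifPn => // /negP xU.
by rewrite (test_function_out (testfunP phi))// => Ux; apply: xU; rewrite inE.
Qed.

Lemma linear_regular_dist : linear (fun phi : D => regular_dist phi : D -> R^o).
Proof.
move=> a phi psi; apply/funext => w.
transitivity (a * regular_dist phi w + regular_dist psi w) => //.
have i1 := test_function_integrable (testfunP (testfun_mul phi w)).
have i2 := test_function_integrable (testfunP (testfun_mul psi w)).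
rewrite !regular_dist_testE -RintegralZl// -RintegralD//.
  by apply: eq_Rintegral => x _; rewrite mulrDl mulrA.
exact: (integrableZl measurableT a i1).
Qed.

Lemma regular_dist_linear phi : linear (regular_dist phi : D -> R^o).
Proof.
move=> a w z; rewrite [LHS]regular_dist_testE.
transitivity (a * regular_dist phi w + regular_dist phi z) => //.
have i1 := test_function_integrable (testfunP (testfun_mul phi w)).
have i2 := test_function_integrable (testfunP (testfun_mul phi z)).
rewrite !regular_dist_testE -RintegralZl// -RintegralD//.
  by apply: eq_Rintegral => x _; rewrite mulrDr mulrCA.
exact: (integrableZl measurableT a i1).
Qed.

Lemma Lp_fun_testfun (p : R) phi : 1 <= p -> Lp_fun U p phi.
Proof.
move=> p1; apply/(Lp_funP _ _ p1); rewrite patch_testfun; split.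
  exact: test_function_measurable (testfunP phi).
by apply: test_function_powR_lty (testfunP phi); apply: lt_le_trans p1.
Qed.

Lemma normr_le_sup (g : X -> R) x : (exists M, forall x, `|g x| <= M) ->
  `|g x| <= sup [set `|g x| | x in setT].
Proof.
move=> [M gM]; apply: ub_le_sup; last by exists x.
by exists M => _ [y _ <-].
Qed.

(** A distribution of order 0: the pairing with psi is at most the L^1 norm of [phi] times the
    supremum of |psi|, which is the term of [Cnorm 0] without derivatives. *)
Lemma regular_dist_distributions phi : distributions (regular_dist phi : D -> R^o).
Proof.
split; first exact: regular_dist_linear.
move=> K cK KU; exists (\int[mu]_x `|phi x|), 0%N => psi _.
have bd nu : exists M : R, forall x, `|testfun_deriv (nu : mindex n 0) psi x| <= M.
  by have [M M0 h] := test_function_bounded (testfunP (testfun_deriv nu psi)); exists M.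
have psiC x : `|psi x| <= Cnorm 0 psi.
  have [nu [d0 nuE]] := @mword_surj R n U 0 [::] (leqnn 0).
  rewrite /Cnorm (bigD1 nu)/= ?d0// nuE/= (le_trans (normr_le_sup x _))//.
    by have := bd nu; rewrite nuE.
  rewrite lerDl sumr_ge0// => nu' _.
  by rewrite (le_trans _ (normr_le_sup 0 (bd nu'))).
have i1 := test_function_integrable (testfunP (testfun_mul phi psi)).
have i2 : mu.-integrable setT (EFin \o (fun x => `|phi x|)).
  exact: integrable_abse (test_function_integrable (testfunP phi)).
rewrite regular_dist_testE (le_trans (le_normr_Rintegral _ _))//.
have i3 : mu.-integrable setT (EFin \o (fun x => `|phi x| * Cnorm 0 psi)).
  exact: (integrableZr measurableT (Cnorm 0 psi) i2).
rewrite -RintegralZr// le_Rintegral//.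
  exact: integrable_abse i1.
by move=> x _; rewrite normrM ler_wpM2l.
Qed.

Lemma test_function_slob_lty (theta p : R) phi : 1 < p -> 0 < theta -> theta < 1 ->
  (slob_int setT theta p phi < +oo)%E.
Proof.
move=> p1 t0 t1; have [C C0 CP] := slob_int_test U p1 t0 t1.
have p0 : 0 < p by apply: lt_trans p1.
apply: le_lt_trans (CP _ (testfunP phi)) _.
apply: lte_mul_pinfty; rewrite ?lee_fin ?fin_numE//.
apply: lte_add_pinfty; first exact: test_function_powR_lty (testfunP phi).
apply: lte_sum_pinfty => i _.
exact: test_function_powR_lty p0 (testfunP (testfun_partial i phi)).
Qed.

Lemma slob_int_setT (V : set X) (theta p : R) (f : X -> R) : open V ->
  measurable_fun setT f -> (slob_int V theta p f <= slob_int setT theta p f)%E.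
Proof.
move=> oV mf; have mV : measurable V by exact: open_measurable_rV.
rewrite /slob_int setXTT; apply: ge0_subset_integral => //.
- exact: measurableX.
- apply/measurable_EFinP; apply: measurable_funM; last exact: (measurable_diff_kernel (measurable_slob_kernel _)).
  by apply: measurable_powR_norm; apply: measurable_funB; exact: (measurableT_comp mf).
- by move=> z _; rewrite lee_fin mulr_ge0 ?powR_ge0// slob_kernel_ge0.
Qed.

Lemma sobolev_norm_regular_lty (s p : R) phi : open U -> 0 <= s -> 1 < p ->
  (sobolev_norm_nneg s p (regular_dist phi : D -> R^o) < +oo)%E.
Proof.
move=> oU s0 p1; have p0 : 0 < p by apply: lt_trans p1.
have /andP[ks sk] := Num.Theory.truncn_itv s0.
have rep (psi : D) : Lp_reps p (regular_dist psi : D -> R^o) psi.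
  by split=> //; apply: Lp_fun_testfun; exact: ltW.
apply: lte_add_pinfty.
  apply: lte_sum_pinfty => nu _; rewrite dist_deriv_regular.
  apply: (@le_lt_trans _ _ (Lp_norm U p (testfun_deriv nu phi))).
    by apply: ereal_inf_lbound; exists (testfun_deriv nu phi).
  have /(Lp_funP _ _ (ltW p1))[_ h] := Lp_fun_testfun (testfun_deriv nu phi) (ltW p1).
  by rewrite Lp_normE//; apply: poweR_lty; exact: h.
case: ifPn => [_|th0]; first by rewrite ltry.
apply: lte_sum_pinfty => nu _; rewrite dist_deriv_regular.
apply: (@le_lt_trans _ _ (slobodeckij U (s - (Num.truncn s)%:R) p (testfun_deriv nu phi))).
  by apply: ereal_inf_lbound; exists (testfun_deriv nu phi).
rewrite slobodeckijE; apply: poweR_lty.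
apply: le_lt_trans (slob_int_setT _ _ oU (test_function_measurable (testfunP _))) _.
apply: test_function_slob_lty => //.
  by rewrite lt_neqAle eq_sym th0 subr_ge0.
by rewrite ltrBlDr addrC natr1.
Qed.

Lemma sobolev0_regular (s p : R) phi : open U -> 0 <= s -> 1 < p ->
  sobolev0 s p (regular_dist phi : D -> R^o).
Proof.
move=> oU s0 p1; split.
  by split; [exact: regular_dist_distributions|exact: sobolev_norm_regular_lty].
move=> e e0; exists phi; rewrite subrr sobolev_norm_nneg0 ?ltW//.
Qed.

End testfun_regular.

(** * Multiplication by a cut-off and extension by zero *)

Section cutoff_extension.
Context {R : realType} {n : nat} {U V : set 'rV[R]_n}.
Local Notation X := 'rV[R]_n.
Local Notation mu := (lebesgue_rV R n).
Hypothesis UV : U `<=` V.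

Lemma testfun_ext_subproof (phi : testfun U) : (phi : X -> R^o) \in test_pred V.
Proof. by rewrite inE; have [sf cf fU] := testfunP phi; split=> // x /fU /UV. Qed.

Definition testfun_ext (phi : testfun U) : testfun V := TestFun (testfun_ext_subproof phi).

Lemma testfun_cut_subproof (eta : testfun U) (psi : testfun V) :
  ((psi : X -> R) * (eta : X -> R)) \in test_pred U.
Proof. by rewrite inE; apply: test_functionMl; [case: (testfunP psi)|exact: testfunP]. Qed.

Definition testfun_cut (eta : testfun U) (psi : testfun V) : testfun U :=
  TestFun (testfun_cut_subproof eta psi).

Lemma linear_testfun_ext : linear testfun_ext.
Proof. by move=> a phi psi; apply: val_inj. Qed.

Lemma Dw_ext w (phi : testfun U) : Dw w (testfun_ext phi) = testfun_ext (Dw w phi).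
Proof. by elim: w => //= i w IH; rewrite -/(Dw _ _) IH; apply: val_inj. Qed.

(** Extending eta g by zero is the transpose of cutting by [eta]. For a general distribution [u] on
    [U], the form psi |-> u(eta psi) thus serves as the extension of eta u. *)
Lemma regular_dist_cut (eta g : testfun U) :
  regular_dist (testfun_ext (testfun_mul eta g)) =
  (fun psi => regular_dist g (testfun_cut eta psi)) :> (testfun V -> R^o).
Proof.
apply/funext => psi; rewrite !regular_dist_testE; apply: eq_Rintegral => x _.
by rewrite /= !fctE; ring.
Qed.

End cutoff_extension.

Section multiplier.
Context {R : realType} {n : nat} {U V : set 'rV[R]_n}.
Local Notation X := 'rV[R]_n.
Local Notation mu := (lebesgue_rV R n).
Hypothesis (oU : open U) (oV : open V) (UV : U `<=` V).
Local Open Scope ereal_scope.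

Lemma patch_mul (eta : testfun U) (f : X -> R) :
  (fun x => eta x * f x)%R \_ V = (fun x => eta x * (f \_ U) x)%R.
Proof.
apply/funext => x; rewrite !patchE.
have [xU|xU] := boolP (x \in U).
  by rewrite mem_set//; apply: UV; rewrite inE in xU.
rewrite (test_function_out (testfunP eta)) ?mul0r ?if_same//.
by move=> Ux; move: xU; rewrite mem_set.
Qed.

(** The product is formed with [g] but measured by [f]: the two representatives agree almost
    everywhere where [eta] is nonzero. *)
Lemma lp_int_mul (p : R) (eta : testfun U) : (1 <= p)%R ->
  exists2 M : R, (0 < M)%R & forall (u : testfun U -> R^o) f g,
    Lp_reps p u f -> Lp_reps p u g ->
    Lp_fun V p (fun x => eta x * g x)%R /\
    Lp_norm V p (fun x => eta x * g x)%R <= M%:E * Lp_norm U p f.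
Proof.
move=> p1; have p0 : (0 < p)%R by apply: lt_le_trans p1.
have [M M0 MP] := test_function_bounded (testfunP eta).
have me := test_function_measurable (testfunP eta).
exists M => // u f g [fp uf] [gp ug].
have fg := representatives_ae_eq eta p1 oU fp gp (etrans (esym uf) ug).
move: fp gp => /(Lp_funP _ _ p1)[mf ff] /(Lp_funP _ _ p1)[mg gf].
have meg : measurable_fun setT ((fun x => eta x * g x)%R \_ V).
  by rewrite patch_mul; exact: measurable_funM.
have h : lp_int V p (fun x => eta x * g x)%R <= (M `^ p)%:E * lp_int U p f.
  rewrite /lp_int patch_mul -ge0_integralZl//; last 2 first.
  - by apply/measurable_EFinP; exact: measurable_powR_norm.
  - by rewrite lee_fin powR_ge0.
  apply: ae_ge0_le_integral => //.
  - apply/measurable_EFinP; apply: measurable_powR_norm; exact: measurable_funM.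
  - by move=> x _; rewrite -EFinM lee_fin mulr_ge0// powR_ge0.
  - by apply: emeasurable_funM => //; apply/measurable_EFinP; exact: measurable_powR_norm.
  - apply: filterS fg => x fgx _; rewrite -fgx -EFinM lee_fin -powRM ?(ltW M0)//.
    by rewrite ge0_ler_powR ?nnegrE ?mulr_ge0 ?(ltW M0) ?(ltW p0)// normrM ler_wpM2r.
split.
  apply/(Lp_funP _ _ p1); split; [exact: meg|apply: le_lt_trans h _].
  by apply: lte_mul_pinfty; [rewrite lee_fin powR_ge0|rewrite fin_numE|exact: ff].
rewrite !Lp_normE//; have := @lee_root R p M _ (lp_int U p f) 0 p1 (ltW M0) (lp_int_ge0 _ _ _) (lp_int_ge0 _ _ _) (lexx _).
by rewrite poweR0r ?gt_eqF ?invr_gt0// !adde0; exact.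
Qed.

Lemma Lp_reps_mul (p : R) (eta : testfun U) (u : testfun U -> R^o) f : (1 <= p)%R ->
  Lp_reps p u f -> Lp_reps p ((fun psi => u (testfun_cut eta psi)) : testfun V -> R^o)
    (fun x => eta x * f x)%R.
Proof.
move=> p1 uf; have [M _ h] := lp_int_mul eta p1; have [h1 _] := h _ _ _ uf uf.
split=> //; apply/funext => psi; have [_ ->] := uf.
by rewrite !regular_distE; apply: eq_Rintegral => x _; rewrite patch_mul /= !fctE mulrA.
Qed.

Lemma dist_Lp_norm_cut (p : R) (eta : testfun U) : (1 <= p)%R ->
  exists2 M : R, (0 < M)%R & forall u : testfun U -> R^o,
    dist_Lp_norm p ((fun psi => u (testfun_cut eta psi)) : testfun V -> R^o) <=
    M%:E * dist_Lp_norm p u.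
Proof.
move=> p1; have p0 : (0 < p)%R by apply: lt_le_trans p1.
have [M M0 h] := lp_int_mul eta p1; exists M => // u.
rewrite -[leRHS]adde0; apply: le_ereal_inf_affine => //.
  by move=> _ [f _ <-]; rewrite Lp_normE// poweR_ge0.
move=> _ [f uf <-]; rewrite adde0; have [_] := h _ _ _ uf uf; apply: le_trans.
by apply: ereal_inf_lbound; exists (fun x => eta x * f x)%R => //; exact: Lp_reps_mul.
Qed.

Lemma Lp_norm_mul_le (p : R) (eta : testfun U) : (1 <= p)%R ->
  exists2 M : R, (0 < M)%R & forall (u : testfun U -> R^o) g, Lp_reps p u g ->
    Lp_norm V p (fun x => eta x * g x)%R <= M%:E * dist_Lp_norm p u.
Proof.
move=> p1; have p0 : (0 < p)%R by apply: lt_le_trans p1.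
have [M M0 h] := lp_int_mul eta p1; exists M => // u g ug.
rewrite -[leRHS]adde0; apply: le_ereal_inf_affine => //.
  by move=> _ [f _ <-]; rewrite Lp_normE// poweR_ge0.
by move=> _ [f uf <-]; rewrite adde0; have [_] := h _ _ _ uf ug.
Qed.

Lemma dist_slobodeckij_cut (theta p : R) (eta : testfun U) :
  (1 < p)%R -> (0 < theta)%R -> (theta < 1)%R ->
  exists2 M : R, (0 < M)%R & forall u : testfun U -> R^o,
    dist_slobodeckij theta p ((fun psi => u (testfun_cut eta psi)) : testfun V -> R^o) <=
    M%:E * (dist_slobodeckij theta p u + dist_Lp_norm p u).
Proof.
move=> p1 t0 t1; have p0 : (0 < p)%R by apply: lt_trans p1.
have [C C0 CP] := slob_int_cutoff p1 t0 t1 oU (testfunP eta).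
(* The p-th power of [M] is C + 1, which dominates [C] and keeps [M] positive even when C = 0. *)
pose M := ((C + 1) `^ p^-1)%R.
have M0 : (0 < M)%R by rewrite powR_gt0// ltr_wpDl.
have MC : (C <= M `^ p)%R by rewrite /M -powRrM mulVf ?gt_eqF// powRr1 ?lerDl// addr_ge0.
exists M => // u; rewrite -[X in _ * (X + _)]mul1e; apply: le_ereal_inf2 => //.
- by move=> _ [f _ <-]; rewrite poweR_ge0.
- by move=> _ [f _ <-]; rewrite Lp_normE// poweR_ge0.
move=> _ _ [f uf <-] [g ug <-]; rewrite mul1e.
have [fp uf2] := uf; have [gp ug2] := ug.
have fg := representatives_ae_eq eta (ltW p1) oU fp gp (etrans (esym uf2) ug2).
have [/(Lp_funP _ _ (ltW p1))[mef _] _] := Lp_reps_mul eta (ltW p1) uf.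
move: fp gp => /(Lp_funP _ _ (ltW p1))[mf ff] /(Lp_funP _ _ (ltW p1))[mg gf].
apply: (@le_trans _ _ (slobodeckij V theta p (fun x => eta x * f x)%R)).
  by apply: ereal_inf_lbound; exists (fun x => eta x * f x)%R => //; exact: Lp_reps_mul (ltW p1) uf.
rewrite Lp_normE// !slobodeckijE; apply: (lee_root (ltW p1) (ltW M0) (slob_int_ge0 _ _ _ _) (slob_int_ge0 _ _ _ _) (lp_int_ge0 _ _ _)).
have me : measurable_fun setT (fun x => eta x * f x)%R.
  rewrite (_ : (fun x => _) = (fun x => eta x * (f \_ U) x)%R) -?patch_mul//.
  apply/funext => x; rewrite patch_mul patchE; case: ifPn => // xU.
  rewrite (test_function_out (testfunP eta)) ?mul0r//.
  by move=> Ux; move: xU; rewrite mem_set.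
apply: (le_trans (slob_int_setT _ _ oV me)); apply: (le_trans (CP _ _ mf mg fg)).
by rewrite lee_wpmul2r ?lee_fin// adde_ge0 ?slob_int_ge0// lp_int_ge0.
Qed.

End multiplier.

(** * Boundedness of cut-offs in Sobolev norms of nonnegative order *)

Section dominated.
Context {R : realType} {T : Type}.
Local Open Scope ereal_scope.
Implicit Types F G N : T -> \bar R.

(** An estimate uniform in a parameter, stated as a relation so that estimates compose and add
    without naming their constants. *)
Definition dominated F N := exists2 C : R, (0 < C)%R & forall x, F x <= C%:E * N x.

Lemma dominated_le F G N : (forall x, F x <= G x) -> dominated G N -> dominated F N.
Proof. by move=> FG [C C0 h]; exists C => // x; exact: le_trans (FG x) (h x). Qed.

Lemma dominated_trans F G N : dominated F G -> dominated G N -> dominated F N.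
Proof.
move=> [C C0 h] [E E0 g]; exists (C * E)%R; first exact: mulr_gt0.
move=> x; rewrite (le_trans (h x))// EFinM -muleA lee_wpmul2l// lee_fin ltW//.
Qed.

Lemma dominatedZ (c : R) F N : (0 <= c)%R -> (forall x, 0 <= F x) ->
  dominated F N -> dominated (fun x => c%:E * F x) N.
Proof.
move=> c0 F0; apply: dominated_trans; exists (c + 1)%R; first by rewrite ltr_wpDl.
by move=> x; rewrite lee_wpmul2r// lee_fin lerDl.
Qed.

Lemma dominatedD F G N : (forall x, 0 <= N x) -> dominated F N -> dominated G N ->
  dominated (fun x => F x + G x) N.
Proof.
move=> N0 [C C0 h] [E E0 g]; exists (C + E)%R; first exact: addr_gt0.
by move=> x; rewrite EFinD ge0_muleDl ?lee_fin ?(ltW C0) ?(ltW E0)// leeD.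
Qed.

Lemma dominated_sum (I : finType) (P : pred I) (F : I -> T -> \bar R) N :
  (forall x, 0 <= N x) -> (forall i, P i -> dominated (F i) N) ->
  dominated (fun x => \sum_(i | P i) F i x) N.
Proof.
move=> N0 h; rewrite (_ : (fun _ => _) = (fun x => \sum_(i <- [seq i <- index_enum I | P i]) F i x)); last first.
  by apply/funext => x; rewrite big_filter.
have : forall i, i \in [seq i <- index_enum I | P i] -> dominated (F i) N.
  by move=> i; rewrite mem_filter => /andP[/h].
elim: [seq i <- index_enum I | P i] => [|i r IH] dF.
  by exists 1%R => // x; rewrite big_nil mul1e.
rewrite (_ : (fun _ => _) = (fun x => F i x + \sum_(j <- r) F j x)); last first.
  by apply/funext => x; rewrite big_cons.
apply: dominatedD => //; first by apply: dF; rewrite mem_head.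
by apply: IH => j jr; apply: dF; rewrite inE jr orbT.
Qed.

End dominated.

Section root_sum.
Context {R : realType}.
Local Open Scope ereal_scope.

Lemma poweR_subadd_sum (I : Type) (r : seq I) (q : R) (F : I -> \bar R) :
  (0 < q)%R -> (q <= 1)%R -> (forall i, 0 <= F i) ->
  (\sum_(i <- r) F i) `^ q <= \sum_(i <- r) (F i `^ q).
Proof.
move=> q0 q1 F0; elim: r => [|i r IH]; first by rewrite !big_nil poweR0r ?gt_eqF.
rewrite !big_cons; apply: (le_trans (poweR_subadd q0 q1 _ _)) => //.
  by apply: sume_ge0.
exact: leeD.
Qed.

End root_sum.

Section sobolev_norm_terms.
Context {R : realType} {n : nat} {U : set 'rV[R]_n}.
Local Notation D := (testfun U).
Local Open Scope ereal_scope.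
Variables (s p : R).
Hypothesis p0 : (0 < p)%R.
Local Notation k := (Num.truncn s).

Lemma dist_Lp_norm_le_sobolev (nu : mindex n k) (u : D -> R^o) : (mdeg nu <= k)%N ->
  dist_Lp_norm p (dist_deriv nu u) <= sobolev_norm_nneg s p u.
Proof.
move=> nuk; rewrite /sobolev_norm_nneg (bigD1 nu)//= -addeA leeDl//.
apply: adde_ge0; first by apply: sume_ge0 => i _; exact: dist_Lp_norm_ge0.
by case: ifP => // _; apply: sume_ge0 => i _; exact: dist_slobodeckij_ge0.
Qed.

Lemma dist_slobodeckij_le_sobolev (nu : mindex n k) (u : D -> R^o) :
  (s - k%:R)%R != 0%R -> mdeg nu = k ->
  dist_slobodeckij (s - k%:R)%R p (dist_deriv nu u) <= sobolev_norm_nneg s p u.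
Proof.
move=> th0 nuk; rewrite /sobolev_norm_nneg (negbTE th0) addeC (bigD1 nu) ?nuk//= -addeA leeDl//.
apply: adde_ge0; first by apply: sume_ge0 => i _; exact: dist_slobodeckij_ge0.
by apply: sume_ge0 => i _; exact: dist_Lp_norm_ge0.
Qed.

Lemma dominated_sobolev_norm (T : Type) (v : T -> D -> R^o) (N : T -> \bar R) :
  (forall x, 0 <= N x) ->
  (forall nu : mindex n k, (mdeg nu <= k)%N ->
    dominated (fun x => dist_Lp_norm p (dist_deriv nu (v x))) N) ->
  (forall nu : mindex n k, (s - k%:R)%R != 0%R -> mdeg nu = k ->
    dominated (fun x => dist_slobodeckij (s - k%:R)%R p (dist_deriv nu (v x))) N) ->
  dominated (fun x => sobolev_norm_nneg s p (v x)) N.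
Proof.
move=> N0 h1 h2; apply: dominatedD => //; first exact: dominated_sum.
have [_|th0] := eqVneq (s - k%:R)%R 0%R; first by exists 1%R => // x; rewrite mul1e.
by apply: dominated_sum => // nu /eqP; exact: h2.
Qed.

End sobolev_norm_terms.

Section cutoff_bounds.
Context {R : realType} {n : nat} {U V : set 'rV[R]_n}.
Local Notation X := 'rV[R]_n.
Local Notation mu := (lebesgue_rV R n).
Hypothesis (oU : open U) (oV : open V) (UV : U `<=` V).
Variables (s p : R).
Hypothesis (s0 : 0 <= s) (p1 : 1 < p).
Local Open Scope ereal_scope.
Local Notation k := (Num.truncn s).
Local Notation theta := (s - (Num.truncn s)%:R)%R.

Let p0 : (0 < p)%R. Proof. exact: lt_trans p1. Qed.

Let theta_itv : theta != 0%R -> (0 < theta)%R /\ (theta < 1)%R.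
Proof.
have /andP[ks sk] := Num.Theory.truncn_itv s0; move=> th0; split.
  by rewrite lt_neqAle eq_sym th0 subr_ge0.
by rewrite ltrBlDr addrC natr1.
Qed.

(** Here [u] is an extension of [u'] through [eta]. The hypothesis that cutting commutes with every
    derivative holds when [u] lives where [eta] is locally 1, so no derivative falls on [eta] and
    each term of the norm is estimated alone. *)
Lemma sobolev_norm_cut (eta : testfun U) :
  exists2 M : R, (0 < M)%R & forall (u : testfun V -> R^o) (u' : testfun U -> R^o),
    (forall nu : mindex n k, (mdeg nu <= k)%N ->
      dist_deriv nu u = (fun psi => dist_deriv nu u' (testfun_cut eta psi))) ->
    sobolev_norm_nneg s p u <= M%:E * sobolev_norm_nneg s p u'.
Proof.
(* The admissible pairs are packed into one type, so that [dominated] yields a constant common to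
   all of them. *)
pose T := {w : (testfun V -> R^o) * (testfun U -> R^o) | forall nu : mindex n k, (mdeg nu <= k)%N ->
      dist_deriv nu w.1 = (fun psi => dist_deriv nu w.2 (testfun_cut eta psi))}.
suff [M M0 h] : dominated (fun w : T => sobolev_norm_nneg s p (sval w).1)
    (fun w : T => sobolev_norm_nneg s p (sval w).2).
  by exists M => // u u' uu'; exact: (h (exist _ (u, u') uu')).
have N0 (w : T) : 0 <= sobolev_norm_nneg s p (sval w).2 by exact: sobolev_norm_nneg_ge0.
apply: dominated_sobolev_norm => // nu.
  move=> nuk; have [M M0 h] := dist_Lp_norm_cut oU UV eta (ltW p1).
  exists M => // -[[u u'] /= e]; rewrite e// (le_trans (h _))//.
  by rewrite lee_wpmul2l ?lee_fin ?(ltW M0)//; exact: dist_Lp_norm_le_sobolev.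
move=> th0 nuk; have [t0 t1] := theta_itv th0.
have [M M0 h] := dist_slobodeckij_cut oU oV UV eta p1 t0 t1.
have nuk' : (mdeg nu <= k)%N by rewrite nuk.
exists (M * 2)%R; first by rewrite mulr_gt0.
move=> [[u u'] /= e]; rewrite e// (le_trans (h _))// EFinM -muleA.
rewrite lee_wpmul2l ?lee_fin ?(ltW M0)// mule_natl mule2n.
by apply: leeD; [exact: dist_slobodeckij_le_sobolev|exact: dist_Lp_norm_le_sobolev].
Qed.

Local Notation N := (fun psi : testfun U => sobolev_norm_nneg s p (regular_dist psi : testfun U -> R^o)).

Let N0 psi : 0 <= N psi. Proof. exact: sobolev_norm_nneg_ge0. Qed.

Let Dw_le w : (size w <= k)%N ->
  dominated (fun psi : testfun U => dist_Lp_norm p (regular_dist (Dw w psi) : testfun U -> R^o)) N.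
Proof.
move=> wk; have [nu [d nuE]] := @mword_surj R n U k w wk.
exists 1%R => // psi; rewrite mul1e -nuE -dist_deriv_regular.
by apply: dist_Lp_norm_le_sobolev; rewrite ?d.
Qed.

Let ext_D (f g : testfun U) : regular_dist (testfun_ext UV (f + g)%R) =
  (regular_dist (testfun_ext UV f) + regular_dist (testfun_ext UV g))%R :> (testfun V -> R^o).
Proof.
have := linear_testfun_ext UV 1%R f g; rewrite !scale1r => ->.
by have := linear_regular_dist 1%R (testfun_ext UV f) (testfun_ext UV g); rewrite !scale1r.
Qed.

Let Lp_diff_op m T : (m <= k)%N -> diff_op m T ->
  dominated (fun psi : testfun U => dist_Lp_norm p (regular_dist (testfun_ext UV (T psi)) : testfun V -> R^o)) N.
Proof.
move=> mk; elim=> {T} [eta w wm|S T _ IS _ IT].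
  have [M M0 h] := dist_Lp_norm_cut oU UV eta (ltW p1).
  apply: dominated_trans (Dw_le (leq_trans wm mk)).
  by exists M => // psi; rewrite regular_dist_cut; exact: h.
apply: (@dominated_le _ _ _ (fun psi => 2%:E * (
  dist_Lp_norm p (regular_dist (testfun_ext UV (S psi)) : testfun V -> R^o) +
  dist_Lp_norm p (regular_dist (testfun_ext UV (T psi)) : testfun V -> R^o)))).
  move=> psi; rewrite ext_D.
  have := dist_Lp_norm_lincomb 1 (regular_dist (testfun_ext UV (S psi)) : testfun V -> R^o)
    (regular_dist (testfun_ext UV (T psi)) : testfun V -> R^o) (ltW p1) oV.
  by rewrite scale1r normr1 mul1e.
apply: dominatedZ => //; last exact: dominatedD.
by move=> psi; apply: adde_ge0; exact: dist_Lp_norm_ge0.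
Qed.

Let Lp_mul_le (eta : testfun U) w : (size w <= k)%N ->
  dominated (fun psi : testfun U => Lp_norm V p (testfun_mul eta (Dw w psi))) N.
Proof.
move=> wk; apply: dominated_trans (Dw_le wk).
have [M M0 h] := Lp_norm_mul_le oU UV eta (ltW p1); exists M => // psi.
by apply: h; split=> //; apply: Lp_fun_testfun; exact: ltW.
Qed.

                                                                                                   
                                                                           
(** The norm contains fractional seminorms of the derivatives of top order k only. A word of length
    k is handled by [dist_slobodeckij_cut]. A shorter word leaves room for one more derivative, so
    [slob_int_test] bounds its fractional seminorm by L^p norms of derivatives of order at most
    k. *)
Let slob_diff_op m T : theta != 0%R -> (m <= k)%N -> diff_op m T ->
  dominated (fun psi : testfun U => dist_slobodeckij theta p (regular_dist (testfun_ext UV (T psi)) : testfun V -> R^o)) N.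
Proof.
move=> th0 mk; have [t0 t1] := theta_itv th0; elim=> {T} [eta w wm|S T _ IS _ IT]; last first.
  apply: (@dominated_le _ _ _ (fun psi => 2%:E * (
    dist_slobodeckij theta p (regular_dist (testfun_ext UV (S psi)) : testfun V -> R^o) +
    dist_slobodeckij theta p (regular_dist (testfun_ext UV (T psi)) : testfun V -> R^o)))).
    move=> psi; rewrite ext_D.
    have := dist_slobodeckij_lincomb theta 1 (regular_dist (testfun_ext UV (S psi)) : testfun V -> R^o)
      (regular_dist (testfun_ext UV (T psi)) : testfun V -> R^o) (ltW p1) oV.
    by rewrite scale1r normr1 mul1e.
  apply: dominatedZ => //; last exact: dominatedD.
  by move=> psi; apply: adde_ge0; exact: dist_slobodeckij_ge0.
have [wk|kw] := eqVneq (size w) k.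
  have [M M0 h] := dist_slobodeckij_cut oU oV UV eta p1 t0 t1.
  apply: (@dominated_trans _ _ _ (fun psi => dist_slobodeckij theta p (regular_dist (Dw w psi) : testfun U -> R^o) +
     dist_Lp_norm p (regular_dist (Dw w psi) : testfun U -> R^o))).
    by exists M => // psi; rewrite regular_dist_cut; exact: h.
  apply: dominatedD => //; last by apply: Dw_le; rewrite wk.
  have [nu [d nuE]] := @mword_surj R n U k w (eq_leq wk).
  exists 1%R => // psi; rewrite mul1e -nuE -dist_deriv_regular.
  by apply: dist_slobodeckij_le_sobolev; rewrite ?d.
have {kw}kw : (size w < k)%N by rewrite ltn_neqAle kw (leq_trans wm).
have [C C0 CP] := slob_int_test U p1 t0 t1.
pose c := ((C + 1) `^ p^-1)%R.
have c0 : (0 < c)%R by rewrite powR_gt0// ltr_wpDl.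
have cC : (C <= c `^ p)%R by rewrite /c -powRrM mulVf ?gt_eqF// powRr1 ?lerDl// addr_ge0.
have lp0 i psi : 0 <= \int[mu]_x (`|'D_(basis_vec R i) (testfun_mul eta (Dw w psi) : X -> R) x| `^ p)%:E.
  by apply: integral_ge0 => x _; rewrite lee_fin powR_ge0.
have LpE (g : testfun U) : Lp_norm V p g = (\int[mu]_x (`|g x| `^ p)%:E) `^ p^-1.
  rewrite (Lp_normE _ _ p0) /lp_int; congr (_ `^ _); apply: eq_integral => x _.
  by rewrite (patch_testfun (testfun_ext UV g)).
apply: (@dominated_le _ _ _ (fun psi => c%:E * (Lp_norm V p (testfun_mul eta (Dw w psi)) +
   \sum_(i < n) Lp_norm V p (testfun_partial i (testfun_mul eta (Dw w psi)))))).
  move=> psi; set g := testfun_mul eta (Dw w psi).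
  apply: (@le_trans _ _ (slobodeckij V theta p g)).
    apply: ereal_inf_lbound; exists g => //; split=> //.
    exact: (Lp_fun_testfun (testfun_ext UV g) (ltW p1)).
  have g0 : 0 <= \int[mu]_x (`|g x| `^ p)%:E by apply: integral_ge0 => x _; rewrite lee_fin powR_ge0.
  have sg0 : 0 <= \sum_(i < n) \int[mu]_x (`|'D_(basis_vec R i) (g : X -> R) x| `^ p)%:E.
    by apply: sume_ge0 => i _; exact: lp0.
  rewrite slobodeckijE LpE; apply: (@le_trans _ _ (c%:E * ((\int[mu]_x (`|g x| `^ p)%:E) `^ p^-1 +
    (\sum_(i < n) \int[mu]_x (`|'D_(basis_vec R i) (g : X -> R) x| `^ p)%:E) `^ p^-1))).
    apply: (lee_root (ltW p1) (ltW c0) (slob_int_ge0 _ _ _ _) g0 sg0).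
    apply: (le_trans (slob_int_setT _ _ oV (test_function_measurable (testfunP g)))).
    apply: (le_trans (CP _ (testfunP g))).
    by rewrite lee_wpmul2r ?lee_fin// adde_ge0.
  rewrite lee_wpmul2l ?lee_fin ?(ltW c0)// leeD2l//.
  have q0 : (0 < p^-1)%R by rewrite invr_gt0.
  have q1 : (p^-1 <= 1)%R by rewrite invf_le1// ltW.
  apply: (le_trans (poweR_subadd_sum _ q0 q1 (fun i => lp0 i psi))).
  by apply: lee_sum => i _; rewrite LpE.
have Lp0 (g : X -> R) : 0 <= Lp_norm V p g by rewrite Lp_normE// poweR_ge0.
apply: dominatedZ => //; first exact: ltW.
  by move=> psi; rewrite adde_ge0// sume_ge0.
apply: dominatedD => //; first by apply: Lp_mul_le; exact: ltnW.
apply: dominated_sum => // i _.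
apply: (@dominated_le _ _ _ (fun psi => 2%:E * (Lp_norm V p (testfun_mul eta (Dw (i :: w) psi)) +
   Lp_norm V p (testfun_mul (testfun_partial i eta) (Dw w psi))))).
  move=> psi; set g := testfun_mul eta (Dw (i :: w) psi); set h := testfun_mul (testfun_partial i eta) _.
  have lin := Lp_norm_lincomb 1%R (ltW p1) (Lp_fun_testfun (testfun_ext UV g) (ltW p1)) (Lp_fun_testfun (testfun_ext UV h) (ltW p1)).
  rewrite normr1 mul1e in lin; apply: le_trans lin.
  rewrite le_eqVlt; apply/orP; left; apply/eqP; congr (Lp_norm V p _); apply/funext => x.
  rewrite mul1r [LHS]testfun_partialM; congr (_ + _)%R; exact: mulrC.
apply: dominatedZ => //; first by move=> psi; rewrite adde_ge0.
by apply: dominatedD => //; apply: Lp_mul_le => //; exact: ltnW.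
Qed.

(** Here [psi] is arbitrary, so derivatives do fall on [eta]; [diff_op_Dw_mul] expands them into
    terms that are bounded separately. *)
Lemma sobolev_norm_cutoff (eta : testfun U) :
  dominated (fun psi : testfun U =>
    sobolev_norm_nneg s p (regular_dist (testfun_ext UV (testfun_mul eta psi)) : testfun V -> R^o)) N.
Proof.
have E k' (nu : mindex n k') (psi : testfun U) :
    dist_deriv nu (regular_dist (testfun_ext UV (testfun_mul eta psi)) : testfun V -> R^o) =
    regular_dist (testfun_ext UV (Dw (mword nu) (testfun_mul eta psi))).
  by rewrite dist_deriv_regular testfun_derivE Dw_ext.
apply: dominated_sobolev_norm => // nu.
  move=> nuk; under eq_fun do rewrite E.
  by apply: Lp_diff_op (diff_op_Dw_mul (mword nu) eta); rewrite size_mword.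
move=> th0 nuk; under eq_fun do rewrite E.
by apply: slob_diff_op (diff_op_Dw_mul (mword nu) eta); rewrite ?size_mword ?nuk.
Qed.

End cutoff_bounds.

                                

(** * Negative orders by duality *)

Section dual_norms.
Context {R : realType} {n : nat} {U : set 'rV[R]_n}.
Local Notation D := (testfun U).
Variables (s q : R).
Hypothesis (oU : open U) (s0 : 0 <= s) (q1 : 1 < q).
Local Notation N := (@sobolev_norm_nneg R n U s q).
Local Notation reg phi := (regular_dist phi : D -> R^o).
Implicit Types (u v w : D -> R^o) (phi psi : D).

Let N0 u : (0 <= N u)%E.
Proof. by apply: sobolev_norm_nneg_ge0; apply: lt_trans q1. Qed.

Let N_lincomb (a : R) u v : (N (a *: u + v)%R <= 2%:E * (`|a|%:E * N u + N v))%E.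
Proof. by apply: sobolev_norm_nneg_lincomb => //; exact: ltW. Qed.

Let Nzero : N 0 = 0%E. Proof. by apply: sobolev_norm_nneg0; exact: ltW. Qed.

Let regZ (a : R) phi : reg (a *: phi) = a *: reg phi.
Proof.
have h := @linear_regular_dist R n U; have r0 : reg (0 : D) = 0.
  by have := h (-1) 0 0; rewrite scaler0 addr0 scaleN1r addNr.
by have := h a phi 0; rewrite addr0 r0 addr0.
Qed.

Let reg0 : reg (0 : D) = 0.
Proof. by rewrite -[0 : D](scale0r 0) regZ scale0r. Qed.

Lemma dual_norm_ge0 (F : (D -> R^o) -> R) : (0 <= dual_norm s q F)%E.
Proof.
apply: (@le_trans _ _ (`|F (reg 0)|%:E)); first by rewrite lee_fin.
apply: ereal_sup_ubound; exists (reg 0) => //; split; first exact: (sobolev0_regular (0 : D) oU s0 q1).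
by rewrite reg0 Nzero.
Qed.

(** Rescale [phi] into the unit ball. The available bound is N(a v) <= 2 |a| N(v), so the rescaling
    costs the factor 2. *)
Lemma dual_norm_bound (F : (D -> R^o) -> R) u phi : sobolev0_dual s q F -> linear u ->
  (forall psi, F (reg psi) = u psi) ->
  (`|u phi|%:E <= (2 * fine (dual_norm s q F))%:E * N (reg phi))%E.
Proof.
move=> [_ Foo] lu Fu; have d0 := dual_norm_ge0 F.
have Noo := sobolev_norm_regular_lty phi oU s0 q1.
have Fd : (dual_norm s q F = (fine (dual_norm s q F))%:E) by rewrite fineK// ge0_fin_numE.
have NE : N (reg phi) = (fine (N (reg phi)))%:E by rewrite fineK// ge0_fin_numE.
have Fb v : sobolev0 s q v -> (N v <= 1)%E -> `|F v| <= fine (dual_norm s q F).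
  by move=> v0 v1; rewrite -lee_fin -Fd; apply: ereal_sup_ubound; exists v.
move: Foo Fd Fb; set d := fine _ => Foo Fd Fb; have d0' : 0 <= d by rewrite fine_ge0.
rewrite NE -EFinM lee_fin; set r := fine (N _) in NE *; have r0 : 0 <= r by rewrite fine_ge0.
apply/ler_addgt0Pr => e e0.
(* Slightly larger than [r], so that division by [t] is legitimate even when r = 0; the excess adds
   at most [e] to the final bound. *)
pose t := r + e / (2 * d + 1).
have d1 : 0 < 2 * d + 1 by rewrite ltr_wpDl// mulr_ge0.
have t0 : 0 < t by rewrite ltr_wpDl// divr_gt0.
have u0 : u 0 = 0 by have := lu (-1) 0 0; rewrite scaler0 addr0 scaleN1r addNr.
have uZ a : u (a *: phi) = a * u phi by have := lu a phi 0; rewrite addr0 u0 addr0.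
have /Fb : sobolev0 s q (reg ((2 * t)^-1 *: phi)) by exact: sobolev0_regular.
rewrite Fu uZ regZ.
rewrite normrM gtr0_norm ?invr_gt0 ?mulr_gt0// ler_pdivrMl ?mulr_gt0// => h.
have {}h : `|u phi| <= 2 * t * d.
  apply: h; rewrite -[_ *: _]addr0; apply: le_trans (N_lincomb _ _ _) _.
  rewrite Nzero adde0 NE -!EFinM lee_fin gtr0_norm ?invr_gt0 ?mulr_gt0//.
  rewrite invfM mulrA mulrA divff// mul1r mulrC ler_pdivrMr// mul1r lerDl divr_ge0// ltW//.
rewrite (le_trans h)// (_ : 2 * t * d = 2 * d * r + (2 * d) / (2 * d + 1) * e); last by rewrite /t; ring.
by rewrite lerD2l ler_piMl ?(ltW e0)// ler_pdivrMr// mul1r lerDl.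
Qed.

                                                                                   
                                                                                                  
(** A McShane extension: G(w) is the infimum over test functions phi of l(phi) + C N(w - phi). By
    [N_B], l(phi) and l(phi') differ by at most C (N(w - phi) + N(w - phi')), where C = 2M on
    account of the quasi-triangle inequality. Hence |G(w) - l(phi)| <= C N(w - phi), which gives at
    once that [G] extends [l], that it is bounded by [C], and, by approximating with test functions,
    that it is linear on their closure. *)
Lemma dual_extension (l : D -> R^o) (M : R) (p : R) : 0 <= M -> linear l -> conj_exp p = q ->
  (forall phi, `|l phi|%:E <= M%:E * N (reg phi))%E ->
  (sobolev_norm_neg (- s) p l <= (2 * M)%:E)%E.
Proof.
move=> M0 ll pq lM; set C := 2 * M; have C0 : 0 <= C by rewrite mulr_ge0.
have N_B w phi phi' : (N (w - reg phi)%R < +oo -> N (w - reg phi')%R < +oo ->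
    `|l phi - l phi'|%:E <= (C * fine (N (w - reg phi)%R) + C * fine (N (w - reg phi')%R))%:E)%E.
  move=> h h'; have -> : l phi - l phi' = l (phi - phi').
    by have := ll (-1) phi' phi; rewrite !scaleN1r [- phi' + phi]addrC => ->; rewrite addrC.
  apply: (le_trans (lM _)).
  have -> : reg (phi - phi') = (-1) *: (w - reg phi) + (w - reg phi').
    rewrite -[phi - phi']addrC -[- phi']scaleN1r linear_regular_dist scaleN1r scaleN1r.
    by rewrite opprB addrA subrK addrC.
  apply: (@le_trans _ _ (M%:E * (2%:E * (N (w - reg phi)%R + N (w - reg phi')%R))))%E.
    by rewrite lee_wpmul2l ?lee_fin// (le_trans (N_lincomb _ _ _))// normrN1 mul1e.
  rewrite -[N (w - reg phi)%R]fineK ?ge0_fin_numE// -[N (w - reg phi')%R]fineK ?ge0_fin_numE//.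
  by rewrite -EFinD -!EFinM lee_fin /C /= le_eqVlt; apply/orP; left; apply/eqP; ring.
pose S w : set R := [set l phi + C * fine (N (w - reg phi)%R) | phi in [set phi : D | (N (w - reg phi)%R < +oo)%E]].
pose G w : R := inf (S w).
have GP w phi : (N (w - reg phi)%R < +oo)%E -> `|G w - l phi| <= C * fine (N (w - reg phi)%R).
  move=> h; have lb x : S w x -> l phi - C * fine (N (w - reg phi)%R) <= x.
    move=> [phi' h' <-]; have := N_B _ _ _ h h'; rewrite lee_fin ler_norml => /andP[_].
    by rewrite !lerBlDr; move=> h2; rewrite (le_trans h2)//; lra.
  have lo : l phi - C * fine (N (w - reg phi)%R) <= G w.
    by apply: lb_le_inf => [|x /lb//]; exists (l phi + C * fine (N (w - reg phi)%R)); exists phi.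
  have up : G w <= l phi + C * fine (N (w - reg phi)%R).
    by apply: ge_inf; [exists (l phi - C * fine (N (w - reg phi)%R))|exists phi].
  by rewrite ler_norml; apply/andP; split; lra.
have Greg phi : G (reg phi) = l phi.
  have := GP (reg phi) phi; rewrite subrr Nzero mulr0 normr_le0 subr_eq0 => /(_ _)/eqP; apply.
  exact: ltry.
have l0 : l 0 = 0 by have := ll (-1) 0 0; rewrite scaler0 addr0 scaleN1r addNr.
have GN w : (N w < +oo)%E -> `|G w| <= C * fine (N w).
  by move=> h; have := GP w 0; rewrite reg0 subr0 l0 subr0; apply.
have Goo : (dual_norm s q G <= C%:E)%E.
  apply: ub_ereal_sup => _ [v [[_ _] v1] <-]; rewrite lee_fin.
  have voo : (N v < +oo)%E by apply: le_lt_trans v1 (ltry _).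
  rewrite (le_trans (GN _ voo))// ler_piMr// -lee_fin fineK// ge0_fin_numE//.
apply: (@le_trans _ _ (dual_norm s q G)) => //.
apply: ereal_inf_lbound; exists G; last by rewrite opprK pq.
rewrite opprK pq; split=> //; split; last by apply: le_lt_trans Goo (ltry _).
move=> a v w [[_ voo] dv] [[_ woo] dw]; apply/eqP; rewrite -subr_eq0 -normr_le0.
apply/ler_addgt0Pr => e e0; rewrite add0r.
(* The errors add up to 3 C (|a| + 1) d when [v] and [w] are both approximated within d; the extra 1
   keeps [K] positive. *)
pose K := 3 * C * (`|a| + 1) + 1.
have K0 : 0 < K by rewrite ltr_wpDl// !mulr_ge0// addr_ge0.
pose d := e / K; have d0 : 0 < d by rewrite divr_gt0.
have [fv fvd] := dv d d0; have [fw fwd] := dw d d0.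
have fin z phi : (N (z - reg phi)%R < d%:E)%E -> (N (z - reg phi)%R < +oo)%E /\ fine (N (z - reg phi)%R) <= d.
  move=> h; have hoo : (N (z - reg phi)%R < +oo)%E by apply: lt_trans h (ltry _).
  by split=> //; rewrite -lee_fin fineK ?ge0_fin_numE// ltW.
have [fvoo fvd'] := fin _ _ fvd; have [fwoo fwd'] := fin _ _ fwd.
have Gv := GP _ _ fvoo; have Gw := GP _ _ fwoo.
have NL : (N (a *: v + w - reg (a *: fv + fw))%R <= (2 * (`|a| * d + d))%:E)%E.
  have -> : a *: v + w - reg (a *: fv + fw) = a *: (v - reg fv) + (w - reg fw).
    by rewrite linear_regular_dist scalerBr opprD addrACA.
  apply: (le_trans (N_lincomb _ _ _)).
  rewrite EFinM lee_wpmul2l ?lee_fin// EFinD leeD// ?(ltW fwd)//.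
  by rewrite EFinM lee_wpmul2l ?lee_fin ?(ltW fvd).
have NLoo : (N (a *: v + w - reg (a *: fv + fw))%R < +oo)%E by apply: le_lt_trans NL (ltry _).
have Gvw := GP _ _ NLoo; rewrite ll in Gvw.
have NL' : fine (N (a *: v + w - reg (a *: fv + fw))%R) <= 2 * (`|a| * d + d).
  by rewrite -lee_fin fineK// ge0_fin_numE.
have Gv' : `|G v - l fv| <= C * d by rewrite (le_trans Gv)// ler_wpM2l.
have Gw' : `|G w - l fw| <= C * d by rewrite (le_trans Gw)// ler_wpM2l.
have Gvw' : `|G (a *: v + w) - (a * l fv + l fw)| <= C * (2 * (`|a| * d + d)).
  by rewrite (le_trans Gvw)// ler_wpM2l.
rewrite [X in `|X|](_ : _ = (G (a *: v + w) - (a * l fv + l fw)) - a * (G v - l fv) - (G w - l fw)); last by ring.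
rewrite (le_trans (ler_normB _ _))// (le_trans (lerD (ler_normB _ _) (lexx _)))// normrM.
rewrite (le_trans (lerD (lerD Gvw' (ler_wpM2l (normr_ge0 a) Gv')) Gw'))//.
rewrite (_ : _ + _ = 3 * C * (`|a| + 1) * d); last by ring.
rewrite (_ : e = K * d) ?ler_wpM2r ?(ltW d0)//; first by rewrite /K lerDl.
by rewrite /d mulrC divfK// gt_eqF.
Qed.

End dual_norms.

Section dual_comp.
Context {R : realType} {n : nat} {U V : set 'rV[R]_n}.
Variables (s p : R).
Hypothesis (oU : open U) (oV : open V) (s0 : s < 0) (p1 : 1 < p).

Lemma conj_exp_gt1 : 1 < conj_exp p.
Proof.
have p0 : 0 < p by apply: lt_trans p1.
have h : 0 < 1 - p^-1 by rewrite subr_gt0 invf_lt1.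
by rewrite /conj_exp invf_gt1// gtrBl invr_gt0.
Qed.

Local Notation q := (conj_exp p).

(** The transpose of a bounded map of test functions is bounded. The constant is 4M, with one factor
    2 from [dual_norm_bound] and another from [dual_extension]. *)
Lemma sobolev_norm_neg_comp (S : testfun U -> testfun V) :
  dominated (fun psi : testfun U => sobolev_norm_nneg (- s) q (regular_dist (S psi) : testfun V -> R^o))
            (fun psi : testfun U => sobolev_norm_nneg (- s) q (regular_dist psi : testfun U -> R^o)) ->
  exists2 C : R, 0 < C & forall (u : testfun U -> R^o) (v : testfun V -> R^o),
    linear u -> linear v -> (forall psi, u psi = v (S psi)) ->
    (sobolev_norm_neg s p u <= C%:E * sobolev_norm_neg s p v)%E.
Proof.
have q1 := conj_exp_gt1; have s0' : 0 <= - s by rewrite oppr_ge0 ltW.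
move=> [M M0 SM]; exists (4 * M); first by rewrite mulr_gt0.
move=> u v lu lv uv; rewrite -[leRHS]adde0.
apply: le_ereal_inf_affine; rewrite ?mulr_gt0//.
  by move=> _ [F _ <-]; exact: dual_norm_ge0.
move=> _ [F [dF Fv] <-]; rewrite adde0.
have d0 := dual_norm_ge0 oV s0' q1 F; have [_ doo] := dF.
have b := dual_norm_bound oV s0' q1 _ dF lv Fv.
set d := fine (dual_norm (- s) q F) in b.
have dE : dual_norm (- s) q F = d%:E by rewrite fineK// ge0_fin_numE.
have d0' : 0 <= d by rewrite fine_ge0.
rewrite dE -EFinM (_ : 4 * M * d = 2 * (2 * d * M)); last by ring.
have := @dual_extension R n U (- s) q oU q1 u (2 * d * M) p _ lu erefl _.
rewrite opprK; apply; first by rewrite !mulr_ge0// ltW.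
move=> psi; rewrite uv; apply: (le_trans (b _)); rewrite [(2 * d * M)%:E]EFinM -muleA.
by rewrite lee_wpmul2l ?lee_fin ?mulr_ge0.
Qed.

End dual_comp.

                     

(** * Comparison of norms on an open set and on a smaller one *)

Section restriction.
Context {R : realType} {n : nat} {U V : set 'rV[R]_n}.
Local Notation X := 'rV[R]_n.
Local Notation mu := (lebesgue_rV R n).
Hypothesis UV : U `<=` V.
Implicit Types (u w : testfun V -> R^o).

Definition dist_restrict u : testfun U -> R^o := fun psi => u (testfun_ext UV psi).

Lemma linear_dist_restrict u : linear u -> linear (dist_restrict u).
Proof. by move=> lu a phi psi; rewrite /dist_restrict linear_testfun_ext lu. Qed.

Lemma testfun_deriv_ext k (nu : mindex n k) (phi : testfun U) :
  testfun_deriv nu (testfun_ext UV phi) = testfun_ext UV (testfun_deriv nu phi).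
Proof. by rewrite !testfun_derivE Dw_ext. Qed.

Lemma distributions_restrict u : distributions u -> distributions (dist_restrict u).
Proof.
move=> [lu bu]; split; first exact: linear_dist_restrict.
move=> K cK KU; have [C [N h]] := bu K cK (subset_trans KU UV).
exists C, N => phi sphi; rewrite (le_trans (h (testfun_ext UV phi) sphi))//.
rewrite le_eqVlt; apply/orP; left; apply/eqP; congr (_ * _).
by apply: eq_bigr => nu _; rewrite testfun_deriv_ext.
Qed.

Lemma dist_deriv_restrict k (nu : mindex n k) u :
  dist_deriv nu (dist_restrict u) = dist_restrict (dist_deriv nu u).
Proof.
by apply/funext => phi; rewrite /dist_deriv /dist_restrict testfun_deriv_ext.
Qed.

Hypotheses (oU : open U) (oV : open V).

Lemma patch_patch (f : X -> R) : (f \_ V) \_ U = f \_ U.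
Proof.
apply/funext => x; rewrite !patchE; case: ifPn => // xU.
by rewrite mem_set//; apply: UV; rewrite inE in xU.
Qed.

Lemma measurable_patch_sub (f : X -> R) : measurable_fun setT (f \_ V) ->
  measurable_fun setT (f \_ U).
Proof.
move=> mf; rewrite -patch_patch; apply/(measurable_restrictT _ _).1.
  exact: open_measurable_rV.
exact: measurable_funS mf.
Qed.

Lemma normr_patch_le (f : X -> R) x : `|(f \_ U) x| <= `|(f \_ V) x|.
Proof.
rewrite -patch_patch [in leLHS]patchE; case: ifP => // _; by rewrite normr0.
Qed.

Section Lp.
Variable p : R.
Hypothesis p1 : 1 <= p.
Let p0 : 0 < p. Proof. by apply: lt_le_trans p1. Qed.

Lemma lp_int_sub (f : X -> R) : measurable_fun setT (f \_ V) ->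
  (lp_int U p f <= lp_int V p f)%E.
Proof.
move=> mf; apply: ge0_le_integral => //.
- by apply/measurable_EFinP; apply: measurable_powR_norm; exact: measurable_patch_sub.
- by apply/measurable_EFinP; exact: measurable_powR_norm.
- move=> x _; rewrite lee_fin ge0_ler_powR ?nnegrE ?(ltW p0)//.
  exact: normr_patch_le.
Qed.

Lemma slob_int_sub (theta : R) (f : X -> R) : measurable_fun setT (f \_ V) ->
  (slob_int U theta p f <= slob_int V theta p f)%E.
Proof.
move=> mf.
have slE (W : set X) : W `<=` V -> slob_int W theta p f = slob_int W theta p (f \_ V).
  move=> WV; apply: eq_integral => z; rewrite inE => -[z1 z2].
  by rewrite !patchE !mem_set//; exact: WV.
rewrite (slE U UV) (slE V)//; apply: ge0_subset_integral => //.
- by apply: measurableX; exact: open_measurable_rV.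
- by apply: measurableX; exact: open_measurable_rV.
- apply: (measurable_funS measurableT) => //.
  apply/measurable_EFinP; apply: measurable_funM; last exact: (measurable_diff_kernel (measurable_slob_kernel _)).
  by apply: measurable_powR_norm; apply: measurable_funB; exact: (measurableT_comp mf).
- by move=> z _; rewrite lee_fin mulr_ge0 ?powR_ge0// slob_kernel_ge0.
- by move=> z [/UV z1 /UV z2].
Qed.

Lemma Lp_reps_restrict u f : Lp_reps p u f -> Lp_reps p (dist_restrict u) f.
Proof.
move=> [/(Lp_funP _ _ p1)[mf ff] ->]; split.
  apply/(Lp_funP _ _ p1); split; first exact: measurable_patch_sub.
  by apply: le_lt_trans ff; exact: lp_int_sub.
apply/funext => psi; rewrite /dist_restrict !regular_distE; apply: eq_Rintegral => x _ /=.
rewrite -patch_patch [in RHS]patchE; case: ifPn => // xU.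
rewrite (test_function_out (testfunP psi)) ?mul0r//.
by move=> Ux; move: xU; rewrite mem_set.
Qed.

Lemma le_root (x y : \bar R) : (0 <= x -> x <= y -> x `^ p^-1 <= y `^ p^-1)%E.
Proof.
move=> x0 xy; have q0 : 0 <= p^-1 by rewrite invr_ge0 ltW.
by apply: (gt0_ler_poweR q0) => //; rewrite in_itv/= ?x0 ?leey// (le_trans x0 xy).
Qed.

(** Every representative on [V] also represents the restriction on [U], where the integrals run over
    a smaller set; so each infimum can only decrease. *)
Lemma sobolev_norm_restrict (s : R) u :
  (sobolev_norm_nneg s p (dist_restrict u) <= sobolev_norm_nneg s p u)%E.
Proof.
apply: leeD.
  apply: lee_sum => nu _; rewrite dist_deriv_restrict.
  apply/ereal_infP => _ [f uf <-].
  apply: (@le_trans _ _ (Lp_norm U p f)).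
    by apply: ereal_inf_lbound; exists f => //; exact: Lp_reps_restrict.
  have [/(Lp_funP _ _ p1)[mf _] _] := uf.
  by rewrite !Lp_normE//; apply: le_root; [exact: lp_int_ge0|exact: lp_int_sub].
have [//|th0] := eqVneq (s - (Num.truncn s)%:R) 0.
apply: lee_sum => nu _; rewrite dist_deriv_restrict.
apply/ereal_infP => _ [f uf <-].
apply: (@le_trans _ _ (slobodeckij U (s - (Num.truncn s)%:R) p f)).
  by apply: ereal_inf_lbound; exists f => //; exact: Lp_reps_restrict.
have [/(Lp_funP _ _ p1)[mf _] _] := uf.
by rewrite !slobodeckijE//; apply: le_root; [exact: slob_int_ge0|exact: slob_int_sub].
Qed.

End Lp.
End restriction.

Section localization.
Context {R : realType} {n : nat} {V : set 'rV[R]_n}.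
Local Notation X := 'rV[R]_n.
Local Notation D := (testfun V).

Lemma Dw_near w (f g : D) x : (\forall y \near x, f y = g y) -> Dw w f x = Dw w g x.
Proof.
move=> fg; suff : \forall y \near x, Dw w f y = Dw w g y by exact: nbhs_singleton.
elim: w => // i w IH.
have /nbhs_interior := IH; apply: filterS => y h.
exact: (@near_eq_derive _ _ _ (Dw w f : X -> R) (Dw w g : X -> R)).
Qed.

Lemma linear_dist_mul (phi : D) (u : D -> R^o) : linear u -> linear (dist_mul phi u).
Proof.
move=> lu a f g; rewrite /dist_mul -lu; congr u.
apply: val_inj; apply/funext => x /=.
transitivity (phi x * (a * f x + g x)) => //.
by rewrite mulrDr mulrCA.
Qed.

Lemma testfun_mul_Dw_near (phi f g : D) w :
  (forall x, supp phi x -> \forall y \near x, f y = g y) ->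
  testfun_mul phi (Dw w f) = testfun_mul phi (Dw w g).
Proof.
move=> fg; apply: val_inj; apply/funext => x.
transitivity (phi x * Dw w f x) => //; transitivity (phi x * Dw w g x) => //.
have [->|phix] := eqVneq (phi x) 0; first by rewrite !mul0r.
by rewrite (Dw_near w (fg x _))//; exact: subset_closure.
Qed.

End localization.

Section comparison.
Context {R : realType} {n : nat} {U V : set 'rV[R]_n}.
Local Notation X := 'rV[R]_n.
Hypotheses (oU : open U) (oV : open V) (UV : U `<=` V).
Variables (phi : testfun V) (chi : testfun U).
Hypothesis chi1 : forall x, supp phi x -> \forall y \near x, chi y = 1.

Let chi_mul (f g : testfun V) : (forall y, f y = chi y * g y) ->
  forall x, supp phi x -> \forall y \near x, f y = g y.
Proof. by move=> fg x /chi1; apply: filterS => y chiy; rewrite fg chiy mul1r. Qed.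

(** Near the support of [phi], [psi] and [chi psi] coincide together with all their derivatives, and
    [phi w] sees nothing else. *)
Let dist_mul_cut (w : testfun V -> R^o) k (nu : mindex n k) :
  dist_deriv nu (dist_mul phi w) =
  (fun psi => dist_deriv nu (dist_restrict UV (dist_mul phi w)) (testfun_cut chi psi)).
Proof.
apply/funext => psi; rewrite dist_deriv_restrict /dist_restrict /dist_deriv; congr (_ * w _).
rewrite !testfun_derivE; apply/esym/testfun_mul_Dw_near/chi_mul => y.
exact: mulrC.
Qed.

(** For s < 0 the restriction sends [psi] to w(phi chi psi), so it is the transpose of
    [psi |-> chi psi] from test functions on [U] to test functions on [V], bounded by
    [sobolev_norm_cutoff]. *)
Lemma sobolev_norm_dist_restrict (s p : R) : 1 < p ->
  exists2 C : R, 0 < C & forall w : testfun V -> R^o, linear w ->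
    (sobolev_norm s p (dist_restrict UV (dist_mul phi w)) <=
     C%:E * sobolev_norm s p (dist_mul phi w))%E.
Proof.
move=> p1; rewrite /sobolev_norm; have [s0|s0] := leP 0 s.
  exists 1 => // w _; rewrite mul1e; apply: sobolev_norm_restrict => //; exact: ltW.
have s0' : 0 <= - s by rewrite oppr_ge0 ltW.
have [C C0 h] := @sobolev_norm_neg_comp _ _ U V s p oU oV s0 p1 _
  (sobolev_norm_cutoff oU oV UV s0' (conj_exp_gt1 p1) chi).
exists C => // w lw; apply: h.
- exact/linear_dist_restrict/linear_dist_mul.
- exact: linear_dist_mul.
- move=> psi; congr w; apply/esym/(@testfun_mul_Dw_near _ _ _ phi _ _ [::])/chi_mul.
  by [].
Qed.

(** For s >= 0 the product [phi w] is recovered from its restriction by cutting with [chi]. For s <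
    0 the relevant map is [psi |-> chi psi] from [V] to [U]: multiplication on [V], bounded by the
    smooth multiplication property, followed by restriction to [U]. *)
Lemma sobolev_norm_dist_extend (s p : R) : 1 < p ->
  (s < 0 -> smooth_mult_triple V (- s) (conj_exp p)) ->
  exists2 C : R, 0 < C & forall w : testfun V -> R^o, linear w ->
    (sobolev_norm s p (dist_mul phi w) <=
     C%:E * sobolev_norm s p (dist_restrict UV (dist_mul phi w)))%E.
Proof.
move=> p1 smt; rewrite /sobolev_norm; have [s0|s0] := leP 0 s.
  have [M M0 h] := sobolev_norm_cut oU oV UV s0 p1 chi.
  by exists M => // w _; apply: h => nu _; exact: dist_mul_cut.
have s0' : 0 <= - s by rewrite oppr_ge0 ltW.
have q1 := conj_exp_gt1 p1.
have [C C0 h] : exists2 C : R, 0 < C & forall (u : testfun V -> R^o) (v : testfun U -> R^o),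
    linear u -> linear v -> (forall psi, u psi = v (testfun_cut chi psi)) ->
    (sobolev_norm_neg s p u <= C%:E * sobolev_norm_neg s p v)%E.
  apply: sobolev_norm_neg_comp => //.
  have [_ [C h]] := smt s0 (testfun_ext UV chi).
  (* The constant in the smooth multiplication property carries no sign, so it is replaced by a
     positive one. *)
  exists (`|C| + 1); first by rewrite ltr_wpDl.
  move=> psi.
  have reg_sob : sobolev (- s) (conj_exp p) (regular_dist psi : testfun V -> R^o).
    split; first exact: regular_dist_distributions.
    by rewrite /sobolev_norm s0'; exact: sobolev_norm_regular_lty.
  have := h _ reg_sob; rewrite /sobolev_norm s0' => {}h.
  apply: (@le_trans _ _ (C%:E * sobolev_norm_nneg (- s) (conj_exp p) (regular_dist psi : testfun V -> R^o))%E).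
    apply: le_trans h.
    rewrite (_ : regular_dist _ = dist_restrict UV (dist_mul (testfun_ext UV chi) (regular_dist psi))).
      by apply: sobolev_norm_restrict => //; exact: ltW.
    apply/funext => f; rewrite /dist_restrict /dist_mul !regular_dist_testE.
    by apply: eq_Rintegral => x _ /=; rewrite !fctE; ring.
  rewrite lee_wpmul2r ?sobolev_norm_nneg_ge0 ?(lt_trans _ q1)// lee_fin.
  by rewrite (le_trans (ler_norm C))// lerDl.
exists C => // w lw; apply: h.
- exact: linear_dist_mul.
- exact/linear_dist_restrict/linear_dist_mul.
- move=> psi; congr w; apply/esym/(@testfun_mul_Dw_near _ _ _ phi _ _ [::])/chi_mul.
  by move=> y; exact: mulrC.
Qed.

End comparison.

(** * The embedding of the local spaces *)

Lemma finite_set_lbound {R : realDomainType} {T : choiceType} (F : set T) (d : T -> R) :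
  finite_set F -> (forall x, 0 < d x) -> exists2 e : R, 0 < e & forall x, F x -> e <= d x.
Proof.
move=> /finite_seqP[r ->] d0; elim: r => [|x r [e e0 h]]; first by exists 1.
exists (Num.min (d x) e); first by rewrite lt_min d0.
by move=> y /=; rewrite inE ge_min => /predU1P[->|/h ->]; rewrite ?lexx ?orbT.
Qed.
Theorem theorem5p20 (R : realType) (n : nat) (Omega : set 'rV[R]_n)
    (s1 s2 p1 p2 : R) :
  (0 < n)%N ->
  Omega !=set0 -> open Omega -> interior_lipschitz Omega ->
  1 < p1 -> 1 < p2 ->
  (forall U : set 'rV[R]_n, bounded_lipschitz U ->
     sobolev_embedding U s1 p1 s2 p2) ->
  (s1 < 0 -> smooth_mult_triple Omega (- s1) (conj_exp p1)) ->
  (s2 < 0 -> smooth_mult_triple Omega (- s2) (conj_exp p2)) ->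
  sobolev_loc_embedding Omega s1 p1 s2 p2.
Proof.
move=> _ _ oO lipO p1_gt1 p2_gt1 emb _ smt2.
(* For each [phi], one Lipschitz set around its support and one constant serve both comparisons; the
   constant is uniform in [w], which continuity will use. *)
have local (phi : testfun Omega) : exists (U : set 'rV[R]_n) (UO : U `<=` Omega),
    bounded_lipschitz U /\ exists2 C : R, 0 < C & forall w : testfun Omega -> R^o, linear w ->
    (sobolev_norm s1 p1 (dist_restrict UO (dist_mul phi w)) <=
       C%:E * sobolev_norm s1 p1 (dist_mul phi w))%E /\
    (sobolev_norm s2 p2 (dist_mul phi w) <=
       C%:E * sobolev_norm s2 p2 (dist_restrict UO (dist_mul phi w)))%E.
  have [_ csphi sphiO] := testfunP phi.
  have [U [bU UO sphiU]] := lipO _ csphi sphiO; exists U, UO; split=> //.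
  have [oU _ _] := bU.
  have [chi [tchi _ chi1]] := exists_cutoff oU csphi sphiU.
  have tchi' : (chi : 'rV[R]_n -> R^o) \in test_pred U by rewrite inE.
  have [C C0 hC] := @sobolev_norm_dist_restrict _ _ _ _ oU oO UO phi (TestFun tchi') chi1 s1 p1 p1_gt1.
  have [E E0 hE] := @sobolev_norm_dist_extend _ _ _ _ oU oO UO phi (TestFun tchi') chi1 s2 p2 p2_gt1 smt2.
  have nonneg (W : set 'rV[R]_n) (oW : open W) s p (u : testfun W -> R^o) : 1 < p -> (0 <= sobolev_norm s p u)%E.
    move=> p_gt1; rewrite /sobolev_norm; have [s0|s0] := leP 0 s.
      by apply: sobolev_norm_nneg_ge0; apply: lt_trans p_gt1.
    apply/ereal_infP => _ [F _ <-]; apply: dual_norm_ge0 => //.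
      by rewrite oppr_ge0 ltW.
    exact: conj_exp_gt1.
  exists (C + E); first exact: addr_gt0.
  move=> w lw; split.
    rewrite (le_trans (hC w lw))// lee_wpmul2r ?nonneg// lee_fin lerDl; exact: ltW.
  rewrite (le_trans (hE w lw))// lee_wpmul2r ?nonneg// lee_fin lerDr; exact: ltW.
have sob1 (phi : testfun Omega) U (UO : U `<=` Omega) C u : 0 < C -> sobolev_loc s1 p1 u ->
    (sobolev_norm s1 p1 (dist_restrict UO (dist_mul phi u)) <=
       C%:E * sobolev_norm s1 p1 (dist_mul phi u))%E ->
    sobolev s1 p1 (dist_restrict UO (dist_mul phi u)).
  move=> C0 [_ /(_ phi)[du noo]] h; split; first exact: distributions_restrict.
  apply: le_lt_trans h _; apply: lte_mul_pinfty; rewrite ?lee_fin ?(ltW C0)//.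
have sub : @sobolev_loc _ _ Omega s1 p1 `<=` @sobolev_loc _ _ Omega s2 p2.
  move=> u u1; have [[lu bu] u2] := u1; split=> // phi; split; first by case: (u2 phi).
  have [U [UO [bU [C C0 /(_ u lu)[h1 h2]]]]] := local phi.
  have [sU _] := emb U bU; have [_ noo] := sU _ (sob1 _ _ _ _ _ C0 u1 h1).
  apply: le_lt_trans h2 _; apply: lte_mul_pinfty; rewrite ?lee_fin ?(ltW C0)//.
split=> // u Y u1 [F [finF [e [e0 FY]]]].
(* Each target seminorm is controlled by the source seminorm with the same [phi]. *)
have ball (phi : testfun Omega) : exists d : R, 0 < d /\
    forall v : testfun Omega -> R^o, sobolev_loc s1 p1 v ->
    (sobolev_norm s1 p1 (dist_mul phi (v - u)%R) < d%:E)%E ->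
    (sobolev_norm s2 p2 (dist_mul phi (v - u)%R) < e%:E)%E.
  have [U [UO [bU [C C0 h]]]] := local phi.
  have [[lu _] _] := u1; have [_ cont] := emb U bU.
  pose res v := dist_restrict UO (dist_mul phi v).
  have resu : sobolev s1 p1 (res u) by apply: (sob1 phi U UO C u C0 u1); exact: (h u lu).1.
  (* Continuity of the embedding on [U] at [res u], asked for radius e/C because returning to
     [Omega] multiplies by C. *)
  have [//|F' [_ [d [d0 dP]]]] := cont (res u)
    [set z | (sobolev_norm s2 p2 (z - res u)%R < (e / C)%:E)%E] resu.
    exists [set tt]; split; first exact: finite_set1.
    by exists (e / C); split; [exact: divr_gt0|move=> v _ /(_ tt); exact].
  (* Restricting from [Omega] to [U] multiplies by C as well, hence the radius d/C. *)
  exists (d / C); split; first exact: divr_gt0.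
  move=> v v1 vu; have [[lv _] _] := v1.
  have lvu : linear (v - u)%R.
    move=> a f g; transitivity (v (a *: f + g) - u (a *: f + g)) => //.
    by rewrite lv lu scalerBr opprD addrACA.
  have [h1 h2] := h _ lvu; apply: (le_lt_trans h2).
  have resv : sobolev s1 p1 (res v) by apply: (sob1 phi U UO C v C0 v1); exact: (h v lv).1.
  have : (sobolev_norm s2 p2 (res v - res u)%R < (e / C)%:E)%E.
    (* By definition [res v - res u] is the restriction of [phi (v - u)], to which [h1] applies. *)
    apply: dP => // _ _; apply: (le_lt_trans h1).
    by rewrite -lte_pdivlMl// -EFinM mulrC.
  by rewrite -lte_pdivlMl// -EFinM mulrC.
(* A neighbourhood involves finitely many [phi], so the same index set with the smallest of the
   radii works. *)
have [d dP] := choice ball.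
have [d' d0 dF] := finite_set_lbound finF (fun phi => (dP phi).1).
exists F; split=> //; exists d'; split=> // v v1 vu; apply: FY; first exact: sub.
move=> phi Fphi; apply: (dP phi).2 => //; apply: lt_le_trans (vu phi Fphi) _.
by rewrite lee_fin dF.
Qed.
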